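(* For every integer $m\geq 2$ and every integer $n\geq 1$ there exists a simple $m$-dimensional $n$-Venn diagram.
   Context: An $m$-space is a subset of a Euclidean space that can be transformed continuously (homeomorphically) onto an $m$-dimensional rectangle (bounded case) or onto an $m$-dimensional subspace (unbounded case). An $m$-surface is a subset of an $m$-space homeomorphic to the $(m-1)$-dimensional sphere; by convention an $m$-surface is the empty set when $m\leq 0$. For an $m$-surface $S$, $S^0$ denotes its interior and $S^1$ its exterior. Given $m$-surfaces $S_1,\ldots,S_n$ in an $m$-space $S$, the regions are the sets $S_1^{\varepsilon_1}\cap\cdots\cap S_n^{\varepsilon_n}$ with $\varepsilon_i\in\{0,1\}$. The set $\{S_1,\ldots,S_n\}$ is an $m$-dimensional Venn diagram ($n$-Venn diagram) if all $2^n$ regions are non-empty and connected and each can be transformed continuously onto the interior or exterior of an $m$-surface, and the intersection of any two of the surfaces is a union of finitely many $(m-1)$-surfaces. It is a simple Venn diagram if, for every $k$, the intersection of any $k$ of the surfaces is a union of finitely many $(m-k+1)$-surfaces. *)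

(* Defs.v *)
From HB Require Import structures.
From mathcomp Require Import all_boot all_order all_algebra.
From mathcomp Require Import all_classical all_reals all_analysis.
Set Implicit Arguments.
Unset Strict Implicit.
Unset Printing Implicit Defensive.
Import Order.TTheory GRing.Theory Num.Theory.
Import numFieldNormedType.Exports.
Local Open Scope classical_set_scope.
Local Open Scope ring_scope.

Definition homeomorphism (T U : topologicalType) (A : set T) (B : set U)
    (f : T -> U) (g : U -> T) : Prop :=
  [/\ {within A, continuous f} /\ {within B, continuous g},
      set_fun A B f /\ set_fun B A g,
      {in A, cancel f g} & {in B, cancel g f}].

Definition homeomorphic (T U : topologicalType) (A : set T) (B : set U) : Prop :=
  exists f g, homeomorphism A B f g.

Definition is_rectangle (R : realType) (m : nat) (M : set 'rV[R]_m) : Prop :=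
  exists a b : 'rV[R]_m, (forall i, a 0 i < b 0 i) /\
    M = [set x | forall i, a 0 i <= x 0 i <= b 0 i].

(* Up to a linear homeomorphism, the only m-dimensional linear subspace is R^m
   itself, which serves as the model of the unbounded case. *)
Definition space_model (R : realType) (m : nat) (M : set 'rV[R]_m) : Prop :=
  M = setT \/ is_rectangle M.

Definition is_mspace (R : realType) (m N : nat) (X : set 'rV[R]_N) : Prop :=
  exists2 M : set 'rV[R]_m, space_model M & homeomorphic X M.

(* The (m-1)-dimensional unit sphere, sitting in R^m. *)
Definition usphere (R : realType) (m : nat) : set 'rV[R]_m :=
  [set x | \sum_(i < m) x 0 i ^+ 2 = 1].

(* Dimensions below 0 do not occur as arguments: they are truncated to 0, where
   the same convention (an m-surface is empty for m <= 0) applies. *)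
Definition is_msurface (R : realType) (m N : nat) (A : set 'rV[R]_N) : Prop :=
  if m is 0%N then A = set0
  else (exists2 X : set 'rV[R]_N, is_mspace m X & A `<=` X) /\
       homeomorphic A (@usphere R m).

(* The two sides in R^m of a subset K: the points of the complement lying in a
   bounded (b = false) or unbounded (b = true) connected component. *)
Definition model_side (R : realType) (m : nat) (K : set 'rV[R]_m) (b : bool) :
    set 'rV[R]_m :=
  [set y | ~ K y /\
     if b then ~ bounded_set (connected_component (~` K) y)
     else bounded_set (connected_component (~` K) y)].

(* Interior S^0 (b = false) and exterior S^1 (b = true) of a surface S in the
   m-space X. They are read in R^m through a homeomorphism phi from X onto R^m
   or onto a rectangle. The complement of the image of S is taken in the whole
   of R^m, also for a rectangle, so that a surface touching the boundary of the
   rectangle is covered. By invariance of domain the result does not depend on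
   phi. *)
Definition side (R : realType) (m N : nat) (X : set 'rV[R]_N)
    (phi : 'rV[R]_N -> 'rV[R]_m) (S : set 'rV[R]_N) (b : bool) : set 'rV[R]_N :=
  X `&` phi @^-1` model_side (phi @` S) b.

Definition region (R : realType) (m N n : nat) (X : set 'rV[R]_N)
    (phi : 'rV[R]_N -> 'rV[R]_m) (S : 'I_n -> set 'rV[R]_N)
    (eps : 'I_n -> bool) : set 'rV[R]_N :=
  \bigcap_(i in [set: 'I_n]) side X phi (S i) (eps i).

Definition finite_union_msurfaces (R : realType) (m N : nat)
    (A : set 'rV[R]_N) : Prop :=
  exists (p : nat) (F : 'I_p -> set 'rV[R]_N),
    (forall i, is_msurface m (F i)) /\ A = \bigcup_(i in [set: 'I_p]) F i.

(* Distinctness of the S i need not be required: if S i = S j with i != j, the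
   regions with eps i != eps j are empty. *)
Definition is_venn (R : realType) (m n N : nat) (X : set 'rV[R]_N)
    (S : 'I_n -> set 'rV[R]_N) : Prop :=
  exists (M : set 'rV[R]_m) (phi : 'rV[R]_N -> 'rV[R]_m)
         (psi : 'rV[R]_m -> 'rV[R]_N),
  [/\ space_model M /\ homeomorphism X M phi psi,
      forall i, is_msurface m (S i) /\ S i `<=` X,
      forall eps : 'I_n -> bool,
        [/\ region X phi S eps !=set0,
            connected (region X phi S eps) &
            exists (T : set 'rV[R]_N) (b : bool),
              [/\ is_msurface m T, T `<=` X &
                  homeomorphic (region X phi S eps) (side X phi T b)]] &
      forall i j : 'I_n, i != j ->
        finite_union_msurfaces m.-1 (S i `&` S j)].

(* The truncated m.+1 - k is m - k + 1 for k <= m + 1 and 0 for larger k. *)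
Definition is_simple_venn (R : realType) (m n N : nat) (X : set 'rV[R]_N)
    (S : 'I_n -> set 'rV[R]_N) : Prop :=
  is_venn m X S /\
  forall (k : nat) (A : {set 'I_n}), (1 <= k)%N -> #|A| = k ->
    finite_union_msurfaces (m.+1 - k)%N (\bigcap_(i in [set` A]) S i).

(* Main.v *)
Require Import Defs.
From HB Require Import structures.
From mathcomp Require Import all_boot all_order all_algebra.
From mathcomp Require Import all_classical all_reals all_analysis.
From mathcomp Require Import ring lra.

(* Call a family f_0, ..., f_(n-1) of functions on R^(m-1) good when every cell
   of the arrangement of its graphs is an open ball. Write points of R^(m-1) as
   (x, z) with x real. A good family is enlarged by composing it with the fold
   x |-> |x| - X - 1, which doubles the arrangement, and adding a function which
   is very steep near the fold x = 0: its graph cuts every doubled cell into the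
   two copies of the old one. All functions depend on z near the fold only
   through |z|, which makes the set where two of them agree a union of spheres
   that are bodies of revolution around the x-axis.
   In the last step the space of directions of R^m is folded in the same way
   along an equator. The functions then become the radii of star-shaped
   hypersurfaces, the last of which is steep across the equator, and the
   regions lying inside some of the surfaces and outside others are again
   copies of the cells of the family. *)

Set Implicit Arguments.
Unset Strict Implicit.
Unset Printing Implicit Defensive.
Import Order.TTheory GRing.Theory Num.Theory.
Import numFieldNormedType.Exports.
Local Open Scope classical_set_scope.
Local Open Scope ring_scope.

Section Homeomorphisms.
Context {T U V : topologicalType}.

Lemma homeomorphicI (A : set T) (B : set U) (f : T -> U) (g : U -> T) :
  (forall x, A x -> {for x, continuous f}) ->
  (forall y, B y -> {for y, continuous g}) ->
  (forall x, A x -> B (f x)) -> (forall y, B y -> A (g y)) ->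
  (forall x, A x -> g (f x) = x) -> (forall y, B y -> f (g y) = y) ->
  homeomorphic A B.
Proof.
move=> cf cg fAB gBA gf fg; exists f, g; split.
- by split; apply: continuous_in_subspaceT => x /set_mem; [exact: cf|exact: cg].
- by split => x; [exact: fAB|exact: gBA].
- by move=> x /set_mem; exact: gf.
- by move=> y /set_mem; exact: fg.
Qed.

Lemma homeomorphic_sym (A : set T) (B : set U) :
  homeomorphic A B -> homeomorphic B A.
Proof.
by move=> [f [g [[cf cg] [fAB gBA] gf fg]]]; exists g, f.
Qed.

Lemma within_continuous_trans (A : set T) (B : set U) (f : T -> U) (g : U -> V) :
  {within A, continuous f} -> {within B, continuous g} ->
  (forall x, A x -> B (f x)) -> {within A, continuous (g \o f)}.
Proof.
move=> /(@subspace_continuousP _ A _ f) cf /(@subspace_continuousP _ B _ g) cg fAB.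
apply/(@subspace_continuousP _ A _ (g \o f)) => x Ax W Wgf.
have := cg _ (fAB _ Ax) W Wgf; rewrite /= /nbhs /= => {}Wgf.
have := cf _ Ax _ Wgf; rewrite /nbhs /= /within /=.
move=> H0; apply: (@filterS _ (nbhs x) _ _ _ _ H0) => y H Ay.
by apply: H => //; exact: fAB.
Qed.

End Homeomorphisms.

Lemma homeomorphic_refl (T : topologicalType) (A : set T) : homeomorphic A A.
Proof. by apply: (@homeomorphicI T T A A id id) => // x _; exact: cvg_id. Qed.

Lemma homeomorphic_trans (T U V : topologicalType) (A : set T) (B : set U)
    (C : set V) : homeomorphic A B -> homeomorphic B C -> homeomorphic A C.
Proof.
move=> [f [g [[cf cg] [fAB gBA] gf fg]]] [f' [g' [[cf' cg'] [fBC gCB] gf' fg']]].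
exists (f' \o f), (g \o g'); split.
- by split; [exact: (within_continuous_trans cf cf')|
             exact: (within_continuous_trans cg' cg)].
- by split => x ? /=; [exact/fBC/fAB|exact/gBA/gCB].
- move=> x /set_mem Ax /=; rewrite gf' ?gf ?inE //; exact: fAB.
- move=> x /set_mem Ax /=; rewrite fg ?fg' ?inE //; exact: gCB.
Qed.

Lemma homeomorphic_connected (T U : topologicalType) (A : set T) (B : set U) :
  homeomorphic A B -> connected A -> connected B.
Proof.
move=> [f [g [[cf cg] [fAB gBA] gf fg]]] cA.
rewrite (_ : B = f @` A); first exact: connected_continuous_connected.
apply/seteqP; split => [y By|_ [x Ax <-]]; last exact: fAB.
by exists (g y); [exact: gBA|rewrite fg ?inE].
Qed.

Lemma homeomorphic_nonempty (T U : topologicalType) (A : set T) (B : set U) :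
  homeomorphic A B -> A !=set0 -> B !=set0.
Proof.
by move=> [f [g [[cf cg] [fAB gBA] gf fg]]] [x Ax]; exists (f x); exact: fAB.
Qed.

Section PointwiseContinuity.
Context {R : realType} {T : topologicalType}.
Implicit Types (f g : T -> R) (x : T).

Lemma contD f g x : {for x, continuous f} -> {for x, continuous g} ->
  {for x, continuous (fun y => f y + g y)}.
Proof. by move=> cf cg; apply: (@cvgD R R^o). Qed.
Lemma contN f x : {for x, continuous f} -> {for x, continuous (fun y => - f y)}.
Proof. by move=> cf; apply: (@cvgN R R^o). Qed.
Lemma contM f g x : {for x, continuous f} -> {for x, continuous g} ->
  {for x, continuous (fun y => f y * g y)}.
Proof. by move=> cf cg; apply: cvgM. Qed.
Lemma contV f x : {for x, continuous f} -> f x != 0 ->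
  {for x, continuous (fun y => (f y)^-1)}.
Proof. by move=> cf cg; apply: cvgV. Qed.
Lemma cont_max f g x : {for x, continuous f} -> {for x, continuous g} ->
  {for x, continuous (fun y => Num.max (f y) (g y))}.
Proof. by move=> cf cg; exact: continuous_max. Qed.
Lemma cont_min f g x : {for x, continuous f} -> {for x, continuous g} ->
  {for x, continuous (fun y => Num.min (f y) (g y))}.
Proof. by move=> cf cg; exact: continuous_min. Qed.
Lemma cont_cst (U : topologicalType) (a : U) x :
  {for x, continuous (fun _ : T => a)}.
Proof. exact: cvg_cst. Qed.
Lemma cont_norm (W : normedModType R) (f : T -> W) x : {for x, continuous f} ->
  {for x, continuous (fun y => `|f y|)}.
Proof. by move=> cf; exact: cvg_norm. Qed.
Lemma contZ (W : normedModType R) f (g : T -> W) x :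
  {for x, continuous f} -> {for x, continuous g} ->
  {for x, continuous (fun y => f y *: g y)}.
Proof. by move=> cf cg; exact: cvgZ. Qed.
Lemma cont_pair (U V : topologicalType) (f : T -> U) (g : T -> V) x :
  {for x, continuous f} -> {for x, continuous g} ->
  {for x, continuous (fun y => (f y, g y))}.
Proof. by move=> cf cg; exact: cvg_pair. Qed.
Lemma cont_fst (U V : topologicalType) (f : T -> U * V) x :
  {for x, continuous f} -> {for x, continuous (fun y => (f y).1)}.
Proof. by move=> cf; apply: (continuous_comp cf); exact: cvg_fst. Qed.
Lemma cont_snd (U V : topologicalType) (f : T -> U * V) x :
  {for x, continuous f} -> {for x, continuous (fun y => (f y).2)}.
Proof. by move=> cf; apply: (continuous_comp cf); exact: cvg_snd. Qed.
Lemma cont_comp (U V : topologicalType) (h : U -> V) (f : T -> U) x :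
  continuous h -> {for x, continuous f} -> {for x, continuous (fun y => h (f y))}.
Proof. by move=> ch cf; apply: (continuous_comp cf); exact: ch. Qed.
Lemma cont_comp_at (U V : topologicalType) (h : U -> V) (f : T -> U) x :
  {for x, continuous f} -> {for f x, continuous h} ->
  {for x, continuous (fun y => h (f y))}.
Proof. exact: continuous_comp. Qed.
Lemma cont_coord m n (f : T -> 'M[R]_(m, n)) i j x :
  {for x, continuous f} -> {for x, continuous (fun y => f y i j)}.
Proof.
move=> cf; apply: (@continuous_comp _ _ _ f (fun M : 'M[R]_(m, n) => M i j)) => //.
exact: coord_continuous.
Qed.
Lemma cont_mx m n (f : T -> 'M[R]_(m, n)) x :
  (forall i j, {for x, continuous (fun y => f y i j)}) -> {for x, continuous f}.
Proof.
move=> cf W [P fP PW]; rewrite /nbhs /=.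
have fT := @nbhs_filter T x.
have H := @filter_forall T 'I_m (fun i y => forall j, P i j (f y i j)) (nbhs x) fT
  (fun i => @filter_forall T 'I_n (fun j y => P i j (f y i j)) (nbhs x) fT
    (fun j => cf i j _ (fP i j))).
by apply: (@filterS _ (nbhs x) _ _ _ _ H) => y Hy; exact: PW.
Qed.
Lemma cont_near (U : topologicalType) (f g : T -> U) x :
  (\forall y \near x, f y = g y) -> {for x, continuous g} -> {for x, continuous f}.
Proof.
move=> fg cg W; rewrite (nbhs_singleton fg) => /cg; rewrite /nbhs /= => Wg.
by apply: (@filterS2 _ (nbhs x) _ _ _ _ _ fg Wg) => y /= ->.
Qed.

End PointwiseContinuity.

Lemma forall_cont (T U : topologicalType) (f : T -> U) :
  (forall x, {for x, continuous f}) -> continuous f.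
Proof. by []. Qed.

(* Plain unification fails to find the functions in the goals about sums,
   products, etc. of functions given by lambda terms: they are abstracted here. *)
Ltac cont1 :=
  lazymatch goal with
  | |- prop_for ?x (inPhantom (continuous ?f)) =>
    lazymatch f with
    | (fun p => @GRing.add _ (@?a p) (@?b p)) => apply: (@contD _ _ a b)
    | (fun p => @GRing.opp _ (@?a p)) => apply: (@contN _ _ a)
    | (fun p => @GRing.mul _ (@?a p) (@?b p)) => apply: (@contM _ _ a b)
    | (fun p => @GRing.inv _ (@?a p)) => apply: (@contV _ _ a)
    | (fun p => @Order.max _ _ (@?a p) (@?b p)) => apply: (@cont_max _ _ a b)
    | (fun p => @Order.min _ _ (@?a p) (@?b p)) => apply: (@cont_min _ _ a b)
    | (fun p => @Num.norm _ _ (@?a p)) => apply: (@cont_norm _ _ _ a)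
    | (fun p => @GRing.scale _ _ (@?a p) (@?b p)) => apply: (@contZ _ _ _ a b)
    | (fun p => (@?a p, @?b p)) => apply: (@cont_pair _ _ _ a b)
    | (fun p => p) => exact: cvg_id
    | (fun p => (@?a p).1) => apply: (@cont_fst _ _ _ a)
    | (fun p => (@?a p).2) => apply: (@cont_snd _ _ _ a)
    | (fun p => ?a) => exact: cont_cst
    end
  end.
Ltac cont := repeat cont1.

Section PushPull.
Context {R : realType}.
Implicit Types a x y : R.

(* [push a] maps ]a, +oo[ onto R and is the translation by -1 on [1, +oo[. *)
Definition push a x : R := Num.max (x - 1) 0 - Num.max (1 - x) 0 / (x - a).
Definition pull a y : R := Num.max y 0 + a + (1 - a) / (1 + Num.max (- y) 0).

Lemma push_ge a x : 1 <= x -> push a x = x - 1.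
Proof.
move=> x1; rewrite /push max_l ?subr_ge0// max_r ?subr_le0//.
by rewrite mul0r subr0.
Qed.

Lemma push_lt a x : a < x -> x < 1 -> push a x = (x - 1) / (x - a).
Proof.
move=> ax x1; rewrite /push max_r ?subr_le0 ?ltW// max_l ?subr_ge0 ?ltW//.
by rewrite sub0r -mulNr opprB.
Qed.

Lemma push_lt0 a x : a < x -> x < 1 -> push a x < 0.
Proof.
by move=> ax x1; rewrite push_lt// pmulr_llt0 ?invr_gt0 ?subr_gt0// subr_lt0.
Qed.

Lemma pull_ge a y : 0 <= y -> pull a y = y + 1.
Proof.
move=> y0; rewrite /pull max_l// max_r ?oppr_le0// addr0 divr1; lra.
Qed.

Lemma pull_lt a y : y < 0 -> pull a y = a + (1 - a) / (1 - y).
Proof.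
by move=> y0; rewrite /pull max_r ?ltW// max_l ?oppr_ge0 ?ltW// add0r.
Qed.

Lemma pull_lt1 a y : a < 1 -> y < 0 -> pull a y < 1.
Proof.
move=> a1 y0; rewrite pull_lt// -ltrBrDl ltr_pdivrMr; last lra.
by rewrite ltr_pMr ?subr_gt0//; lra.
Qed.

Lemma pull_gt a y : a < 1 -> a < pull a y.
Proof.
move=> a1; have [y0|y0] := leP 0 y; first by rewrite pull_ge//; lra.
by rewrite pull_lt// ltrDl divr_gt0//; lra.
Qed.

Lemma pushK a x : a < 1 -> a < x -> pull a (push a x) = x.
Proof.
move=> a1 ax; have [x1|x1] := leP 1 x.
  by rewrite push_ge// pull_ge ?subr_ge0// subrK.
rewrite pull_lt ?push_lt0// push_lt//; field; apply/andP; split.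
  by apply/eqP; lra.
by apply/eqP; lra.
Qed.

Lemma pullK a y : a < 1 -> push a (pull a y) = y.
Proof.
move=> a1; have [y0|y0] := leP 0 y.
  by rewrite pull_ge// push_ge ?addrK// lerDr.
rewrite push_lt ?pull_gt ?pull_lt1// pull_lt//; field; apply/andP; split.
  by apply/eqP; lra.
by apply/eqP; lra.
Qed.

End PushPull.

Section Fold.
Context {R : realType} {d : nat}.
Local Notation Y := (R * 'rV[R]_d)%type.
Variables (W : set (Y * R)) (X M : R).
Hypotheses (X0 : 0 < X) (M0 : 0 < M).
Hypothesis W_collar : forall (x x' : R) (z : 'rV[R]_d) (t : R), x <= - X -> x' <= - X ->
  W ((x, z), t) -> W ((x', z), t).
Hypothesis W_far : forall (x x' : R) (z z' : 'rV[R]_d) (t : R), X <= `|z| -> X <= `|z'| ->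
  W ((x, z), t) -> W ((x', z'), t).
Hypothesis W_bound : forall (y : Y) (t : R), W (y, t) -> `|t| < M.

Definition hgt (t : R) := X + (t + M) / (2 * M).

Lemma slope_lt1 t : `|t| < M -> -1 < t / M < 1.
Proof.
by rewrite ltr_norml => /andP[? ?]; rewrite ltr_pdivlMr// ltr_pdivrMr//; apply/andP; lra.
Qed.

Lemma hgt_gt t : `|t| < M -> X < hgt t.
Proof.
rewrite ltr_norml => /andP[? ?]; rewrite /hgt ltrDl divr_gt0//; lra.
Qed.

Lemma fold_push (a x : R) (z z' : 'rV[R]_d) (t : R) :
  a < 1 -> a < x -> - 1 < a /\ z = z' \/ X <= `|z| /\ X <= `|z'| ->
  W ((`|x| - X - 1, z), t) <-> W ((push a x - X, z'), t).
Proof.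
move=> a1 ax [[a1' <-]|[zX z'X]]; last by split; exact: W_far.
have [x1|x1] := leP 1 x.
  by rewrite push_ge// ger0_norm ?(le_trans _ x1)// -!addrA [- X - 1]addrC.
have := push_lt0 ax x1 => p0.
have : `|x| < 1 by rewrite ltr_norml; apply/andP; lra.
by move=> x1'; split; apply: W_collar; lra.
Qed.

Lemma cont_push (T : topologicalType) (a x : T -> R) (p : T) :
  {for p, continuous a} -> {for p, continuous x} -> x p - a p != 0 ->
  {for p, continuous (fun q => push (a q) (x q))}.
Proof. by move=> ca cx xa; rewrite /push; cont. Qed.

Lemma cont_pull (T : topologicalType) (a y : T -> R) (p : T) :
  {for p, continuous a} -> {for p, continuous y} ->
  {for p, continuous (fun q => pull (a q) (y q))}.
Proof.
move=> ca cy; rewrite /pull; cont => //.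
by apply: lt0r_neq0; rewrite ltr_wpDr// le_max lexx orbT.
Qed.

Lemma cont_hgt (T : topologicalType) (t : T -> R) (p : T) :
  {for p, continuous t} -> {for p, continuous (fun q => hgt (t q))}.
Proof. by move=> ct; rewrite /hgt; cont => //; rewrite mulf_neq0 ?gt_eqF. Qed.

(* The L-shaped part of the plane where x > t/M or |z| > hgt t is first turned
   into the set x > lslope z t by stretching z on the left. *)
Let stretch (x t : R) := 1 + Num.max 0 (t / M - x).
Let lslope (z : 'rV[R]_d) (t : R) := t / M + 1 - Num.max 1 (`|z| / hgt t).

Let stretch_gt0 (x t : R) : 0 < stretch x t.
Proof. by rewrite /stretch ltr_wpDr// le_max lexx. Qed.

Let lslope_le (z : 'rV[R]_d) (t : R) : lslope z t <= t / M.
Proof. by rewrite /lslope -addrA gerDl subr_le0 le_max lexx. Qed.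

Let lslope_stretch (x : R) (z : 'rV[R]_d) (t : R) : `|t| < M ->
  (lslope (stretch x t *: z) t < x) <-> (t / M < x \/ hgt t < `|z|).
Proof.
move=> tM; have h0 : 0 < hgt t := lt_trans X0 (hgt_gt tM).
have [xt|xt] := ltP (t / M) x.
  by split=> _; [left|exact: le_lt_trans (lslope_le _ _) xt].
rewrite /lslope /stretch [Num.max 0 _]max_r ?subr_ge0// normrZ gtr0_norm; last first.
  by rewrite ltr_pwDl// subr_ge0.
have -> : (t / M + 1 - Num.max 1 ((1 + (t / M - x)) * `|z| / hgt t) < x) =
    (1 + (t / M - x) < Num.max 1 ((1 + (t / M - x)) * `|z| / hgt t)).
  by rewrite -subr_gt0 -[in RHS]subr_gt0; congr (0 < _); ring.
rewrite lt_max ltNge lerDl subr_ge0 xt/= -mulrA ltr_pMr ?ltr_pdivlMr ?mul1r//;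
  last by rewrite ltr_pwDl// subr_ge0.
by split => [|[]]; [right| |].
Qed.

Let lslope_case (x : R) (z : 'rV[R]_d) (t : R) : `|t| < M -> lslope (stretch x t *: z) t < x ->
  - 1 < lslope (stretch x t *: z) t /\ z = stretch x t *: z \/
  X <= `|z| /\ X <= `|stretch x t *: z|.
Proof.
move=> tM xs; have hX := hgt_gt tM; have h0 := lt_trans X0 hX.
have [zh|zh] := leP `|z| (hgt t); last first.
  right; split; first by rewrite ltW// (lt_trans hX).
  rewrite normrZ gtr0_norm// ltW// (lt_le_trans (lt_trans hX zh))// ler_peMl//.
  by rewrite /stretch lerDl le_max lexx.
left; move/(lslope_stretch x z tM) : xs => [xt|]; last by rewrite ltNge zh.
have s1 : stretch x t = 1 by rewrite /stretch max_l ?addr0// subr_le0 ltW.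
rewrite s1 scale1r; split => //.
rewrite /lslope max_l ?addrK ?ler_pdivrMr ?mul1r//.
by case/andP: (slope_lt1 tM).
Qed.

Lemma fold_up : homeomorphic
  [set p : Y * R | W ((`|p.1.1| - X - 1, p.1.2), p.2) /\
    (p.2 / M < p.1.1 \/ hgt p.2 < `|p.1.2|)] W.
Proof.
pose F := fun p : Y * R =>
  ((push (lslope (stretch p.1.1 p.2 *: p.1.2) p.2) p.1.1 - X,
    stretch p.1.1 p.2 *: p.1.2), p.2).
pose B := fun p : Y * R => pull (lslope p.1.2 p.2) (p.1.1 + X).
pose G := fun p : Y * R => ((B p, (stretch (B p) p.2)^-1 *: p.1.2), p.2).
have lslope1 (z : 'rV[R]_d) (t : R) : `|t| < M -> lslope z t < 1.
  by move=> /slope_lt1/andP[_]; apply: le_lt_trans (lslope_le _ _).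
have h_neq0 (t : R) : `|t| < M -> hgt t != 0.
  by move=> tM; rewrite gt_eqF// (lt_trans X0)// hgt_gt.
have c_lslope (T : topologicalType) (z : T -> 'rV[R]_d) (t : T -> R) q :
    {for q, continuous z} -> {for q, continuous t} -> `|t q| < M ->
    {for q, continuous (fun q => lslope (z q) (t q))}.
  move=> cz ct tM; rewrite /lslope; cont => //; first exact: lt0r_neq0.
    exact: cont_hgt.
  exact: h_neq0.
have cB (p : Y * R) : `|p.2| < M -> {for p, continuous B}.
  move=> tM.
  apply: (@cont_pull _ (fun q : Y * R => lslope q.1.2 q.2) (fun q => q.1.1 + X));
    last by cont.
  by apply: (c_lslope _ (fun q : Y * R => q.1.2) (fun q => q.2)); [cont|cont|].
apply: (@homeomorphicI _ _ _ _ F G).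
- move=> [[x z] t] /= [/W_bound tM /(lslope_stretch x z tM) xs].
  have cs : {for ((x, z), t), continuous (fun p : Y * R => stretch p.1.1 p.2)}.
    by rewrite /stretch; cont; exact: lt0r_neq0.
  rewrite /F; cont1; last by cont.
  cont1; last by cont.
  cont1; last by cont.
  apply: (@cont_push _ (fun q : Y * R => lslope (stretch q.1.1 q.2 *: q.1.2) q.2)
    (fun q => q.1.1)); [|by cont|by rewrite subr_eq0 gt_eqF].
  by apply: (c_lslope _ (fun q : Y * R => stretch q.1.1 q.2 *: q.1.2)
    (fun q => q.2)); [cont|cont|].
- move=> [[x z] t] /= /W_bound tM; have {}cB := cB ((x, z), t) tM.
  rewrite /G; cont1; last by cont.
  cont1; first exact: cB.
  apply: (@contZ _ _ _ (fun q : Y * R => (stretch (B q) q.2)^-1)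
    (fun q => q.1.2)); last by cont.
  apply: (@contV _ _ (fun q : Y * R => stretch (B q) q.2)); last by rewrite gt_eqF.
  by rewrite /stretch; cont; first [exact: lt0r_neq0|exact: cB].
- move=> [[x z] t] /= [Wp].
  have tM := W_bound Wp; move/(lslope_stretch x z tM) => xs.
  exact: ((fold_push t (lslope1 _ _ tM) xs (lslope_case tM xs)).1 Wp).
- move=> [[x z] t] /= Wp; have tM := W_bound Wp.
  have l1 := lslope1 z t tM.
  rewrite /G /B/=; set b := pull _ _; set z' := _ *: _.
  have zE : z = stretch b t *: z' by rewrite scalerA divff ?scale1r ?gt_eqF.
  have bl : lslope (stretch b t *: z') t < b by rewrite -zE; exact: pull_gt.
  split; last exact/(lslope_stretch b z' tM).
  suff W' : W ((push (lslope (stretch b t *: z') t) b - X, stretch b t *: z'), t).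
    by apply: ((fold_push t _ bl (lslope_case tM bl)).2 W'); rewrite -zE.
  by rewrite -zE pullK// addrK.
- move=> [[x z] t] /= [/W_bound tM /(lslope_stretch x z tM) xs].
  rewrite /G /F /B/= subrK pushK//; last exact: lslope1.
  by rewrite scalerA mulVf ?scale1r ?gt_eqF.
- move=> [[x z] t] /= /W_bound tM; have l1 := lslope1 z t tM.
  rewrite /F /G/=; have s0 := stretch_gt0 (B ((x, z), t)) t.
  by rewrite scalerA divff ?gt_eqF// scale1r /B/= pullK// addrK.
Qed.

Let narrow (z : 'rV[R]_d) (t : R) :=
  (hgt t - X) / (hgt t - X - Num.max 0 (`|z| - X)).
Let widen (z : 'rV[R]_d) (t : R) :=
  1 - Num.max 0 (`|z| - X) / (hgt t - X + `|z|).

Lemma fold_down : homeomorphic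
  [set p : Y * R | W ((`|p.1.1| - X - 1, p.1.2), p.2) /\
    (p.1.1 < p.2 / M /\ `|p.1.2| < hgt p.2)] W.
Proof.
pose F := fun p : Y * R =>
  ((push (- (p.2 / M)) (- p.1.1) - X, narrow p.1.2 p.2 *: p.1.2), p.2).
pose G := fun p : Y * R =>
  ((- pull (- (p.2 / M)) (p.1.1 + X), widen p.1.2 p.2 *: p.1.2), p.2).
have a1 (t : R) : `|t| < M -> -1 < - (t / M) < 1.
  by move=> /slope_lt1/andP[? ?]; apply/andP; lra.
have hX (t : R) : `|t| < M -> 0 < hgt t - X by move=> tM; rewrite subr_gt0 hgt_gt.
have kz_gt0 (z : 'rV[R]_d) (t : R) : `|t| < M -> 0 < hgt t - X + `|z|.
  by move=> /hX h; rewrite ltr_wpDr.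
have den_gt0 (z : 'rV[R]_d) (t : R) : `|t| < M -> `|z| < hgt t -> 0 < hgt t - X - Num.max 0 (`|z| - X).
  by move=> /hX h zh; rewrite subr_gt0 gt_max h/=; lra.
have narrow1 (z : 'rV[R]_d) (t : R) : `|t| < M -> `|z| <= X -> narrow z t = 1.
  move=> /hX h zX; rewrite /narrow max_l ?subr_le0// subr0 divff//; exact: lt0r_neq0.
have widen1 (z : 'rV[R]_d) (t : R) : `|z| <= X -> widen z t = 1.
  by move=> zX; rewrite /widen max_l ?subr_le0// mul0r subr0.
have narrowE (z : 'rV[R]_d) (t : R) : `|t| < M -> X <= `|z| -> `|z| < hgt t ->
    `|narrow z t *: z| = (hgt t - X) * `|z| / (hgt t - `|z|).
  move=> tM Xz zh; have h := hX t tM.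
  have -> : narrow z t = (hgt t - X) / (hgt t - `|z|).
    by rewrite /narrow max_r ?subr_ge0//; congr (_ / _); lra.
  rewrite normrZ ger0_norm; first by rewrite mulrAC.
  by apply: divr_ge0; lra.
have h_gt0 (t : R) : `|t| < M -> 0 < hgt t by move=> tM; rewrite (lt_trans X0)// hgt_gt.
have widenE (z : 'rV[R]_d) (t : R) : `|t| < M -> X <= `|z| ->
    widen z t = hgt t / (hgt t - X + `|z|).
  move=> tM Xz; rewrite /widen max_r ?subr_ge0//; field.
  by have := kz_gt0 z t tM; lra.
have narrow_ge (z : 'rV[R]_d) (t : R) : `|t| < M -> X <= `|z| -> `|z| < hgt t -> X <= `|narrow z t *: z|.
  move=> tM Xz zh; have h := hX t tM; rewrite narrowE// ler_pdivlMr ?subr_gt0//.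
  have := ler_wpM2l (ltW (lt_trans X0 (hgt_gt tM))) Xz; lra.
have widen_ge (z : 'rV[R]_d) (t : R) : `|t| < M -> X <= `|z| -> X <= `|widen z t *: z|.
  move=> tM Xz; have h := hX t tM; have k0 := kz_gt0 z t tM.
  rewrite widenE// normrZ ger0_norm ?divr_ge0 ?(ltW k0) ?(ltW (h_gt0 t tM))//.
  rewrite mulrAC ler_pdivlMr//.
  have := ler_wpM2l (ltW h) Xz; lra.
have widen_lt (z : 'rV[R]_d) (t : R) : `|t| < M -> `|widen z t *: z| < hgt t.
  move=> tM; have h := hX t tM; have k0 := kz_gt0 z t tM.
  have [zX|zX] := leP `|z| X; first by rewrite widen1// scale1r; lra.
  rewrite widenE// ?ltW// normrZ ger0_norm ?divr_ge0 ?(ltW k0) ?(ltW (h_gt0 t tM))//.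
  rewrite mulrAC ltr_pdivrMr// ltr_pM2l ?h_gt0//; lra.
have narrowK (z : 'rV[R]_d) (t : R) : `|t| < M -> `|z| < hgt t ->
    widen (narrow z t *: z) t *: (narrow z t *: z) = z.
  move=> tM zh; have h := hX t tM.
  have [zX|zX] := leP `|z| X; first by rewrite narrow1// scale1r widen1// scale1r.
  have zX' := ltW zX.
  rewrite widenE ?narrow_ge// narrowE// scalerA /narrow max_r ?subr_ge0//.
  rewrite -[RHS]scale1r; congr (_ *: _); have h0 := h_gt0 t tM.
  have hz : hgt t - `|z| != 0 by rewrite subr_eq0 gt_eqF.
  have -> : hgt t - X - (`|z| - X) = hgt t - `|z| by ring.
  have -> : hgt t - X + (hgt t - X) * `|z| / (hgt t - `|z|) =
     (hgt t - X) * hgt t / (hgt t - `|z|) by field.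
  by field; rewrite hz !gt_eqF.
have widenK (z : 'rV[R]_d) (t : R) : `|t| < M -> narrow (widen z t *: z) t *: (widen z t *: z) = z.
  move=> tM; have h := hX t tM; have k0 := kz_gt0 z t tM.
  have [zX|zX] := leP `|z| X; first by rewrite widen1// scale1r narrow1// scale1r.
  have zX' := ltW zX.
  have wz : `|widen z t *: z| = hgt t * `|z| / (hgt t - X + `|z|).
    rewrite widenE// normrZ ger0_norm ?divr_ge0 ?(ltW k0) ?(ltW (h_gt0 t tM))//.
    by rewrite mulrAC.
  rewrite {1}/narrow scalerA max_r; last by rewrite subr_ge0 widen_ge.
  rewrite wz widenE// -[RHS]scale1r; congr (_ *: _); have h0 := h_gt0 t tM.
  have -> : hgt t - X - (hgt t * `|z| / (hgt t - X + `|z|) - X) =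
     hgt t * (hgt t - X) / (hgt t - X + `|z|).
    by field; rewrite gt_eqF.
  by field; rewrite !gt_eqF.
apply: (@homeomorphicI _ _ _ _ F G).
- move=> [[x z] t] /= [/W_bound tM [xt zh]].
  rewrite /F; cont1; last by cont.
  cont1.
    cont1; last by cont.
    apply: (@cont_push _ (fun q : Y * R => - (q.2 / M)) (fun q => - q.1.1)).
    - by cont; exact: lt0r_neq0.
    - by cont.
    - by rewrite /= opprK addrC subr_eq0 gt_eqF.
  cont1; last by cont.
  rewrite /narrow; cont; try by apply: (@cont_hgt _ (fun q : Y * R => q.2)); cont.
  by rewrite gt_eqF// den_gt0.
- move=> [[x z] t] /= /W_bound tM.
  rewrite /G; cont1; last by cont.
  cont1.
    cont1.
    apply: (@cont_pull _ (fun q : Y * R => - (q.2 / M)) (fun q => q.1.1 + X)).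
    - by cont; exact: lt0r_neq0.
    - by cont.
  cont1; last by cont.
  rewrite /widen; cont; try by apply: (@cont_hgt _ (fun q : Y * R => q.2)); cont.
  by rewrite gt_eqF// kz_gt0.
- move=> [[x z] t] /= [Wp [xt zh]]; have tM := W_bound Wp.
  case/andP: (a1 t tM) => a1l a1r.
  have xt' : - (t / M) < - x by rewrite ltrN2.
  suff zz : - 1 < - (t / M) /\ z = narrow z t *: z \/ X <= `|z| /\ X <= `|narrow z t *: z|.
    by apply: ((fold_push t a1r xt' zz).1); rewrite normrN.
  have [zX|zX] := leP X `|z|; last by left; rewrite narrow1 ?scale1r ?ltW.
  by right; split => //; exact: narrow_ge.
- move=> [[x z] t] /= Wp; have tM := W_bound Wp.
  case/andP: (a1 t tM) => a1l a1r; have pg := pull_gt (x + X) a1r.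
  split; last by split; [rewrite ltrNl|exact: widen_lt].
  suff zz : - 1 < - (t / M) /\ widen z t *: z = z \/ X <= `|widen z t *: z| /\ X <= `|z|.
    rewrite /G/= normrN; apply: ((fold_push t a1r pg zz).2).
    by rewrite pullK// addrK.
  have [zX|zX] := leP X `|z|; last by left; rewrite widen1 ?scale1r ?ltW.
  by right; split => //; exact: widen_ge.
- move=> [[x z] t] /= [/W_bound tM [xt zh]]; case/andP: (a1 t tM) => a1l a1r.
  by rewrite /G /F/= subrK pushK ?ltrN2// opprK narrowK.
- move=> [[x z] t] /= /W_bound tM; case/andP: (a1 t tM) => a1l a1r.
  by rewrite /G /F/= opprK pullK// addrK widenK.
Qed.

End Fold.

Section Unions.

Inductive funion (T : Type) (C : set T -> Prop) : set T -> Prop :=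
| funion0 : funion C set0
| funionU A B : C A -> funion C B -> funion C (A `|` B).

Lemma funion1 (T : Type) (C : set T -> Prop) (A : set T) : C A -> funion C A.
Proof. by move=> CA; rewrite -(setU0 A); apply: funionU => //; exact: funion0. Qed.

Lemma funion_setU (T : Type) (C : set T -> Prop) (A B : set T) :
  funion C A -> funion C B -> funion C (A `|` B).
Proof.
elim=> [|A1 A2 CA1 _ IH] CB; first by rewrite set0U.
by rewrite -setUA; apply: funionU => //; exact: IH.
Qed.

Lemma funion_map (T U : Type) (C : set T -> Prop) (D : set U -> Prop)
    (g : set T -> set U) (A : set T) :
  g set0 = set0 -> (forall B1 B2, g (B1 `|` B2) = g B1 `|` g B2) ->
  (forall B, C B -> funion D (g B)) -> funion C A -> funion D (g A).
Proof.
move=> g0 gU gC; elim=> [|A1 A2 CA1 _ IH]; first by rewrite g0; exact: funion0.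
by rewrite gU; apply: funion_setU; [exact: gC|exact: IH].
Qed.

End Unions.

Section Fibers.
Context {R : realType} {T : topologicalType}.

Lemma homeomorphic_fiber (a b : T -> R) : continuous a -> continuous b ->
  (forall y, a y < b y) ->
  homeomorphic [set p : T * R | a p.1 < p.2 < b p.1] [set: T * R].
Proof.
move=> ca cb ab.
pose u := fun p : T * R => (2 * p.2 - a p.1 - b p.1) / (b p.1 - a p.1).
have ba y : 0 < b y - a y by rewrite subr_gt0.
have u1 p : a p.1 < p.2 < b p.1 -> `|u p| < 1.
  move=> /andP[ap pb]; rewrite ltr_norml /u ltr_pdivlMr// ltr_pdivrMr//.
  by apply/andP; split; lra.
have ca1 (p : T * R) : {for p, continuous (fun q : T * R => a q.1)}.
  by apply: (@cont_comp _ _ _ a (fun q : T * R => q.1) p ca); cont.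
have cb1 (p : T * R) : {for p, continuous (fun q : T * R => b q.1)}.
  by apply: (@cont_comp _ _ _ b (fun q : T * R => q.1) p cb); cont.
apply: (@homeomorphicI _ _ _ _ (fun p => (p.1, u p / (1 - `|u p|)))
  (fun p => (p.1, (a p.1 + b p.1 + (b p.1 - a p.1) * (p.2 / (1 + `|p.2|))) / 2))).
- move=> p /u1 up; rewrite /u; cont; first [exact: ca1|exact: cb1|
    by apply: lt0r_neq0; rewrite ?subr_gt0].
- move=> p _; cont; first [exact: ca1|exact: cb1|
    by apply: lt0r_neq0; rewrite ?ltr_pwDl].
- by [].
- move=> [y v] _ /=; have := ba y; set k := b y - a y => k0.
  have v1 : `|v / (1 + `|v|)| < 1.
    rewrite normrM normfV [`|1 + _|]ger0_norm ?addr_ge0// ltr_pdivrMr ?ltr_pwDl//.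
    by rewrite mul1r ltrDr.
  move: v1; set w := v / _; rewrite ltr_norml => /andP[w1 w2].
  have : k * w < k * 1 by rewrite ltr_pM2l.
  have : k * -1 < k * w by rewrite ltr_pM2l.
  by move: (k * w) => kw; rewrite /k => ? ?; apply/andP; split; lra.
- move=> [y t] /u1 /=; set v := u _ => v1; congr (_, _).
  have nv : `|v / (1 - `|v|)| = `|v| / (1 - `|v|).
    by rewrite normrM normfV [`|1 - _|]ger0_norm// subr_ge0 ltW.
  have n0 : 1 - `|v| != 0 by rewrite gt_eqF// subr_gt0.
  have -> : v / (1 - `|v|) / (1 + `|v / (1 - `|v|)|) = v.
    by rewrite nv; field; rewrite n0/= subrK oner_eq0.
  by rewrite /v /u/=; field; rewrite gt_eqF.
- move=> [y v] _ /=; congr (_, _).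
  set w := u _; have -> : w = v / (1 + `|v|).
    by rewrite /w /u/=; field; rewrite (gt_eqF (ba y)) gt_eqF// ltr_pwDl.
  rewrite normrM normfV [`|1 + _|]ger0_norm ?addr_ge0//.
  have n0 : 1 + `|v| != 0 by rewrite gt_eqF// ltr_pwDl.
  by field; rewrite n0/= addrK oner_eq0.
Qed.

End Fibers.

Section Clip.
Context {R : realType}.
Definition clip (M v : R) := Num.max (- M) (Num.min M v).

Lemma clip_gt M v t : `|t| < M -> (t < clip M v) = (t < v).
Proof.
by rewrite ltr_norml => /andP[Mt tM]; rewrite /clip lt_max lt_min tM ltNge (ltW Mt).
Qed.

Lemma clip_lt M v t : `|t| < M -> (clip M v < t) = (v < t).
Proof.
by rewrite ltr_norml => /andP[Mt tM]; rewrite /clip gt_max gt_min Mt [M < t]ltNge (ltW tM).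
Qed.

Lemma clip_eq M v t : `|t| < M -> clip M v = t <-> v = t.
Proof.
move=> tM; split => [ct|->]; apply/eqP; rewrite eq_le !leNgt.
  by rewrite -(clip_lt v tM) -(clip_gt v tM) ct ltxx.
by rewrite clip_lt// clip_gt// ltxx.
Qed.

Lemma clip_norm M v : 0 < M -> `|clip M v| <= M.
Proof.
move=> M0; rewrite ler_norml /clip le_max lexx/= ge_max ge_min lexx andbT; lra.
Qed.

Lemma clip_ge M v : 0 < M -> M <= v -> clip M v = M.
Proof. by move=> M0 Mv; rewrite /clip min_l// max_r//; lra. Qed.

Lemma clip_maxl M v w : v <= - M -> 0 < M -> clip M (Num.max v w) = clip M w.
Proof.
move=> vM M0; rewrite /clip; case: (leP v w) => // wv.
by rewrite !min_r ?max_l//; lra.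
Qed.

Lemma cont_clip (T : topologicalType) M (v : T -> R) p :
  {for p, continuous v} -> {for p, continuous (fun q => clip M (v q))}.
Proof. by move=> cv; rewrite /clip; cont. Qed.

End Clip.

Section BaseSystem.
Context {R : realType} {d : nat}.
Local Notation Y := (R * 'rV[R]_d)%type.
Implicit Types (f : nat -> Y -> R) (A : nat -> bool) (X : R).

Definition drum (b1 b2 : R -> R) (h : R) : set Y :=
  [set y | (y.1 = b1 `|y.2| \/ y.1 = b2 `|y.2|) /\ `|y.2| <= h \/
           `|y.2| = h /\ b1 h <= y.1 <= b2 h].
Definition tube (b : R -> R) (h : R) : set Y :=
  [set y | y.1 = b `|y.2| /\ `|y.2| <= h \/ `|y.2| = h /\ y.1 <= b h].
Definition ring (x h : R) : set Y := [set y | y.1 = x /\ `|y.2| = h].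

Definition is_drum X (D : set Y) := exists b1 b2 h,
  [/\ continuous b1 /\ continuous b2, 0 < h,
      forall s, - X < b1 s /\ b1 s < b2 s /\ b2 s < X & D = drum b1 b2 h].
Definition is_tube X (D : set Y) := exists b h,
  [/\ continuous b, 0 < h, forall s, - X < b s /\ b s < X & D = tube b h].
Definition is_ring X (D : set Y) := exists x h,
  [/\ - X < x, x < X, 0 < h & D = ring x h].

Definition cell n f A : set (Y * R) :=
  [set p | `|p.2| < n.+1%:R /\
    forall i, (i < n)%N -> if A i then p.2 < f i p.1 else f i p.1 < p.2].

(* [eps] is the common profile of the functions in the collar x <= -X, where the
   next fold takes place. There the functions other than the last are constant,
   so that only the last one meets the others. The constants i + 1 in the
   region [bs_far] are distinct: no two functions agree there. *)
Record base_system n X f (eps : nat -> R -> R) : Prop := BaseSystem {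
  bs_X : 1 <= X;
  bs_cont : forall i, (i < n)%N -> continuous (f i);
  bs_bound : forall i y, (i < n)%N -> `|f i y| <= i.+1%:R;
  bs_collar : forall i x z, (i < n)%N -> x <= - X -> f i (x, z) = eps i `|z|;
  bs_far : forall i y, (i < n)%N -> X <= y.1 \/ X <= `|y.2| -> f i y = i.+1%:R;
  bs_epsc : forall i, (i < n)%N -> continuous (eps i);
  bs_epsb : forall i s, (i < n)%N -> `|eps i s| <= i.+1%:R;
  bs_eps_old : forall i s, (i.+1 < n)%N -> eps i s = i.+1%:R;
  bs_eps_new : forall i j, i.+1 = n -> (j < i)%N ->
    exists h, [/\ 0 < h, h < X & forall s, eps i s = j.+1%:R <-> s = h];
  bs_cell : forall A, homeomorphic (cell n f A) [set: Y * R];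
  bs_pair_old : forall i j, (j < i)%N -> (i.+1 < n)%N ->
    funion (is_drum X) [set y | f i y = f j y];
  bs_pair_new : forall i j, (j < i)%N -> i.+1 = n ->
    is_tube X [set y | f i y = f j y];
  bs_triple : forall i j k, (k < j)%N -> (j < i)%N -> (i < n)%N ->
    funion (is_ring X) [set y | f i y = f j y /\ f j y = f k y];
  bs_quad : forall i j k l y, (l < k)%N -> (k < j)%N -> (j < i)%N -> (i < n)%N ->
    ~ [/\ f i y = f j y, f j y = f k y & f k y = f l y] }.

Fixpoint minf (K : R) f k (y : Y) : R :=
  if k is k'.+1 then Num.min (minf K f k' y) (f k' y) else K.

Lemma lt_minf K f k y t :
  (t < minf K f k y) <-> t < K /\ forall i, (i < k)%N -> t < f i y.
Proof.
elim: k => [|k IH] /=; first by split=> [//|[]].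
rewrite lt_min; split.
  move=> /andP[/IH[tK tf] tk]; split => // i; rewrite ltnS leq_eqVlt.
  by move=> /predU1P[->//|]; exact: tf.
move=> [tK tf]; rewrite tf// andbT; apply/IH; split => // i ik.
by apply: tf; rewrite ltnS ltnW.
Qed.

Lemma minf_continuous K f k :
  (forall i, (i < k)%N -> continuous (f i)) -> continuous (minf K f k).
Proof.
elim: k => [|k IH] cf p; first exact: cont_cst.
apply: (@cont_min _ _ (minf K f k) (f k)).
  by apply: IH => i ik; apply: cf; rewrite ltnS ltnW.
exact: cf.
Qed.

Lemma minf_gt K k f c y : c < K -> (forall i, (i < k)%N -> c < f i y) ->
  c < minf K f k y.
Proof. by move=> cK cf; apply/lt_minf. Qed.

Lemma cell_top n f A : (forall i, (i < n)%N -> A i) ->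
  (forall i, (i < n)%N -> continuous (f i)) ->
  (forall i y, (i < n)%N -> `|f i y| <= i.+1%:R) ->
  homeomorphic (cell n f A) [set: Y * R].
Proof.
move=> At cf bf; pose K : R := n.+1%:R.
rewrite (_ : cell n f A = [set p | - K < p.2 < minf K f n p.1]).
  apply: (@homeomorphic_fiber _ _ (fun _ => - K) (minf K f n)).
  - by move=> ?; exact: cont_cst.
  - exact: minf_continuous.
  move=> y; apply: minf_gt; first by rewrite gtrN// ltr0n.
  move=> i iltn; have := bf i y iltn; rewrite ler_norml => /andP[+ _].
  by apply: lt_le_trans; rewrite ltrN2 ltr_nat.
apply/seteqP; split => -[y t]; rewrite /cell/= ltr_norml.
  move=> [/andP[tl tr] tf]; rewrite tl/=; apply/lt_minf; split => // i iltn.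
  by have := tf _ iltn; rewrite At.
move=> /andP[-> /lt_minf[-> tf]]; split => // i iltn.
by rewrite At//; exact: tf.
Qed.

Lemma cell_bottom n f A : (forall i, (i < n)%N -> ~~ A i) ->
  (forall i, (i < n)%N -> continuous (f i)) ->
  (forall i y, (i < n)%N -> `|f i y| <= i.+1%:R) ->
  homeomorphic (cell n f A) [set: Y * R].
Proof.
move=> Ab cf bf.
pose g i y := - f i y; pose B i := ~~ A i.
apply: (@homeomorphic_trans _ _ _ _ (cell n g B)); last first.
  apply: cell_top => [//|i iltn p|i y iltn]; last by rewrite normrN bf.
  by apply: (@contN _ _ (f i)); exact: cf.
have E p : cell n f A p <-> cell n g B (p.1, - p.2).
  rewrite /cell/= normrN; split=> -[? H]; split => // i iltn; have := H i iltn;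
    by rewrite /B /g; case: (A i) => /=; rewrite ltrN2.
apply: (@homeomorphicI _ _ _ _ (fun p => (p.1, - p.2)) (fun p => (p.1, - p.2))).
- by move=> p _; cont.
- by move=> p _; cont.
- by move=> p /E.
- by move=> [y t] Hp; apply/E; rewrite /= opprK.
- by move=> [y t] _ /=; rewrite opprK.
- by move=> [y t] _ /=; rewrite opprK.
Qed.

Lemma base_system0 : base_system 0 1 (fun _ _ => 0) (fun _ _ => 0).
Proof.
by split => // A; apply: cell_top.
Qed.

Definition fold X (y : Y) : Y := (`|y.1| - X - 1, y.2).

Lemma fold_continuous X : continuous (fold X).
Proof. by apply: forall_cont => p; rewrite /fold; cont. Qed.

Lemma fold_drum X D : 1 <= X -> is_drum X D ->
  funion (is_drum (2 * X + 1)) (fold X @^-1` D).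
Proof.
move=> X1 [b1 [b2 [h [[cb1 cb2] h0 b12 ->]]]].
pose c : R := X + 1.
rewrite (_ : _ @^-1` _ = drum (fun s => b1 s + c) (fun s => b2 s + c) h `|`
                         drum (fun s => - b2 s - c) (fun s => - b1 s - c) h).
  apply: funion_setU; apply: funion1.
    exists (fun s => b1 s + c), (fun s => b2 s + c), h; split => //.
    - by split; apply: forall_cont => p; cont; first [exact: cb1|exact: cb2].
    - by move=> s; have := b12 s; rewrite /c; lra.
  exists (fun s => - b2 s - c), (fun s => - b1 s - c), h; split => //.
  - by split; apply: forall_cont => p; cont; first [exact: cb2|exact: cb1].
  - by move=> s; have := b12 s; rewrite /c; lra.
apply/seteqP; rewrite /fold /drum /c; split=> -[x z] /=;
  have := b12 `|z|; have := b12 h => B1 B2; case: (ger0P x) => x0.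
- move=> [[H zh]|[-> H]].
    by left; left; split => //; case: H => H; [left|right]; lra.
  by left; right; split => //; lra.
- move=> [[H zh]|[-> H]].
    by right; left; split => //; case: H => H; [right|left]; lra.
  by right; right; split => //; lra.
- move=> [[[H zh]|[zh H]]|[[H zh]|[zh H]]].
  + by left; split => //; case: H => H; [left|right]; lra.
  + by right; split => //; lra.
  + by exfalso; case: H => H; lra.
  + by exfalso; lra.
- move=> [[[H zh]|[zh H]]|[[H zh]|[zh H]]].
  + by exfalso; case: H => H; lra.
  + by exfalso; lra.
  + by left; split => //; case: H => H; [right|left]; lra.
  + by right; split => //; lra.
Qed.

Lemma fold_tube X D : 1 <= X -> is_tube X D ->
  is_drum (2 * X + 1) (fold X @^-1` D).
Proof.
move=> X1 [b [h [cb h0 bX ->]]]; pose c : R := X + 1.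
exists (fun s => - b s - c), (fun s => b s + c), h; split => //.
- by split; apply: forall_cont => p; cont; exact: cb.
- by move=> s; have := bX s; rewrite /c; lra.
apply/seteqP; rewrite /fold /tube /drum /c; split=> -[x z] /=;
  have := bX `|z|; have := bX h => B1 B2; case: (ger0P x) => x0.
- by move=> [[H zh]|[-> H]]; [left; split => //; right|right; split => //]; lra.
- by move=> [[H zh]|[-> H]]; [left; split => //; left|right; split => //]; lra.
- by move=> [[[H|H] zh]|[zh H]]; [exfalso|left; split => //|right; split => //]; lra.
- by move=> [[[H|H] zh]|[zh H]]; [left; split => //|exfalso|right; split => //]; lra.
Qed.

Lemma fold_ring X D : 1 <= X -> is_ring X D ->
  funion (is_ring (2 * X + 1)) (fold X @^-1` D).
Proof.
move=> X1 [x0 [h [x1 x2 h0 ->]]].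
rewrite (_ : _ @^-1` _ = ring (x0 + X + 1) h `|` ring (- x0 - X - 1) h).
  apply: funion_setU; apply: funion1.
    by exists (x0 + X + 1), h; split => //; lra.
  by exists (- x0 - X - 1), h; split => //; lra.
apply/seteqP; rewrite /fold /ring; split=> -[x z] /=; case: (ger0P x) => xp.
- by move=> [H zh]; left; split => //; lra.
- by move=> [H zh]; right; split => //; lra.
- by move=> [[H zh]|[H zh]]; [split => //|exfalso]; lra.
- by move=> [[H zh]|[H zh]]; [exfalso|split => //]; lra.
Qed.

Section Step.
Variables (n : nat) (X : R) (f : nat -> Y -> R) (eps : nat -> R -> R).
Hypothesis bs : base_system n X f eps.

Let M : R := n.+1%:R.
Let ramp (s : R) := 2 * M * (s - X) - M.
Let fnew (y : Y) := clip M (Num.max (M * y.1) (ramp `|y.2|)).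
Let f' i (y : Y) := if (i < n)%N then f i (fold X y) else fnew y.
Let eps' i (s : R) := if (i < n)%N then i.+1%:R else clip M (ramp s).

Let M0 : 0 < M. Proof. by rewrite /M ltr0n. Qed.
Let X1 : 1 <= X. Proof. exact: bs_X bs. Qed.
Let X0 : 0 < X. Proof. exact: lt_le_trans X1. Qed.

Let f'_old i y : (i < n)%N -> f' i y = f i (fold X y).
Proof. by rewrite /f' => ->. Qed.
Let f'_new y : f' n y = fnew y. Proof. by rewrite /f' ltnn. Qed.

Let ramp_gt (s t : R) : (t < ramp s) = (hgt X M t < s).
Proof.
rewrite /hgt -ltrBrDl ltr_pdivrMr ?mulr_gt0// /ramp ltrBrDr.
by rewrite [(s - X) * _]mulrC.
Qed.

Let ramp_lt (s t : R) : (ramp s < t) = (s < hgt X M t).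
Proof.
rewrite /hgt -ltrBlDl ltr_pdivlMr ?mulr_gt0// /ramp ltrBlDr.
by rewrite [(s - X) * _]mulrC.
Qed.

Let fnew_gt y t : `|t| < M -> t < fnew y <-> t / M < y.1 \/ hgt X M t < `|y.2|.
Proof.
move=> tM; rewrite /fnew clip_gt// lt_max ramp_gt ltr_pdivrMr// [y.1 * M]mulrC.
by split => [/orP|H]; [|apply/orP].
Qed.

Let fnew_lt y t : `|t| < M -> fnew y < t <-> y.1 < t / M /\ `|y.2| < hgt X M t.
Proof.
move=> tM; rewrite /fnew clip_lt// gt_max ramp_lt ltr_pdivlMr// [y.1 * M]mulrC.
by split => [/andP[]|[? ?]]; [|apply/andP].
Qed.

Let fnew_eq y t : `|t| < M -> fnew y = t <->
  y.1 = t / M /\ `|y.2| <= hgt X M t \/ `|y.2| = hgt X M t /\ y.1 <= t / M.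
Proof.
move=> tM; have fg := fnew_gt y tM; have fl := fnew_lt y tM; split.
  move=> ft; rewrite ft in fg fl.
  have [lt1|gt1|eq1] := ltgtP y.1 (t / M).
  - right; split => //; apply/eqP; rewrite eq_le !leNgt; apply/andP; split; apply/negP => h.
      by have := fg.2 (or_intror h); rewrite ltxx.
    by have := fl.2 (conj lt1 h); rewrite ltxx.
  - by have := fg.2 (or_introl gt1); rewrite ltxx.
  - left; split => //; rewrite leNgt; apply/negP => h.
    by have := fg.2 (or_intror h); rewrite ltxx.
move=> H; apply/eqP; rewrite eq_le !leNgt; apply/andP; split; apply/negP.
  move=> /fg [h|h]; case: H => -[a b].
  - by rewrite a ltxx in h.
  - by rewrite ltNge b in h.
  - by rewrite ltNge b in h.
  - by rewrite a ltxx in h.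
move=> /fl [h1 h2]; case: H => -[a b].
- by rewrite a ltxx in h1.
- by rewrite a ltxx in h2.
Qed.

Let hgtX (t : R) : `|t| < M -> X < hgt X M t. Proof. exact: hgt_gt. Qed.

Let old_bound i y : (i < n)%N -> `|f i y| < M.
Proof.
move=> iltn; apply: le_lt_trans (bs_bound bs y iltn) _.
by rewrite ltr_nat ltnS.
Qed.

Let eps_bound i s : (i < n)%N -> `|eps i s| < M.
Proof.
move=> iltn; apply: le_lt_trans (bs_epsb bs s iltn) _.
by rewrite ltr_nat ltnS.
Qed.

Let S_bound i : (i < n)%N -> `|i.+1%:R : R| < M.
Proof. by move=> iltn; rewrite ger0_norm// ltr_nat ltnS. Qed.

Let middle i x z : (i < n)%N -> `|x| < 1 -> f i (fold X (x, z)) = eps i `|z|.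
Proof. by move=> iltn x1; apply: (bs_collar bs) => //=; lra. Qed.

Let outer i x z : (i < n)%N -> X <= `|z| -> f i (fold X (x, z)) = i.+1%:R.
Proof. by move=> iltn zX; apply: (bs_far bs) => //=; right. Qed.

Let eps_outer i (z : 'rV[R]_d) : (i < n)%N -> X <= `|z| -> eps i `|z| = i.+1%:R.
Proof.
by move=> iltn zX; rewrite -(middle z (x := 0)) ?normr0// outer.
Qed.

Let pair_new j x z : (j < n)%N -> fnew (x, z) = f j (fold X (x, z)) <->
  tube (fun s => eps j s / M) (hgt X M j.+1%:R) (x, z).
Proof.
move=> jn; rewrite fnew_eq ?old_bound//=.
have hj := hgtX (S_bound jn); have vb := old_bound (fold X (x, z)) jn.
have small v : `|v| < M -> `|v / M| < 1.
  by move=> vM; rewrite normrM normfV (ger0_norm (ltW M0)) ltr_pdivrMr// mul1r.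
have hle v : v <= j.+1%:R -> hgt X M v <= hgt X M j.+1%:R.
  by move=> vj; rewrite /hgt lerD2l ler_pM2r ?invr_gt0 ?mulr_gt0// lerD2r.
rewrite /tube /=; split.
  move=> [[xE zh]|[zh xle]].
    have x1 : `|x| < 1 by rewrite xE small.
    left; rewrite middle// in xE zh; split => //.
    apply: le_trans zh (hle _ _).
    by have := bs_epsb bs `|z| jn; rewrite ler_norml => /andP[].
  have zX : X <= `|z| by rewrite zh ltW// hgtX.
  right; rewrite outer// in zh xle; split => //.
  by rewrite -zh eps_outer.
move=> [[xE zh]|[zh xle]].
  have x1 : `|x| < 1 by rewrite xE small// eps_bound.
  left; rewrite middle//; split => //.
  have [zX|zX] := leP X `|z|; first by rewrite eps_outer.
  by rewrite ltW// (lt_trans zX)// hgtX// eps_bound.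
have zX : X <= `|z| by rewrite zh ltW.
right; rewrite outer//; split => //.
by rewrite -zh eps_outer// in xle.
Qed.

Let new_middle j k x z : (k < j)%N -> (j < n)%N ->
  fnew (x, z) = f j (fold X (x, z)) -> f j (fold X (x, z)) = f k (fold X (x, z)) ->
  [/\ `|x| < 1, x = eps j `|z| / M, eps j `|z| = eps k `|z| & `|z| < X].
Proof.
move=> kj jn fj fjk; have kn := ltn_trans kj jn.
have zX : `|z| < X.
  rewrite ltNge; apply/negP => zX; move: fjk; rewrite !outer// => /eqP.
  by rewrite eqr_nat eqSS gtn_eqF.
move/(pair_new _ _ jn) : fj => [/= [xE _]|/= [zh _]]; last first.
  by have := hgtX (S_bound jn); rewrite -zh ltNge (ltW zX).
have x1 : `|x| < 1.
  by rewrite xE normrM normfV (ger0_norm (ltW M0)) ltr_pdivrMr// mul1r eps_bound.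
by split => //; rewrite -!(middle z _ x1)// ?fjk.
Qed.

Lemma cell_step A : homeomorphic (cell n.+1 f' A) [set: Y * R].
Proof.
have cf' i : (i < n.+1)%N -> continuous (f' i).
  rewrite ltnS leq_eqVlt => /predU1P[->|iltn]; apply: forall_cont => p.
    rewrite /f' ltnn; apply: (@cont_clip _ _ M (fun y : Y => Num.max (M * y.1) (ramp `|y.2|))).
    by rewrite /ramp; cont.
  rewrite /f' iltn; apply: (@cont_comp _ _ _ (f i) (fold X)); first exact: (bs_cont bs).
  exact: fold_continuous.
have bf' i y : (i < n.+1)%N -> `|f' i y| <= i.+1%:R.
  rewrite ltnS leq_eqVlt => /predU1P[->|iltn]; first by rewrite f'_new clip_norm.
  by rewrite f'_old//; exact: (bs_bound bs).
have W_collar (x x' : R) (z : 'rV[R]_d) (t : R) : x <= - X -> x' <= - X ->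
    cell n f A ((x, z), t) -> cell n f A ((x', z), t).
  move=> xX x'X [tM H]; split => // i iltn; have := H i iltn => /=.
  by rewrite !(bs_collar bs _ iltn).
have W_far (x x' : R) (z z' : 'rV[R]_d) (t : R) : X <= `|z| -> X <= `|z'| ->
    cell n f A ((x, z), t) -> cell n f A ((x', z'), t).
  move=> xX x'X [tM H]; split => // i iltn; have := H i iltn => /=.
  by rewrite !(bs_far bs iltn) //=; right.
have W_bound (y : Y) (t : R) : cell n f A (y, t) -> `|t| < M by case.
have MM : M < n.+2%:R by rewrite ltr_nat.
have lift i : (i < n)%N -> (i < n.+1)%N by move=> ?; rewrite ltnS ltnW.
have fnewM y : `|fnew y| <= M by exact: clip_norm.
have [An|An] := boolP (A n).
  have [Aall|/existsNP[j /not_implyP[jn /negP Aj]]] :=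
      pselect (forall i, (i < n)%N -> A i).
    apply: cell_top => // i; rewrite ltnS leq_eqVlt => /predU1P[->//|].
    exact: Aall.
  apply: homeomorphic_trans (bs_cell bs A).
  apply: homeomorphic_trans (fold_up X0 M0 W_collar W_far W_bound).
  rewrite (_ : cell _ _ _ = [set p : Y * R |
    cell n f A ((`|p.1.1| - X - 1, p.1.2), p.2) /\
    (p.2 / M < p.1.1 \/ hgt X M p.2 < `|p.1.2|)]); first exact: homeomorphic_refl.
  apply/seteqP; split => -[[x z] t] [tb H].
    have tM : `|t| < M.
      have := H n (ltnSn n); rewrite An f'_new => tf.
      have := H j (lift j jn); rewrite (negbTE Aj) f'_old// => ft.
      rewrite ltr_norml (lt_le_trans tf)/=; last by have := fnewM (x, z); rewrite ler_norml => /andP[].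
      rewrite andbT; apply: lt_trans ft.
      by have := old_bound (fold X (x, z)) jn; rewrite ltr_norml => /andP[].
    split; last by apply/(fnew_gt (x, z) tM); have := H n (ltnSn n); rewrite An f'_new.
    by split => // i iltn; have := H i (lift i iltn); rewrite f'_old.
  move: tb => /= [tM tf]; split; first exact: lt_trans tM MM.
  move=> i; rewrite ltnS leq_eqVlt => /predU1P[->|iltn].
    by rewrite An f'_new; exact/(fnew_gt (x, z) tM).
  by rewrite f'_old//; exact: tf.
have [Aall|/existsNP[j /not_implyP[jn /negP/negPn Aj]]] :=
    pselect (forall i, (i < n)%N -> ~~ A i).
  apply: cell_bottom => // i; rewrite ltnS leq_eqVlt => /predU1P[->//|].
  exact: Aall.
apply: homeomorphic_trans (bs_cell bs A).
apply: homeomorphic_trans (fold_down X0 M0 W_collar W_far W_bound).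
rewrite (_ : cell _ _ _ = [set p : Y * R |
  cell n f A ((`|p.1.1| - X - 1, p.1.2), p.2) /\
  (p.1.1 < p.2 / M /\ `|p.1.2| < hgt X M p.2)]); first exact: homeomorphic_refl.
apply/seteqP; split => -[[x z] t] [tb H].
  have tM : `|t| < M.
    have := H n (ltnSn n); rewrite (negbTE An) f'_new => tf.
    have := H j (lift j jn); rewrite Aj f'_old// => ft.
    rewrite ltr_norml (le_lt_trans _ tf)/=; last by have := fnewM (x, z); rewrite ler_norml => /andP[].
    apply: lt_trans ft _.
    by have := old_bound (fold X (x, z)) jn; rewrite ltr_norml => /andP[].
  split; last by apply/(fnew_lt (x, z) tM); have := H n (ltnSn n); rewrite (negbTE An) f'_new.
  by split => // i iltn; have := H i (lift i iltn); rewrite f'_old.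
move: tb => /= [tM tf]; split; first exact: lt_trans tM MM.
move=> i; rewrite ltnS leq_eqVlt => /predU1P[->|iltn].
  by rewrite (negbTE An) f'_new; exact/(fnew_lt (x, z) tM).
by rewrite f'_old//; exact: tf.
Qed.

Lemma base_systemS : base_system n.+1 (2 * X + 1) f' eps'.
Proof.
have M0' : M != 0 by rewrite gt_eqF.
have X1' := X1; have M0'' := M0.
split.
- lra.
- move=> i; rewrite ltnS leq_eqVlt => /predU1P[->|iltn]; apply: forall_cont => p.
    rewrite /f' ltnn; apply: (@cont_clip _ _ M (fun y : Y => Num.max (M * y.1) (ramp `|y.2|))).
    by rewrite /ramp; cont.
  rewrite /f' iltn; apply: (@cont_comp _ _ _ (f i) (fold X)); first exact: (bs_cont bs).
  exact: fold_continuous.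
- move=> i y; rewrite ltnS leq_eqVlt => /predU1P[->|iltn]; first by rewrite f'_new clip_norm.
  by rewrite f'_old//; exact: (bs_bound bs).
- move=> i x z; rewrite ltnS leq_eqVlt => /predU1P[->|iltn] xX.
    rewrite f'_new /eps' ltnn /fnew clip_maxl//=.
    by rewrite -[leRHS]mulrN1 ler_pM2l//; lra.
  rewrite f'_old// /eps' iltn; apply: (bs_far bs) => //; left => /=.
  by rewrite ler0_norm; lra.
- move=> i [x z]; rewrite ltnS leq_eqVlt => /predU1P[->|iltn] /= far.
    rewrite f'_new /fnew clip_ge// le_max; case: far => far.
      by rewrite ler_peMr//=; lra.
    apply/orP; right; rewrite /ramp; have : M <= M * (`|z| - X).
      by rewrite ler_peMr ?ltW//; lra.
    lra.
  rewrite f'_old//; apply: (bs_far bs) => //; case: far => /= far; [left|right]; last lra.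
  by rewrite ger0_norm; lra.
- move=> i; rewrite ltnS leq_eqVlt => /predU1P[->|iltn]; apply: forall_cont => p.
    by rewrite /eps' ltnn; apply: (@cont_clip _ _ M ramp); rewrite /ramp; cont.
  by rewrite /eps' iltn; cont.
- move=> i s; rewrite ltnS leq_eqVlt /eps' => /predU1P[->|iltn].
    by rewrite ltnn clip_norm.
  by rewrite iltn ger0_norm.
- by move=> i s; rewrite ltnS /eps' => ->.
- move=> i j [->] jn; exists (hgt X M j.+1%:R); have jM := S_bound jn.
  have h1 := hgtX jM; split; first exact: lt_trans h1.
    rewrite /hgt -ltrBrDl ltr_pdivrMr ?mulr_gt0//.
    have : M <= X * M by rewrite ler_peMl// ltW.
    by move: jM; rewrite ltr_norml => /andP[_]; nra.
  move=> s; rewrite /eps' ltnn clip_eq//; split => H.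
    apply/eqP; rewrite eq_le !leNgt -ramp_gt -ramp_lt H ltxx//.
  by apply/eqP; rewrite eq_le !leNgt ramp_gt ramp_lt H ltxx.
- exact: cell_step.
- move=> i j ji; rewrite ltnS => iltn; have jn := ltn_trans ji iltn.
  rewrite (_ : [set y | _] = fold X @^-1` [set y | f i y = f j y]); last first.
    by apply/seteqP; split => y /=; rewrite !f'_old.
  have [iN|iN] := ltnP i.+1 n.
    apply: (funion_map (C := is_drum X)) => //; last exact: (bs_pair_old bs).
    by move=> B; exact: fold_drum.
  apply: funion1; apply: fold_tube => //; apply: (bs_pair_new bs) => //.
  by apply/eqP; rewrite eqn_leq iN iltn.
- move=> i j + [iE]; rewrite iE => jn.
  exists (fun s => eps j s / M), (hgt X M j.+1%:R); split.
  + by apply: forall_cont => s; cont => //; exact: (bs_epsc bs).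
  + exact: lt_trans (hgtX (S_bound jn)).
  + move=> s; have := eps_bound s jn => es.
    have : `|eps j s / M| < 1.
      by rewrite normrM normfV (ger0_norm (ltW M0)) ltr_pdivrMr// mul1r.
    by rewrite ltr_norml => /andP[]; move: (_ / M) => q; lra.
  + by apply/seteqP; split => -[x z] /=; rewrite f'_new f'_old// => /pair_new H; apply: H.
- move=> i j k kj ji; rewrite ltnS leq_eqVlt => /predU1P[iE|iltn]; last first.
    have jn := ltn_trans ji iltn; have kn := ltn_trans kj jn.
    rewrite (_ : [set y | _] = fold X @^-1` [set y | f i y = f j y /\ f j y = f k y]).
      apply: (funion_map (C := is_ring X)) => //; last exact: (bs_triple bs).
      by move=> B; exact: fold_ring.
    by apply/seteqP; split => y /=; rewrite !f'_old.
  rewrite iE in ji *; have kn := ltn_trans kj ji.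
  have k1n : (k.+1 < n)%N by exact: leq_ltn_trans ji.
  have [jN|jN] := ltnP j.+1 n.
    rewrite (_ : [set y | _] = set0); first exact: funion0.
    apply/seteqP; split => -[x z] //=; rewrite f'_new !f'_old// => -[H1 H2].
    have [_ _ + _] := new_middle kj ji H1 H2.
    rewrite !(bs_eps_old bs)// => /eqP.
    by rewrite eqr_nat eqSS gtn_eqF.
  have jE : j.+1 = n by apply/eqP; rewrite eqn_leq jN ji.
  have [h [h0 hX hE]] := bs_eps_new bs jE kj.
  apply: funion1; exists (k.+1%:R / M), h.
  have kb := S_bound kn.
  have kM : `|k.+1%:R / M| < 1.
    by rewrite normrM normfV (ger0_norm (ltW M0)) ltr_pdivrMr// mul1r.
  have [kM1 kM2] : - 1 < k.+1%:R / M /\ k.+1%:R / M < 1.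
    by move: kM; rewrite ltr_norml => /andP[].
  split; [apply: le_lt_trans kM1; lra|apply: lt_trans kM2 _; lra|exact: h0|].
  apply/seteqP; split => -[x z] /=; rewrite f'_new !f'_old//.
    move=> [H1 H2]; have [x1 xE eE zX] := new_middle kj ji H1 H2.
    rewrite [RHS](bs_eps_old bs) // in eE.
    by rewrite /ring/= xE eE; split => //; exact/hE.
  move=> [/= xE zh]; have x1 : `|x| < 1 by rewrite xE.
  rewrite !middle// (bs_eps_old bs _ k1n); have ej := (hE `|z|).2 zh.
  rewrite ej; split => //; apply/(fnew_eq _ kb); left; split => //=.
  by rewrite zh ltW// (lt_trans hX)// hgtX.
- move=> i j k l [x z] lk kj ji; rewrite ltnS leq_eqVlt => /predU1P[iE|iltn]; last first.
    have jn := ltn_trans ji iltn; have kn := ltn_trans kj jn; have ln := ltn_trans lk kn.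
    by rewrite !f'_old//; exact: (bs_quad bs).
  rewrite iE in ji *; have kn := ltn_trans kj ji; have ln := ltn_trans lk kn.
  rewrite f'_new !f'_old// => -[H1 H2 H3].
  have [x1 _ _ _] := new_middle kj ji H1 H2.
  move: H3; rewrite !middle// !(bs_eps_old bs) ?(leq_ltn_trans kj)//; last first.
    by rewrite (leq_ltn_trans lk).
  by move=> /eqP; rewrite eqr_nat eqSS gtn_eqF.
Qed.

End Step.

Lemma base_system_exists n : exists X f eps, base_system n X f eps.
Proof.
elim: n => [|n [X [f [eps /base_systemS]]]]; last by move=> H; do 3 eexists; exact: H.
by do 3 eexists; exact: base_system0.
Qed.

End BaseSystem.

Section RowVectors.
Context {R : realType}.

Lemma norm_rv_le k (u : 'rV[R]_k) (r : R) :
  `|u| <= r <-> 0 <= r /\ forall j, `|u 0 j| <= r.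
Proof.
rewrite [`|u|]/Num.norm/= mx_normrE; split.
  by move=> /bigmax_leP[r0 ur]; split => // j; exact: (ur (0, j)).
by move=> [r0 ur]; apply/bigmax_leP; split => // -[i j] _ /=; rewrite ord1.
Qed.

Lemma norm_coord k (u : 'rV[R]_k) j : `|u 0 j| <= `|u|.
Proof. by case: ((norm_rv_le u `|u|).1 (lexx _)). Qed.

Lemma norm_rv_gt k (u : 'rV[R]_k) (r : R) : 0 <= r -> r < `|u| ->
  exists j, r < `|u 0 j|.
Proof.
move=> r0 ru; apply: contrapT => /forallNP H; move: ru; apply/negP; rewrite -leNgt.
by apply/norm_rv_le; split => // j; rewrite leNgt; apply/negP/H.
Qed.

Lemma norm_rv0 (z : 'rV[R]_0) : `|z| = 0.
Proof. by rewrite (_ : z = 0) ?normr0//; apply/rowP => -[]. Qed.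

Definition rv_cons k (a : R) (v : 'rV[R]_k) : 'rV[R]_k.+1 :=
  \row_j (if unlift ord0 j is Some i then v 0 i else a).
Definition rv_tail k (u : 'rV[R]_k.+1) : 'rV[R]_k := \row_i u 0 (lift ord0 i).

Lemma rv_cons0 k a (v : 'rV[R]_k) : rv_cons a v 0 ord0 = a.
Proof. by rewrite mxE unlift_none. Qed.

Lemma rv_consS k a (v : 'rV[R]_k) i : rv_cons a v 0 (lift ord0 i) = v 0 i.
Proof. by rewrite mxE liftK. Qed.

Lemma rv_tail_cons k a (v : 'rV[R]_k) : rv_tail (rv_cons a v) = v.
Proof. by apply/rowP => i; rewrite mxE rv_consS. Qed.

Lemma rv_cons_tail k (u : 'rV[R]_k.+1) : rv_cons (u 0 ord0) (rv_tail u) = u.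
Proof. by apply/rowP => i; rewrite mxE; case: unliftP => [j ->|->]; rewrite ?mxE. Qed.

Lemma rv_consZ k a l (v : 'rV[R]_k) : l *: rv_cons a v = rv_cons (l * a) (l *: v).
Proof. by apply/rowP => i; rewrite !mxE; case: unliftP => [j _|_]; rewrite ?mxE. Qed.

Lemma rv_tailZ k l (u : 'rV[R]_k.+1) : rv_tail (l *: u) = l *: rv_tail u.
Proof. by apply/rowP => i; rewrite !mxE. Qed.

Lemma norm_rv_cons k a (v : 'rV[R]_k) : `|rv_cons a v| = Num.max `|a| `|v|.
Proof.
apply/eqP; rewrite eq_le; apply/andP; split.
  apply/norm_rv_le; split; first by rewrite le_max normr_ge0.
  by move=> j; rewrite mxE le_max; case: unliftP => [i _|_];
    rewrite ?lexx ?norm_coord ?orbT.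
rewrite ge_max -{1}(rv_cons0 a v) norm_coord/=; apply/norm_rv_le; split => // j.
by rewrite -(rv_consS a v) norm_coord.
Qed.

Lemma cont_rv_cons (T : topologicalType) k (a : T -> R) (v : T -> 'rV[R]_k) p :
  {for p, continuous a} -> {for p, continuous v} ->
  {for p, continuous (fun q => rv_cons (a q) (v q))}.
Proof.
move=> ca cv; apply: cont_mx => i j.
rewrite (_ : (fun y : T => _) = fun y : T => if unlift ord0 j is Some i then v y 0 i else a y).
  by case: (unlift ord0 j) => [l|//]; exact: cont_coord.
by apply/funext => y; rewrite mxE.
Qed.

Lemma cont_rv_tail (T : topologicalType) k (u : T -> 'rV[R]_k.+1) p :
  {for p, continuous u} -> {for p, continuous (fun q => rv_tail (u q))}.
Proof.
move=> cu; apply: cont_mx => i j.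
rewrite (_ : (fun y : T => _) = fun y : T => u y 0 (lift ord0 j)).
  exact: cont_coord.
by apply/funext => y; rewrite mxE.
Qed.

Lemma cont_sum (T : topologicalType) k (F : 'I_k -> T -> R) p :
  (forall i, {for p, continuous (F i)}) ->
  {for p, continuous (fun q => \sum_(i < k) F i q)}.
Proof.
elim: k F => [|k IH] F cF.
  rewrite (_ : (fun q : T => _) = fun=> 0); first exact: cont_cst.
  by apply/funext => q; rewrite big_ord0.
rewrite (_ : (fun q : T => _) =
    fun q => (\sum_(i < k) F (widen_ord (leqnSn k) i) q) + F ord_max q).
  by apply: contD => //; exact: (IH (fun i => F (widen_ord (leqnSn k) i))).
by apply/funext => q; rewrite big_ord_recr.
Qed.

Lemma open_ball_homeomorphic k :
  homeomorphic [set u : 'rV[R]_k | `|u| < 1] [set: 'rV[R]_k].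
Proof.
pose F (c : R) (u : 'rV[R]_k) := (1 + c * `|u|)^-1 *: u.
apply: (@homeomorphicI _ _ _ _ (fun u : 'rV[R]_k => (1 - `|u|)^-1 *: u)
  (fun u => (1 + `|u|)^-1 *: u)).
- by move=> u u1; cont; apply: lt0r_neq0; rewrite subr_gt0.
- by move=> u _; cont; apply: lt0r_neq0; rewrite ltr_pwDl.
- by [].
- move=> u _ /=; rewrite normrZ ger0_norm ?invr_ge0 ?addr_ge0//.
  by rewrite mulrC ltr_pdivrMr ?ltr_pwDl// mul1r ltrDr.
- move=> u /= u1; have n0 : 0 < 1 - `|u| by rewrite subr_gt0.
  rewrite normrZ ger0_norm ?invr_ge0 ?ltW// scalerA -[RHS]scale1r; congr (_ *: _).
  by field; rewrite subrK oner_eq0 gt_eqF.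
- move=> u _ /=; have n0 : 0 < 1 + `|u| by rewrite ltr_pwDl.
  rewrite normrZ ger0_norm ?invr_ge0 ?ltW// scalerA -[RHS]scale1r; congr (_ *: _).
  by field; rewrite addrK oner_eq0 gt_eqF.
Qed.

End RowVectors.

Section Connectivity.
Context {R : realType}.

Lemma starlike_connected k (A : set 'rV[R]_k) (c : 'rV[R]_k) : A c ->
  (forall u (t : R), A u -> 0 <= t <= 1 -> A (c + t *: (u - c))) -> connected A.
Proof.
move=> Ac Ast; pose seg (u : 'rV[R]_k) := (fun t : R => c + t *: (u - c)) @` `[0, 1].
rewrite (_ : A = \bigcup_(u in A) seg u).
  apply: bigcup_connected.
    exists c => u _; exists 0; first by rewrite /= in_itv/= lexx ler01.
    by rewrite scale0r addr0.
  move=> u Au; apply: connected_continuous_connected; first exact: segment_connected.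
  apply: continuous_subspaceT => t; apply: cvgD; first exact: cvg_cst.
  by apply: cvgZr_tmp; exact: cvg_id.
apply/seteqP; split => [u Au|v [u Au [t t01 <-]]]; last by apply: Ast => //; rewrite /= in_itv in t01.
exists u => //; exists 1; first by rewrite /= in_itv/= lexx ler01.
by rewrite scale1r addrC subrK.
Qed.

Let half k (j : 'I_k) (s : R) : set 'rV[R]_k := [set v | 1 < s * v 0 j].

Let half_connected k (j : 'I_k) (s : R) : s * s = 1 -> connected (half j s).
Proof.
move=> s1; apply: (@starlike_connected _ _ (\row_i (2 * s))).
  by rewrite /half/= mxE mulrCA s1; lra.
move=> u t; rewrite /half/= !mxE => u1 /andP[t0 t1].
rewrite mulrDr mulrCA s1 mulr1.
have -> : s * (t * (u 0 j - 2 * s)) = t * (s * u 0 j - 2).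
  by rewrite -[X in _ = t * (_ - X)]mulr1 -s1; ring.
have [t1'|t1'] := ltP t 1.
  have : 0 <= t * (s * u 0 j - 1) by rewrite mulr_ge0// subr_ge0 ltW.
  lra.
have : 0 < t * (s * u 0 j - 1) by rewrite mulr_gt0 ?subr_gt0// (lt_le_trans _ t1').
lra.
Qed.

Let halfU k (i j : 'I_k) (s t : R) : i != j -> s * s = 1 -> t * t = 1 ->
  connected (half i s `|` half j t).
Proof.
move=> ij s1 t1; apply: connectedU; try exact: half_connected.
exists (\row_l (if l == i then 2 * s else 2 * t)); split; rewrite /half/= mxE.
  by rewrite eqxx mulrCA s1; lra.
by rewrite eq_sym (negbTE ij) mulrCA t1; lra.
Qed.

Lemma exterior_connected k : connected [set v : 'rV[R]_k.+2 | 1 < `|v|].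
Proof.
pose i0 : 'I_k.+2 := ord0; pose i1 : 'I_k.+2 := lift ord0 ord0.
have i01 : i0 != i1 by [].
pose b : 'rV[R]_k.+2 := \row_i 2.
have hb : half i0 1 b by rewrite /half/= mxE; lra.
have n11 : (-1 * -1 : R) = 1 by rewrite mulrNN mulr1.
have sub j s : s * s = 1 -> half j s `<=` [set v : 'rV[R]_k.+2 | 1 < `|v|].
  move=> s1 v /= h; apply: lt_le_trans h _; apply: le_trans (norm_coord v j).
  apply: le_trans (ler_norm _) _; rewrite normrM (_ : `|s| = 1) ?mul1r//.
  apply/eqP; rewrite -(@eqrXn2 _ 2%N)// expr1n real_normK ?num_real//.
  by rewrite expr2 s1.
have key v : 1 < `|v| -> exists C : set 'rV[R]_k.+2,
    [/\ connected C, C b, C v & C `<=` [set v : 'rV[R]_k.+2 | 1 < `|v|]].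
  move=> v1; have [j] := norm_rv_gt ler01 v1.
  have [s s1 ->] : exists2 s : R, s * s = 1 & `|v 0 j| = s * v 0 j.
    by case: (ger0P (v 0 j)) => _; [exists 1|exists (-1)]; rewrite ?mulN1r ?opprK ?mulr1 ?mul1r.
  move=> hv; have [ji|ji] := eqVneq j i0; last first.
    exists (half j s `|` half i0 1); split; [|by right|by left|].
      by apply: halfU => //; rewrite mulr1.
    by rewrite subUset; split; apply: sub => //; rewrite mulr1.
  exists ((half j s `|` half i1 1) `|` (half i1 1 `|` half i0 1)); split.
  - apply: connectedU.
    + by exists b; split; [right|left]; rewrite /half/= mxE; lra.
    + by apply: halfU => //; rewrite ?ji ?mulr1.
    + by apply: halfU => //; rewrite ?mulr1// eq_sym.
  - by right; right.
  - by left; left.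
  - by rewrite !subUset; split; split; apply: sub => //; rewrite mulr1.
rewrite (_ : [set v : 'rV[R]_k.+2 | _] = \bigcup_(C in
    [set C : set 'rV[R]_k.+2 | [/\ connected C, C b & C `<=` [set v : 'rV[R]_k.+2 | 1 < `|v|]]]) C).
  by apply: bigcup_connected => [|C []//]; exists b => C [].
apply/seteqP; split => [v /key[C [cC Cb Cv CE]]|v [C [_ _ CE] Cv]]; last exact: CE.
by exists C.
Qed.

End Connectivity.

Section Star.
Context {R : realType} {k : nat}.
Implicit Types (u v : 'rV[R]_k).
Variable (G : 'rV[R]_k -> R) (K : R).
Hypothesis G_ge1 : forall u, 1 <= G u.
Hypothesis G_le : forall u, G u <= K.
Hypothesis G_hom : forall (l : R) u, 0 < l -> G (l *: u) = G u.
Hypothesis G_cont : forall u, u != 0 -> {for u, continuous G}.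

Definition star : set 'rV[R]_k := [set u | `|u| = G u].

Let G_gt0 u : 0 < G u. Proof. exact: lt_le_trans (G_ge1 u). Qed.

Let enorm u := Num.sqrt (\sum_(i < k) u 0 i ^+ 2).

Let sum_ge0 u : 0 <= \sum_(i < k) u 0 i ^+ 2.
Proof. by apply: sumr_ge0 => i _; exact: sqr_ge0. Qed.

Let enorm_gt0 u : u != 0 -> 0 < enorm u.
Proof.
move=> u0; rewrite sqrtr_gt0 lt_def sum_ge0 andbT; apply: contra u0 => /eqP s0.
apply/eqP/rowP => i; rewrite mxE; apply/eqP.
rewrite -sqrf_eq0 eq_le sqr_ge0 andbT -s0 (bigD1 i)//= lerDl.
by apply: sumr_ge0 => j _; exact: sqr_ge0.
Qed.

Let enormZ (l : R) u : 0 < l -> enorm (l *: u) = l * enorm u.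
Proof.
move=> l0; rewrite /enorm; under eq_bigr do rewrite mxE exprMn.
by rewrite -mulr_sumr sqrtrM ?sqr_ge0// sqrtr_sqr gtr0_norm.
Qed.

Let enorm_cont u : {for u, continuous enorm}.
Proof.
apply: (@cont_comp _ _ _ Num.sqrt (fun v : 'rV[R]_k => \sum_(i < k) v 0 i ^+ 2)).
  exact: sqrt_continuous.
apply: (@cont_sum _ _ _ (fun i (v : 'rV[R]_k) => v 0 i ^+ 2)) => i.
by apply: (@contM _ _ (fun v : 'rV[R]_k => v 0 i) (fun v => v 0 i));
  exact: coord_continuous.
Qed.

Let star_neq0 u : star u -> u != 0.
Proof. by rewrite /star/= -normr_gt0 => ->. Qed.

Lemma star_usphere : homeomorphic star (@usphere R k).
Proof.
have sph u : usphere u -> enorm u = 1 by rewrite /usphere/= /enorm => ->; exact: sqrtr1.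
have sph0 u : usphere u -> u != 0.
  move=> /sph; apply: contra_eqT => /negPn/eqP ->.
  rewrite /enorm big1 ?sqrtr0 1?eq_sym ?oner_eq0// => i _.
  by rewrite mxE expr0n.
have sphn u : usphere u -> 0 < G u / `|u|.
  by move=> /sph0 u0; rewrite divr_gt0// normr_gt0.
apply: (@homeomorphicI _ _ _ _ (fun u => (enorm u)^-1 *: u) (fun u => (G u / `|u|) *: u)).
- move=> u /star_neq0 u0; apply: contZ; last by cont.
  by apply: contV; [exact: enorm_cont|rewrite gt_eqF// enorm_gt0].
- move=> u /sph0 u0; apply: contZ; last by cont.
  by apply: contM; [exact: G_cont|cont; rewrite normr_eq0].
- move=> u /star_neq0 /enorm_gt0 e0; rewrite /usphere/=.
  under eq_bigr do rewrite mxE exprMn.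
  rewrite -mulr_sumr -(sqr_sqrtr (sum_ge0 u)) -exprMn -/(enorm u).
  by rewrite mulVf ?gt_eqF// expr1n.
- move=> u us; rewrite /star/= normrZ (gtr0_norm (sphn _ us)) G_hom ?sphn//.
  by rewrite mulfVK// normr_eq0 sph0.
- move=> u us; have u0 := star_neq0 us; have e0 := enorm_gt0 u0.
  rewrite G_hom ?invr_gt0// normrZ gtr0_norm ?invr_gt0// us scalerA.
  rewrite -[RHS]scale1r; congr (_ *: _); field.
  by rewrite !gt_eqF.
- move=> u us; rewrite enormZ ?sphn// (sph u us) mulr1 scalerA mulVf ?scale1r//.
  by rewrite gt_eqF// sphn.
Qed.

Let inner : set 'rV[R]_k := [set u | `|u| < G u].
Let outer : set 'rV[R]_k := [set u | G u < `|u|].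

Let inner_open : open inner.
Proof.
rewrite openE => u /= uG; have [u0|u0] := eqVneq u 0.
  have : \forall v \near u, `|v| < 1.
    apply: (@cvgr_lt R _ (nbhs u) (nbhs_filter u) (fun v : 'rV[R]_k => `|v|) `|u|); last by rewrite u0 normr0.
    by apply: (@cont_norm _ _ _ (fun v : 'rV[R]_k => v)); exact: cvg_id.
  by apply: filterS => v v1; rewrite /inner/=; apply: lt_le_trans (G_ge1 v).
have : \forall v \near u, 0 < G v - `|v|.
  apply: (@cvgr_gt R _ (nbhs u) (nbhs_filter u) (fun v : 'rV[R]_k => G v - `|v|) (G u - `|u|)); last by rewrite subr_gt0.
  by apply: (@contD _ _ G (fun v => - `|v|)); [exact: G_cont|cont].
by apply: filterS => v; rewrite subr_gt0.
Qed.

Let outer_open : open outer.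
Proof.
rewrite openE => u /= uG.
have u0 : u != 0 by rewrite -normr_gt0 (lt_trans (G_gt0 u)).
have : \forall v \near u, 0 < `|v| - G v.
  apply: (@cvgr_gt R _ (nbhs u) (nbhs_filter u) (fun v : 'rV[R]_k => `|v| - G v) (`|u| - G u)); last by rewrite subr_gt0.
  by apply: (@contD _ _ (fun v : 'rV[R]_k => `|v|) (fun v => - G v));
    [cont|apply: contN; exact: G_cont].
by apply: filterS => v; rewrite subr_gt0.
Qed.

Let sides_separated : separated inner outer.
Proof.
have sep A B : open B -> A `&` B = set0 -> closure A `&` B = set0.
  move=> oB AB; apply/seteqP; split => // u [cA Bu].
  have [v [Av Bv]] := cA B (open_nbhs_nbhs (conj oB Bu)).
  by have : (A `&` B) v by []; rewrite AB.
have io : inner `&` outer = set0.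
  apply/seteqP; split => // u [/= h1 h2]; have := lt_trans h1 h2.
  by rewrite ltxx.
split; first exact: sep.
by rewrite setIC; apply: sep => //; rewrite setIC.
Qed.

Let sides_cover : ~` star = inner `|` outer.
Proof.
apply/seteqP; split => u /=.
  by move=> /eqP; rewrite neq_lt => /orP[]; [left|right].
by rewrite /star /inner/=/outer/= => -[] h e; rewrite e ltxx in h.
Qed.

Let inner_component u : inner u -> bounded_set (connected_component (~` star) u).
Proof.
move=> uI; have : connected_component (~` star) u `<=` inner.
  have sc : connected_component (~` star) u `<=` inner `|` outer.
    by rewrite -sides_cover; exact: connected_component_sub.
  case: (connected_subset sides_separated sc (@component_connected _ _ _)) => // sE.
  have : outer u by apply: sE; apply: connected_component_refl; rewrite sides_cover; left.
  by move=> uE; have := separated_disjoint sides_separated => /seteqP[/(_ u (conj uI uE))].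
move=> sub; exists K; split; first exact: num_real.
move=> M KM v /sub vI /=; apply: le_trans (ltW vI) (le_trans (G_le v) (ltW KM)).
Qed.

Let outer_component u : outer u -> ~ bounded_set (connected_component (~` star) u).
Proof.
move=> uE.
have u0 : 0 < `|u| := lt_trans (G_gt0 u) uE.
pose ray := (fun t : R => t *: u) @` [set t | 1 <= t].
have ray_sub : ray `<=` connected_component (~` star) u.
  apply: connected_component_max.
  - by exists 1; rewrite /= ?scale1r.
  - move=> v [t /= t1 <-]; suff : (inner `|` outer) (t *: u) by rewrite -sides_cover.
    right.
    rewrite /outer/= G_hom ?(lt_le_trans ltr01 t1)// normrZ.
    apply: lt_le_trans uE _; rewrite ler_peMl//; exact: le_trans t1 (ler_norm t).
  - rewrite /ray; apply: connected_continuous_connected.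
      apply/connected_intervalP => x y /= x1 y1 z /andP[xz zy].
      exact: le_trans xz.
    by apply: continuous_subspaceT => t; apply: cvgZr_tmp; exact: cvg_id.
move=> [M [_ HM]].
pose t : R := Num.max 1 ((`|M| + 2) / `|u|).
have tr : connected_component (~` star) u (t *: u).
  by apply: ray_sub; exists t => //=; rewrite le_max lexx.
have MM : M < `|M| + 1 by rewrite (le_lt_trans (ler_norm M))// ltrDl.
have /= := HM _ MM _ tr; rewrite normrZ ger0_norm ?le_max ?ler01//.
apply/negP; rewrite -ltNge; apply: (@lt_le_trans _ _ (`|M| + 2)).
  by rewrite ltrD2l; lra.
by rewrite -ler_pdivrMr// le_max lexx orbT.
Qed.

Lemma star_side (b : bool) :
  model_side star b = if b then outer else inner.
Proof.
apply/seteqP; split => u.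
  rewrite /model_side/= => -[us].
  have : (inner `|` outer) u by rewrite -sides_cover.
  by case: b => -[uI|uE] bc //; exfalso; [apply: bc; exact: inner_component|
    exact: (outer_component uE)].
case: b => us; split.
- by have : (~` star) u by rewrite sides_cover; right.
- exact: outer_component.
- by have : (~` star) u by rewrite sides_cover; left.
- exact: inner_component.
Qed.

End Star.

Section StarMore.
Context {R : realType} {k : nat}.
Variable (G : 'rV[R]_k.+2 -> R).
Hypothesis G_ge1 : forall u, 1 <= G u.
Hypothesis G_hom : forall (l : R) u, 0 < l -> G (l *: u) = G u.
Hypothesis G_cont : forall u, u != 0 -> {for u, continuous G}.
Let G_gt0 u : 0 < G u. Proof. exact: lt_le_trans (G_ge1 u). Qed.

Lemma star_inner_connected : connected [set u | `|u| < G u].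
Proof.
apply: (@starlike_connected _ _ _ 0); first by rewrite /= normr0.
move=> u t /= uG /andP[t0 t1]; rewrite subr0 add0r.
move: t0; rewrite le_eqVlt => /predU1P[<-|t0]; first by rewrite scale0r normr0.
rewrite G_hom// normrZ gtr0_norm//; apply: le_lt_trans uG.
by rewrite ler_piMl.
Qed.

Lemma star_outer_connected : connected [set u | G u < `|u|].
Proof.
have G0 u : G u != 0 by rewrite gt_eqF.
apply: (homeomorphic_connected _ (@exterior_connected R k)).
apply: (@homeomorphicI _ _ _ _ (fun u => G u *: u) (fun u => (G u)^-1 *: u)).
- move=> u /= u1; apply: contZ; last by cont.
  by apply: G_cont; rewrite -normr_gt0 (lt_trans ltr01).
- move=> u /= u1; apply: contZ; last by cont.
  by apply: contV => //; apply: G_cont; rewrite -normr_gt0 (lt_trans _ u1).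
- by move=> u /= u1; rewrite G_hom// normrZ gtr0_norm// ltr_pMr.
- by move=> u /= u1; rewrite normrZ gtr0_norm ?invr_gt0// mulrC ltr_pdivlMr// mul1r.
- by move=> u _; rewrite G_hom// scalerA mulVf// scale1r.
- by move=> u _; rewrite G_hom ?invr_gt0// scalerA divff// scale1r.
Qed.

Lemma star_outer_nonempty : (exists M, forall u, G u <= M) -> [set u | G u < `|u|] !=set0.
Proof.
move=> [M GM]; exists (\row_i (`|M| + 1)) => /=; apply: le_lt_trans (GM _) _.
apply: le_lt_trans (ler_norm M) _.
apply: (@lt_le_trans _ _ (`|M| + 1)); first by rewrite ltrDl.
have := norm_coord (\row_(i < k.+2) (`|M| + 1)) ord0; rewrite mxE; apply: le_trans.
exact: ler_norm.
Qed.

End StarMore.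

Section Polar.
Context {R : realType} {d : nat}.
Local Notation Y := (R * 'rV[R]_d)%type.
Local Notation E := 'rV[R]_d.+2.
Variables (n : nat) (X : R) (f : nat -> Y -> R) (eps : nat -> R -> R).
Hypothesis bs : base_system n X f eps.

Let M : R := n.+1%:R.
Let C : R := n.+2%:R.
Let L : R := 2 * X + 1.
Let eta : R := (L * (X + 1))^-1.

Let X1 : 1 <= X. Proof. exact: bs_X bs. Qed.
Let M0 : 0 < M. Proof. by rewrite /M ltr0n. Qed.
Let L1 : 1 <= L. Proof. by have := X1; rewrite /L; lra. Qed.
Let L0 : 0 < L. Proof. exact: lt_le_trans L1. Qed.
Let X10 : 0 < X + 1. Proof. by have := X1; lra. Qed.
Let eta0 : 0 < eta. Proof. by rewrite invr_gt0 mulr_gt0. Qed.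
Let etaL : L * eta * (X + 1) = 1.
Proof. by rewrite /eta; field; rewrite !gt_eqF. Qed.
Let eta1 : eta < 1.
Proof.
rewrite /eta invf_lt1 ?mulr_gt0//.
have := X1; have := L1 => l1 x1; rewrite (@lt_le_trans _ _ (X + 1))//; first lra.
by rewrite ler_peMl// ltW.
Qed.

Definition far (y : Y) := X <= y.1 \/ X <= `|y.2|.

(* Central projection of the sphere of directions, folded along the equator
   m = 0; the maxima only matter where every f i is constant. *)
Definition dir_proj (m : R) (w : 'rV[R]_d.+1) : Y :=
  (X + 1 - w 0 ord0 / Num.max `|m| (w 0 ord0 / L),
   (Num.max (w 0 ord0) `|m|)^-1 *: rv_tail w).

Definition equator (u : E) : R := u 0 ord0.

(* The height [n] is that of the new surface; the older ones are even in the
   equatorial coordinate. *)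
Definition shell_height i (u : E) : R :=
  if (i < n)%N then f i (dir_proj (equator u) (rv_tail u))
  else clip M (M * equator u / (eta * `|u|)).

Definition shell_radius i (u : E) : R := C + shell_height i u.

Lemma far_eq i y : (i < n)%N -> far y -> f i y = i.+1%:R.
Proof. exact: (bs_far bs). Qed.

Let denom_ge0 (m : R) (w : 'rV[R]_d.+1) : 0 <= Num.max `|m| (w 0 ord0 / L).
Proof. by rewrite le_max normr_ge0. Qed.

Lemma dir_proj_far1 (m : R) (w : 'rV[R]_d.+1) : w 0 ord0 <= `|m| -> far (dir_proj m w).
Proof.
move=> wm; left; rewrite /dir_proj/=.
suff : w 0 ord0 / Num.max `|m| (w 0 ord0 / L) <= 1 by lra.
have := denom_ge0 m w; rewrite le_eqVlt => /predU1P[<-|D0]; first by rewrite invr0 mulr0.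
by rewrite ler_pdivrMr// mul1r le_max wm.
Qed.

Let dir_proj_far2 (m : R) (w : 'rV[R]_d.+1) :
  X * Num.max (w 0 ord0) `|m| <= `|rv_tail w| -> far (dir_proj m w).
Proof.
have [wm _|wm] := leP (w 0 ord0) `|m|; first exact: dir_proj_far1.
have w0 : 0 < w 0 ord0 by exact: le_lt_trans wm.
move=> wz; right; rewrite /dir_proj/= (max_l (ltW wm)) normrZ normfV.
by rewrite gtr0_norm// mulrC ler_pdivlMr.
Qed.

Lemma dir_proj_collar (m : R) (w : 'rV[R]_d.+1) : 0 < w 0 ord0 -> L * `|m| <= w 0 ord0 ->
  dir_proj m w = (- X, (w 0 ord0)^-1 *: rv_tail w).
Proof.
move=> w0 Lm; rewrite /dir_proj max_r; last by rewrite ler_pdivlMr// mulrC.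
rewrite max_l; last by apply: le_trans Lm; rewrite ler_peMl.
congr (_, _); rewrite invf_div mulrC mulfVK ?gt_eqF// /L; ring.
Qed.

Let projZ (l m : R) (w : 'rV[R]_d.+1) : 0 < l -> dir_proj (l * m) (l *: w) = dir_proj m w.
Proof.
move=> l0; have ln0 : l != 0 by rewrite gt_eqF.
have D1 : Num.max `|l * m| (l * w 0 ord0 / L) = l * Num.max `|m| (w 0 ord0 / L).
  by rewrite normrM gtr0_norm// -mulrA maxr_pMr// ltW.
have D2 : Num.max (l * w 0 ord0) `|l * m| = l * Num.max (w 0 ord0) `|m|.
  by rewrite normrM gtr0_norm// maxr_pMr// ltW.
rewrite /dir_proj mxE D1 D2 rv_tailZ; congr (_ - _, _).
  by rewrite invfM mulrACA divff// mul1r.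
by rewrite scalerA; congr (_ *: _); rewrite invfM mulrAC mulVf// mul1r.
Qed.

Let dir_proj_flat (m m' : R) (w : 'rV[R]_d.+1) : `|m| < eta * `|w| -> `|m'| < eta * `|w| ->
  dir_proj m w = dir_proj m' w \/ far (dir_proj m w) /\ far (dir_proj m' w).
Proof.
move=> mw m'w; have [w0|w0] := leP (w 0 ord0) 0.
  by right; split; apply: dir_proj_far1; apply: le_trans w0 _.
have [wL|wL] := leP (L * (eta * `|w|)) (w 0 ord0).
  left; rewrite !dir_proj_collar//.
    by apply: le_trans wL; rewrite ler_pM2l// ltW.
  by apply: le_trans wL; rewrite ler_pM2l// ltW.
right; suff H (m0 : R) : `|m0| < eta * `|w| -> far (dir_proj m0 w) by split; exact: H.
move=> m0w; apply: dir_proj_far2.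
have wpos : 0 < `|w|.
  rewrite lt_def normr_ge0 andbT; apply: contraTneq wL => ->.
  by rewrite !mulr0 -leNgt ltW.
have wX : w 0 ord0 * (X + 1) < `|w|.
  have := wL; rewrite -(ltr_pM2r X10) => /lt_le_trans; apply.
  by rewrite mulrA mulrAC etaL mul1r.
have mX : `|m0| * (X + 1) < `|w|.
  move: m0w; rewrite -(ltr_pM2r X10) => /lt_le_trans; apply.
  have e1 : eta * (X + 1) <= 1.
    by rewrite -[leRHS]etaL -mulrA ler_peMl// ltW// mulr_gt0.
  by rewrite mulrAC ler_piMl.
have tw : `|rv_tail w| = `|w|.
  have := rv_cons_tail w => E1; have := norm_rv_cons (w 0 ord0) (rv_tail w).
  rewrite E1 => ->; rewrite max_r//; apply/ltW; rewrite ltNge; apply/negP => tle.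
  have : `|w| = w 0 ord0.
    by rewrite -[in LHS]E1 norm_rv_cons max_l// gtr0_norm.
  move=> we; move: wX; rewrite we; apply/negP; rewrite -leNgt ler_peMr ?ltW//.
  by have := X1; lra.
rewrite tw; case: (leP (w 0 ord0) `|m0|) => _; have x1 := X1.
  by apply: le_trans (ltW mX); rewrite mulrC ler_wpM2l//; lra.
by apply: le_trans (ltW wX); rewrite mulrC ler_wpM2l// ?ltW//; lra.
Qed.

Lemma shell_height_flat i (u : E) (m : R) : (i < n)%N -> `|equator u| < eta * `|rv_tail u| ->
  `|m| < eta * `|rv_tail u| -> shell_height i u = f i (dir_proj m (rv_tail u)).
Proof.
move=> iltn h1 h2; rewrite /shell_height iltn.
by have [->//|[F1 F2]] := dir_proj_flat h1 h2; rewrite !far_eq.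
Qed.

Lemma shell_height_bound i u : (i <= n)%N -> `|shell_height i u| <= i.+1%:R.
Proof.
rewrite /shell_height leq_eqVlt => /predU1P[->|iltn]; first by rewrite ltnn clip_norm.
by rewrite iltn; exact: (bs_bound bs).
Qed.

Lemma shell_heightZ i (l : R) u : 0 < l -> shell_height i (l *: u) = shell_height i u.
Proof.
move=> l0; rewrite /shell_height /equator mxE rv_tailZ projZ//.
rewrite normrZ gtr0_norm// mulrCA [eta * _]mulrCA invfM.
by rewrite mulrACA divff ?gt_eqF// mul1r.
Qed.

Lemma shell_height_cont i u : (i <= n)%N -> u != 0 -> {for u, continuous (shell_height i)}.
Proof.
have ceq : {for u, continuous equator} by exact: coord_continuous.
have ctl : {for u, continuous (fun v : E => rv_tail v)}.
  by apply: (@cont_rv_tail _ _ _ (fun v : E => v)); cont.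
have ct0 : {for u, continuous (fun v : E => rv_tail v 0 ord0)}.
  exact: (@cont_coord _ _ _ _ (fun v : E => rv_tail v)).
have ctt : {for u, continuous (fun v : E => rv_tail (rv_tail v))}.
  exact: (@cont_rv_tail _ _ _ (fun v : E => rv_tail v)).
have cab : {for u, continuous (fun v : E => `|equator v|)}.
  exact: (@cont_norm _ _ _ equator).
move=> iltn u0; have nu0 : 0 < `|u| by rewrite normr_gt0.
move: iltn; rewrite leq_eqVlt => /predU1P[->|iltn].
  rewrite /shell_height ltnn.
  apply: (@cont_clip _ _ M (fun v : E => M * equator v / (eta * `|v|))).
  cont; last by rewrite mulf_neq0// gt_eqF.
  exact: ceq.
pose g (v : E) := f i (dir_proj (equator v) (rv_tail v)).
rewrite (_ : shell_height i = g); last by apply/funext => v; rewrite /shell_height iltn.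
have [pos|npos] := ltP 0 (Num.max (rv_tail u 0 ord0) `|equator u|).
  apply: (@cont_comp _ _ _ (f i) (fun v : E => dir_proj (equator v) (rv_tail v))).
    exact: (bs_cont bs).
  have D0 : Num.max `|equator u| (rv_tail u 0 ord0 / L) != 0.
    rewrite gt_eqF// lt_max; move: pos; rewrite lt_max => /orP[h|->//].
    by rewrite divr_gt0// orbT.
  rewrite /dir_proj; cont1.
    cont; first [exact: ceq|exact: ct0|exact: cab|exact: D0|exact: lt0r_neq0].
  cont; first [exact: ceq|exact: ctt|exact: ct0|exact: cab|by rewrite gt_eqF].
have eq0 : equator u = 0.
  by apply/eqP; rewrite -normr_le0; apply: le_trans npos; rewrite le_max lexx orbT.
have t0 : rv_tail u 0 ord0 <= 0 by apply: le_trans npos; rewrite le_max lexx.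
apply: (@cont_near _ _ g (fun=> i.+1%:R) u); last exact: cont_cst.
suff : \forall v \near u, far (dir_proj (equator v) (rv_tail v)).
  by apply: filterS => v; exact: far_eq.
move: t0; rewrite le_eqVlt => /predU1P[t0|t0]; last first.
  have : \forall v \near u, rv_tail v 0 ord0 < 0.
    exact: (@cvgr_lt R _ (nbhs u) (nbhs_filter u) (fun v : E => rv_tail v 0 ord0)
      (rv_tail u 0 ord0)).
  by apply: filterS => v v0; apply: dir_proj_far1; rewrite ltW// (lt_le_trans v0).
pose D (v : E) := `|rv_tail (rv_tail v)| - X * Num.max (rv_tail v 0 ord0) `|equator v|.
have Dc : {for u, continuous D}.
  by rewrite /D; cont; first [exact: ceq|exact: ctt|exact: ct0|exact: cab].
have Du : 0 < D u.
  rewrite /D eq0 t0 normr0 maxxx mulr0 subr0 normr_gt0.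
  apply: contra u0 => /eqP tt; apply/eqP.
  rewrite -(rv_cons_tail u) -[u 0 ord0]/(equator u) eq0 -(rv_cons_tail (rv_tail u)) t0 tt.
  by apply/rowP => j; rewrite !mxE; case: unliftP => // j' _; rewrite !mxE; case: unliftP => // j'' _; rewrite !mxE.
have : \forall v \near u, 0 < D v.
  exact: (@cvgr_gt R _ (nbhs u) (nbhs_filter u) D (D u)).
by apply: filterS => v v0; apply: dir_proj_far2; rewrite -subr_ge0 ltW.
Qed.

Lemma shell_radius_ge1 i u : (i <= n)%N -> 1 <= shell_radius i u.
Proof.
move=> iltn; have := shell_height_bound u iltn; rewrite ler_norml => /andP[h _].
have iM : i.+1%:R <= M by rewrite ler_nat.
have -> : shell_radius i u = 1 + (M + shell_height i u) by rewrite /shell_radius /C /M -addn1 natrD; ring.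
by lra.
Qed.

Lemma shell_radius_le i u : (i <= n)%N -> shell_radius i u <= C + M.
Proof.
move=> iltn; have := shell_height_bound u iltn; rewrite ler_norml => /andP[_ h].
by rewrite lerD2l (le_trans h)// ler_nat.
Qed.

Lemma shell_radiusZ i (l : R) u : 0 < l -> shell_radius i (l *: u) = shell_radius i u.
Proof. by move=> l0; rewrite /shell_radius shell_heightZ. Qed.

Lemma shell_radius_cont i u : (i <= n)%N -> u != 0 -> {for u, continuous (shell_radius i)}.
Proof. by move=> iltn u0; apply: contD; [cont|exact: shell_height_cont]. Qed.

Definition shell i : set E := star (shell_radius i).

(* [squeeze a] maps ]a, 1] onto ]0, 1] and is the identity on [eta, 1]. *)
Let squeeze (a l : R) := l - a * Num.max 0 (eta - l) / (eta - a).
Let unsqueeze (a p : R) := p + a * Num.max 0 (eta - p) / eta.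

Let squeeze_id (a l : R) : eta <= l -> squeeze a l = l.
Proof. by move=> el; rewrite /squeeze max_l ?subr_le0// mulr0 mul0r subr0. Qed.

Let squeezeE (a l : R) : a < eta -> l < eta -> squeeze a l = eta * (l - a) / (eta - a).
Proof.
move=> ae le; rewrite /squeeze max_r ?subr_ge0 ?ltW//; field.
by rewrite subr_eq0 gt_eqF.
Qed.

Let squeeze_gt0 (a l : R) : `|a| < eta -> a < l -> 0 < squeeze a l.
Proof.
rewrite ltr_norml => /andP[_ ae] al; have [el|el] := leP eta l.
  by rewrite squeeze_id// (lt_le_trans eta0).
by rewrite squeezeE// divr_gt0 ?mulr_gt0 ?subr_gt0.
Qed.

Let squeeze_lt (a l : R) : `|a| < eta -> a < l -> l < eta -> squeeze a l < eta.
Proof.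
rewrite ltr_norml => /andP[_ ae] al el; rewrite squeezeE// ltr_pdivrMr ?subr_gt0//.
by rewrite ltr_pM2l// ltrD2r.
Qed.

Let unsqueeze_id (a p : R) : eta <= p -> unsqueeze a p = p.
Proof. by move=> el; rewrite /unsqueeze max_l ?subr_le0// mulr0 mul0r addr0. Qed.

Let unsqueezeE (a p : R) : p < eta -> unsqueeze a p = a + p * (eta - a) / eta.
Proof.
move=> pe; rewrite /unsqueeze max_r ?subr_ge0 ?ltW//; field.
by rewrite gt_eqF.
Qed.

Let unsqueeze_gt (a p : R) : `|a| < eta -> 0 < p -> a < unsqueeze a p.
Proof.
rewrite ltr_norml => /andP[_ ae] p0; have [el|el] := leP eta p.
  by rewrite unsqueeze_id// (lt_le_trans ae).
by rewrite unsqueezeE// ltrDl divr_gt0// mulr_gt0// subr_gt0.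
Qed.

Let unsqueeze_lt (a p : R) : `|a| < eta -> p < eta -> unsqueeze a p < eta.
Proof.
rewrite ltr_norml => /andP[_ ae] pe; rewrite unsqueezeE// -ltrBrDl ltr_pdivrMr//.
by rewrite mulrC ltr_pM2l// subr_gt0.
Qed.

Let squeezeK (a l : R) : `|a| < eta -> a < l -> unsqueeze a (squeeze a l) = l.
Proof.
move=> an al; have := an; rewrite ltr_norml => /andP[_ ae]; have [el|el] := leP eta l.
  by rewrite squeeze_id// unsqueeze_id.
rewrite unsqueezeE ?squeeze_lt// squeezeE//; field.
by rewrite subr_eq0 !gt_eqF.
Qed.

Let unsqueezeK (a p : R) : `|a| < eta -> 0 < p -> squeeze a (unsqueeze a p) = p.
Proof.
move=> an p0; have := an; rewrite ltr_norml => /andP[_ ae]; have [el|el] := leP eta p.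
  by rewrite unsqueeze_id// squeeze_id.
rewrite squeezeE ?unsqueeze_lt// unsqueezeE//; field.
by rewrite subr_eq0 !gt_eqF.
Qed.

Section Sector.
Variables (A : nat -> bool) (a : R -> R) (sg : R).
Hypothesis a_cont : continuous a.
Hypothesis a_eta : forall t, `|t| < M -> `|a t| < eta.
Hypothesis sg2 : sg * sg = 1.

Let W := cell n f A.

(* On the new surface the equatorial coordinate of u / |u| is the slope [a] at
   height |u| - C; the sign [sg] selects one of the sides of the surface. *)
Definition sector : set E :=
  [set u | W (dir_proj (equator u) (rv_tail u), `|u| - C) /\
           a (`|u| - C) * `|u| < sg * equator u].

Let sg_norm : `|sg| = 1.
Proof.
by apply/eqP; rewrite -(@eqrXn2 _ 2%N)// expr1n real_normK ?num_real// expr2 sg2.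
Qed.

Let W_bound y t : W (y, t) -> `|t| < M. Proof. by case. Qed.

Let W_far y y' t : far y -> far y' -> W (y, t) -> W (y', t).
Proof.
move=> fy fy' [tM H]; split => // i iltn; have := H i iltn => /=.
by rewrite !far_eq.
Qed.

Let cell_proj (m p : R) (w : 'rV[R]_d.+1) t : 0 < p ->
  `|m| = p \/ `|m| < eta * `|w| /\ p < eta * `|w| ->
  W (dir_proj m w, t) <->
  W ((X + 1 - w 0 ord0 / p, (Num.max (w 0 ord0) p)^-1 *: rv_tail w), t).
Proof.
move=> p0 H; have np : `|p| = p by rewrite gtr0_norm.
have -> : W (dir_proj m w, t) <-> W (dir_proj p w, t).
  case: H => [mp|[mw pw]]; first by rewrite /dir_proj mp np.
  rewrite -[in p < _]np in pw; have [-> //|[F1 F2]] := dir_proj_flat mw pw.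
  by split; exact: W_far.
rewrite /dir_proj np; have [Lp|Lp] := leP (w 0 ord0 / L) p.
  by [].
have w0 : 0 < w 0 ord0 by have := lt_trans p0 Lp; rewrite pmulr_lgt0 ?invr_gt0.
have e1 : X + 1 - w 0 ord0 / (w 0 ord0 / L) = - X.
  by rewrite invf_div mulrC mulfVK ?gt_eqF// /L; ring.
have e2 : X + 1 - w 0 ord0 / p <= - X.
  suff : L <= w 0 ord0 / p by rewrite /L; lra.
  by rewrite ler_pdivlMr// mulrC ltW// -ltr_pdivlMr.
rewrite e1; split => -[tM F]; split => // i iltn; have := F i iltn => /=.
  by rewrite !(bs_collar bs).
by rewrite !(bs_collar bs).
Qed.

Let gauge_unsqueeze (y : 'rV[R]_d.+1) b : `|b| < eta ->
  let Q := Num.max 1 `|y| in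
  Num.max `|unsqueeze b Q^-1| (`|y| / Q) = 1.
Proof.
move=> be Q; have Q1 : 1 <= Q by rewrite le_max lexx.
have Q0 : 0 < Q by rewrite (lt_le_trans ltr01).
have [y1|y1] := leP `|y| 1.
  have QE : Q = 1 by rewrite /Q max_l.
  by rewrite QE invr1 unsqueeze_id ?(ltW eta1)// normr1 mulr1 max_l.
have QE : Q = `|y| by rewrite /Q max_r// ltW.
rewrite -QE divff ?gt_eqF// max_r//.
have Qi : 0 < Q^-1 by rewrite invr_gt0.
have := unsqueeze_gt be Qi; have := be; rewrite ltr_norml => /andP[b1 b2] ub.
have e1 := eta1; rewrite ler_norml; apply/andP; split; first lra.
have [el|el] := leP eta Q^-1; first by rewrite unsqueeze_id// invf_le1.
by have := unsqueeze_lt be el; lra.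
Qed.

Let toW (u : E) : Y * R :=
  let p := `|u| * squeeze (a (`|u| - C)) (sg * equator u / `|u|) in
  ((X + 1 - rv_tail u 0 ord0 / p,
    (Num.max (rv_tail u 0 ord0) p)^-1 *: rv_tail (rv_tail u)), `|u| - C).

Let lift (q : Y * R) : 'rV[R]_d.+1 :=
  rv_cons (X + 1 - q.1.1) (Num.max (X + 1 - q.1.1) 1 *: q.1.2).
Let gauge (q : Y * R) : R := Num.max 1 `|lift q|.
Let fromW (q : Y * R) : E :=
  (q.2 + C) *: rv_cons (sg * unsqueeze (a q.2) (gauge q)^-1) ((gauge q)^-1 *: lift q).

Let C_M : C = M + 1. Proof. by rewrite /C /M -addn1 natrD. Qed.

Let gauge_gt0 q : 0 < gauge q.
Proof. by rewrite /gauge lt_max ltr01. Qed.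

Let norm_fromW q : `|q.2| < M -> `|fromW q| = q.2 + C.
Proof.
move=> tM; have r0 : 0 < q.2 + C.
  by move: tM; rewrite ltr_norml C_M => /andP[? ?]; lra.
rewrite /fromW normrZ gtr0_norm// norm_rv_cons normrM sg_norm mul1r.
rewrite normrZ (gtr0_norm (_ : 0 < (gauge q)^-1)) ?invr_gt0// [_^-1 * _]mulrC.
by rewrite gauge_unsqueeze ?a_eta// mulr1.
Qed.

Let sector_facts u : W (dir_proj (equator u) (rv_tail u), `|u| - C) ->
  a (`|u| - C) * `|u| < sg * equator u ->
  [/\ 0 < `|u|, `|a (`|u| - C)| < eta, a (`|u| - C) < sg * equator u / `|u|,
      sg * equator u / `|u| <= 1 &
      sg * equator u / `|u| < 1 -> `|rv_tail u| = `|u|].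
Proof.
move=> /W_bound tM; have r0 : 0 < `|u|.
  by move: tM; rewrite ltr_norml C_M => /andP[? ?]; lra.
rewrite -ltr_pdivlMr// => al; have ae := a_eta tM.
have nu : `|u| = Num.max `|equator u| `|rv_tail u|.
  by rewrite -[in LHS](rv_cons_tail u) norm_rv_cons.
have el : `|equator u| <= `|u| by rewrite nu le_max lexx.
have sl : `|sg * equator u| <= `|u| by rewrite normrM sg_norm mul1r.
split => //.
  by rewrite ler_pdivrMr// mul1r (le_trans _ sl)// ler_norm.
rewrite ltr_pdivrMr// mul1r => lt1.
have : `|equator u| < `|u|.
  rewrite -[`|equator u|]mul1r -sg_norm -normrM ltr_norml lt1 andbT.
  move: al; rewrite ltr_pdivlMr//; apply: lt_trans.
  rewrite -mulN1r ltr_pM2r//; move: ae; rewrite ltr_norml => /andP[+ _].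
  by apply: lt_trans; rewrite ltrN2.
by rewrite nu; case: (leP `|equator u| `|rv_tail u|) => // _; rewrite ltxx.
Qed.

Let toWP u : sector u -> W (toW u).
Proof.
move=> [Wu au]; have [r0 ae al l1 tl] := sector_facts Wu au.
apply/(cell_proj _ (m := equator u)) => //.
  by rewrite mulr_gt0// squeeze_gt0.
have [el|el] := leP eta (sg * equator u / `|u|).
  left; rewrite squeeze_id// mulrCA divff ?gt_eqF// mulr1.
  have h : 0 < sg * equator u.
    have h := lt_le_trans eta0 el.
    by rewrite -[sg * _](@mulfVK _ `|u|) ?gt_eqF// mulr_gt0.
  by rewrite -[LHS]mul1r -sg_norm -normrM gtr0_norm.
have tu := tl (lt_trans el eta1).
right; rewrite tu; split; last by rewrite mulrC ltr_pM2r// squeeze_lt.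
rewrite -ltr_pdivrMr// -[X in _ / X](gtr0_norm r0) -normfV -normrM.
rewrite -[ltLHS]mul1r -sg_norm -normrM mulrA ltr_norml el andbT.
by apply: lt_trans al; move: ae; rewrite ltr_norml => /andP[].
Qed.

Let lift0 q : lift q 0 ord0 = X + 1 - q.1.1. Proof. exact: rv_cons0. Qed.
Let tail_lift q : rv_tail (lift q) = Num.max (X + 1 - q.1.1) 1 *: q.1.2.
Proof. exact: rv_tail_cons. Qed.

Let tail_fromW q : rv_tail (fromW q) = ((q.2 + C) / gauge q) *: lift q.
Proof. by rewrite /fromW rv_tailZ rv_tail_cons scalerA. Qed.

Let equator_fromW q :
  equator (fromW q) = (q.2 + C) * (sg * unsqueeze (a q.2) (gauge q)^-1).
Proof. by rewrite /fromW /equator mxE rv_cons0. Qed.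

Let slope_fromW q : `|q.2| < M ->
  sg * equator (fromW q) / `|fromW q| = unsqueeze (a q.2) (gauge q)^-1.
Proof.
move=> tM; have r0 : 0 < q.2 + C.
  by move: tM; rewrite ltr_norml C_M => /andP[? ?]; lra.
rewrite norm_fromW// equator_fromW.
move: (unsqueeze _ _) (q.2 + C) r0 => l r r0.
by rewrite -[RHS]mul1r -sg2; field; rewrite gt_eqF.
Qed.

Let toW_fromW q : `|q.2| < M -> toW (fromW q) = q.
Proof.
move=> tM; have r0 : 0 < q.2 + C.
  by move: tM; rewrite ltr_norml C_M => /andP[? ?]; lra.
have g0 := gauge_gt0 q; have gi : 0 < (gauge q)^-1 by rewrite invr_gt0.
rewrite /toW slope_fromW// norm_fromW// addrK unsqueezeK ?a_eta//.
set k := (q.2 + C) / gauge q; have k0 : 0 < k by rewrite mulr_gt0.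
rewrite tail_fromW -/k rv_tailZ mxE lift0 tail_lift mulrC mulKf ?gt_eqF//.
have -> : Num.max (k * (X + 1 - q.1.1)) k = k * Num.max (X + 1 - q.1.1) 1.
  by rewrite maxr_pMr ?ltW// mulr1.
set b := Num.max _ 1; have b0 : 0 < b by rewrite lt_max ltr01 orbT.
rewrite !scalerA; have -> : (k * b)^-1 * k * b = 1.
  by field; rewrite !gt_eqF.
by rewrite scale1r; case: q {tM r0 g0 gi k k0 b b0} => -[x z] t /=; congr (_, _, _); ring.
Qed.

Let fromWP q : W q -> sector (fromW q).
Proof.
move=> Wq; have tM : `|q.2| < M by case: q Wq => y t /W_bound.
have r0 : 0 < q.2 + C.
  by move: tM; rewrite ltr_norml C_M => /andP[? ?]; lra.
have g0 := gauge_gt0 q; have gi : 0 < (gauge q)^-1 by rewrite invr_gt0.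
have ae := a_eta tM; have ug := unsqueeze_gt ae gi.
split; last first.
  rewrite norm_fromW// addrK equator_fromW; set l := unsqueeze _ _.
  have -> : sg * ((q.2 + C) * (sg * l)) = sg * sg * ((q.2 + C) * l) by ring.
  by rewrite sg2 mul1r mulrC ltr_pM2l.
have p0 : 0 < (q.2 + C) * (gauge q)^-1 by rewrite mulr_gt0.
have cond : `|equator (fromW q)| = (q.2 + C) * (gauge q)^-1 \/
    `|equator (fromW q)| < eta * `|rv_tail (fromW q)| /\
    (q.2 + C) * (gauge q)^-1 < eta * `|rv_tail (fromW q)|.
  rewrite equator_fromW normrM (gtr0_norm r0) normrM sg_norm mul1r.
  have [el|el] := leP eta (gauge q)^-1.
    by left; rewrite unsqueeze_id// gtr0_norm.
  right; have gl : gauge q = `|lift q|.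
    rewrite /gauge max_r// leNgt; apply/negP => l1.
    by move: el; rewrite /gauge max_l ?ltW// invr1 => /(lt_trans eta1); rewrite ltxx.
  have -> : `|rv_tail (fromW q)| = q.2 + C.
    by rewrite tail_fromW normrZ (gtr0_norm p0) -gl mulfVK// gt_eqF.
  rewrite ![eta * _]mulrC !ltr_pM2l//; split => //.
  rewrite ltr_norml (unsqueeze_lt ae el) andbT; apply: lt_trans ug.
  by move: ae; rewrite ltr_norml => /andP[].
have H := cell_proj q.2 p0 cond.
rewrite norm_fromW// addrK; apply: H.2.
have := toW_fromW tM; rewrite /toW slope_fromW// norm_fromW// addrK unsqueezeK//.
by move=> ->.
Qed.

Let fromW_toW u : sector u -> fromW (toW u) = u.
Proof.
move=> [Wu au]; have [r0 ae al l1 tl] := sector_facts Wu au.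
set p := squeeze (a (`|u| - C)) (sg * equator u / `|u|).
have p0 : 0 < p by exact: squeeze_gt0.
pose k := `|u| * p; have k0 : 0 < k by rewrite mulr_gt0.
have liftE : lift (toW u) = k^-1 *: rv_tail u.
  have e : X + 1 - (toW u).1.1 = k^-1 * rv_tail u 0 ord0.
    by rewrite /toW/= -/p -/k; ring.
  rewrite /lift e -[RHS]rv_cons_tail rv_tailZ [X in rv_cons X _ = _](_ : _ = (k^-1 *: rv_tail u) 0 ord0); last first.
    by rewrite [RHS]mxE.
  congr (rv_cons _ _); rewrite [(toW u).1.2]/= -/p -/k scalerA; congr (_ *: _).
  have -> : Num.max (rv_tail u 0 ord0) k = k * Num.max (k^-1 * rv_tail u 0 ord0) 1.
    by rewrite maxr_pMr ?ltW// mulr1 mulrA divff ?mul1r// gt_eqF.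
  by rewrite (invfM k) mulrCA mulfV ?mulr1// gt_eqF// lt_max ltr01 orbT.
have gE : (gauge (toW u))^-1 = p.
  rewrite /gauge liftE normrZ gtr0_norm ?invr_gt0//.
  have tu : `|rv_tail u| <= `|u|.
    by rewrite -[in leRHS](rv_cons_tail u) norm_rv_cons le_max lexx orbT.
  move: l1; rewrite le_eqVlt => /predU1P[l1|l1].
    have pE : p = 1 by rewrite /p l1 squeeze_id// ltW.
    by rewrite pE /k pE mulr1 max_l ?invr1// mulrC ler_pdivrMr// mul1r.
  rewrite tl// /k invfM mulrAC mulVf ?mul1r ?gt_eqF// max_r ?invrK//.
  rewrite invf_ge1//; have [el|el] := leP eta (sg * equator u / `|u|).
    by rewrite /p squeeze_id// ltW.
  by rewrite ltW// (lt_trans _ eta1)// squeeze_lt.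
rewrite /fromW gE liftE [(toW u).2]/= subrK /p squeezeK// -/p rv_consZ.
rewrite !scalerA -[RHS]rv_cons_tail; congr rv_cons.
  rewrite -[RHS]mul1r -sg2 -/(equator u); field.
  by rewrite gt_eqF.
rewrite -[RHS]scale1r; congr (_ *: _); rewrite /k; field.
by rewrite !gt_eqF.
Qed.

Lemma sector_cell : homeomorphic sector W.
Proof.
have cabs (u : E) : {for u, continuous (fun v : E => `|v|)} by cont.
have ceq (u : E) : {for u, continuous equator} by exact: coord_continuous.
have ctl (u : E) : {for u, continuous (fun v : E => rv_tail v)}.
  by apply: (@cont_rv_tail _ _ _ (fun v : E => v)); cont.
have ct0 (u : E) : {for u, continuous (fun v : E => rv_tail v 0 ord0)}.
  exact: (@cont_coord _ _ _ _ (fun v : E => rv_tail v)).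
have ctt (u : E) : {for u, continuous (fun v : E => rv_tail (rv_tail v))}.
  exact: (@cont_rv_tail _ _ _ (fun v : E => rv_tail v)).
apply: (@homeomorphicI _ _ _ _ toW fromW).
- move=> u [Wu au]; have [r0 ae al l1 tl] := sector_facts Wu au.
  have ca : {for u, continuous (fun v : E => a (`|v| - C))}.
    by apply: (@cont_comp _ _ _ a (fun v : E => `|v| - C) u a_cont); cont.
  have cs : {for u, continuous (fun v : E =>
      squeeze (a (`|v| - C)) (sg * equator v / `|v|))}.
    rewrite /squeeze; cont; first [exact: ca|exact: ceq|by rewrite gt_eqF|idtac].
    by rewrite subr_eq0 gt_eqF//; move: ae; rewrite ltr_norml => /andP[].
  have sp := squeeze_gt0 ae al.
  have np : `|u| * squeeze (a (`|u| - C)) (sg * equator u / `|u|) != 0.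
    by rewrite mulf_neq0// gt_eqF.
  rewrite /toW; cont; first [exact: cs|exact: ct0|exact: ctt|exact: np|idtac].
  by rewrite gt_eqF// lt_max mulr_gt0// orbT.
- move=> q /= Wq.
  have g0 := gauge_gt0 q.
  have ca : {for q, continuous (fun p : Y * R => a p.2)}.
    by apply: (@cont_comp _ _ _ a (fun p : Y * R => p.2) q a_cont); cont.
  have clift : {for q, continuous lift}.
    apply: (@cont_rv_cons _ _ _ (fun p : Y * R => X + 1 - p.1.1)
      (fun p : Y * R => Num.max (X + 1 - p.1.1) 1 *: p.1.2)); cont.
  have cg : {for q, continuous gauge} by rewrite /gauge; cont; exact: clift.
  have cgi : {for q, continuous (fun p => (gauge p)^-1)}.
    by apply: contV => //; rewrite gt_eqF.
  rewrite /fromW; apply: (@contZ _ _ _ (fun p : Y * R => p.2 + C)); first by cont.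
  apply: (@cont_rv_cons _ _ _
    (fun p : Y * R => sg * unsqueeze (a p.2) (gauge p)^-1)
    (fun p : Y * R => (gauge p)^-1 *: lift p)).
    rewrite /unsqueeze; cont; first [exact: ca|exact: cg|by rewrite gt_eqF].
  by apply: contZ.
- exact: toWP.
- exact: fromWP.
- exact: fromW_toW.
- by move=> [y t] Wq; rewrite toW_fromW//; exact: W_bound Wq.
Qed.

End Sector.

End Polar.

Section EmbeddedSurfaces.
Context {R : realType}.

Lemma homeomorphic_image (T U : topologicalType) (E : T -> U) (P : U -> T)
    (D : set T) :
  (forall y, {for y, continuous E}) -> (forall y, {for E y, continuous P}) ->
  (forall y, P (E y) = y) -> homeomorphic (E @` D) D.
Proof.
move=> cE cP PE; apply: (@homeomorphicI _ _ _ _ P E).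
- by move=> _ [y _ <-]; exact: cP.
- by move=> y _; exact: cE.
- by move=> _ [y Dy <-]; rewrite PE.
- by move=> y Dy; exists y.
- by move=> _ [y _ <-]; rewrite PE.
- by move=> y _; rewrite PE.
Qed.

Lemma msurface_embed (T : topologicalType) k N (E : T -> 'rV[R]_N)
    (P : 'rV[R]_N -> T) (D : set T) :
  (forall y, {for y, continuous E}) -> (forall y, {for E y, continuous P}) ->
  (forall y, P (E y) = y) -> homeomorphic [set: T] [set: 'rV[R]_k.+1] ->
  homeomorphic D (@usphere R k.+1) -> is_msurface k.+1 (E @` D).
Proof.
move=> cE cP PE TR DS; split.
  exists (range E); last exact: image_subset.
  exists setT; first by left.
  by apply: homeomorphic_trans TR; exact: homeomorphic_image cE cP PE.
by apply: homeomorphic_trans DS; exact: homeomorphic_image cE cP PE.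
Qed.

Lemma sphere_usphere k (h : R) : 0 < h ->
  homeomorphic [set z : 'rV[R]_k | `|z| = h] (@usphere R k).
Proof.
move=> h0; have h1 : h != 0 by rewrite gt_eqF.
apply: (@homeomorphic_trans _ _ _ _ (star (fun _ : 'rV[R]_k => 1))); last first.
  by apply: star_usphere => // u _; cont.
apply: (@homeomorphicI _ _ _ _ (fun z : 'rV[R]_k => h^-1 *: z)
  (fun z => h *: z)).
- by move=> z _; cont.
- by move=> z _; cont.
- by move=> z /= zh; rewrite /star/= normrZ zh gtr0_norm ?invr_gt0// mulVf.
- by move=> z /= zh; rewrite normrZ zh gtr0_norm// mulr1.
- by move=> z _; rewrite scalerA divff// scale1r.
- by move=> z _; rewrite scalerA mulVf// scale1r.
Qed.

Lemma msurface_sphere k N (E : 'rV[R]_k -> 'rV[R]_N) (P : 'rV[R]_N -> 'rV[R]_k)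
    (h : R) : 0 < h ->
  (forall y, {for y, continuous E}) -> (forall y, {for E y, continuous P}) ->
  (forall y, P (E y) = y) -> is_msurface k (E @` [set z | `|z| = h]).
Proof.
move=> h0 cE cP PE; case: k E P cE cP PE => [|k] E P cE cP PE.
  apply/seteqP; split => // _ [z /= zh _].
  by move: h0; rewrite -zh norm_rv0 ltxx.
apply: msurface_embed cE cP PE _ _; first exact: homeomorphic_refl.
exact: sphere_usphere.
Qed.

Lemma prod_rV_homeomorphic k :
  homeomorphic [set: (R * 'rV[R]_k)%type] [set: 'rV[R]_k.+1].
Proof.
apply: (@homeomorphicI _ _ _ _ (fun y : R * 'rV[R]_k => rv_cons y.1 y.2)
  (fun u => (u 0 ord0, rv_tail u))) => //.
- move=> y _.
  by apply: (@cont_rv_cons _ _ _ (fun y : R * 'rV[R]_k => y.1) (fun y => y.2)); cont.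
- move=> u _; cont1; first exact: coord_continuous.
  by apply: (@cont_rv_tail _ _ _ (fun v : 'rV[R]_k.+1 => v)); cont.
- by move=> [x z] _ /=; rewrite rv_cons0 rv_tail_cons.
- by move=> u _ /=; rewrite rv_cons_tail.
Qed.

Lemma drum_usphere d X (D : set (R * 'rV[R]_d)) : is_drum X D ->
  homeomorphic D (@usphere R d.+1).
Proof.
move=> [b1 [b2 [h [[cb1 cb2] h0 b12 ->]]]].
have w0 s : 0 < b2 s - b1 s by have := b12 s; rewrite subr_gt0 => -[_ []].
have h1 : h != 0 by rewrite gt_eqF.
have hi : 0 < h^-1 by rewrite invr_gt0.
apply: (@homeomorphic_trans _ _ _ _ (star (fun _ : 'rV[R]_d.+1 => 1))); last first.
  by apply: star_usphere => // u _; cont.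
pose c (y : R * 'rV[R]_d) := (2 * y.1 - b1 `|y.2| - b2 `|y.2|) / (b2 `|y.2| - b1 `|y.2|).
pose x (w : 'rV[R]_d.+1) := ((b2 `|h *: rv_tail w| - b1 `|h *: rv_tail w|) * w 0 ord0 +
  b1 `|h *: rv_tail w| + b2 `|h *: rv_tail w|) / 2.
have c_le1 (y : R * 'rV[R]_d) : `|c y| <= 1 <-> b1 `|y.2| <= y.1 <= b2 `|y.2|.
  rewrite /c ler_norml ler_pdivlMr// ler_pdivrMr//.
  by split => /andP[? ?]; apply/andP; split; lra.
have c_eq1 (y : R * 'rV[R]_d) : `|c y| = 1 <-> y.1 = b1 `|y.2| \/ y.1 = b2 `|y.2|.
  have k0 := w0 `|y.2|; have cE : c y * (b2 `|y.2| - b1 `|y.2|) =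
    2 * y.1 - b1 `|y.2| - b2 `|y.2| by rewrite /c mulfVK// gt_eqF.
  split.
    by case: (ger0P (c y)) => _ ce; [right|left]; move: cE; [rewrite ce|
      rewrite -[c y]opprK ce]; lra.
  move=> [e|e].
    by rewrite (_ : c y = - 1) ?normrN1// /c e; field; rewrite gt_eqF.
  by rewrite (_ : c y = 1) ?normr1// /c e; field; rewrite gt_eqF.
have DE (y : R * 'rV[R]_d) : drum b1 b2 h y <-> Num.max `|c y| (`|y.2| / h) = 1.
  rewrite /drum/=; split.
    move=> [[/c_eq1 -> zh]|[zh H]].
      by rewrite max_l// ler_pdivrMr// mul1r.
    by rewrite zh divff// max_r//; apply/c_le1; rewrite zh.
  case: (leP `|c y| (`|y.2| / h)) => cz e.
    have zh : `|y.2| = h by rewrite -[LHS](@mulfVK _ h)// e mul1r.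
    by right; split => //; rewrite -zh; apply/c_le1; rewrite -e.
  by left; split; [exact/c_eq1|rewrite ltW// -[h]mul1r -ltr_pdivrMr// -e].
have xc y : x (rv_cons (c y) (h^-1 *: y.2)) = y.1.
  rewrite /x rv_tail_cons rv_cons0 scalerA divff// scale1r /c.
  by field; rewrite gt_eqF.
have cx w : c (x w, h *: rv_tail w) = w 0 ord0.
  by rewrite /c /x/=; field; rewrite gt_eqF.
apply: (@homeomorphicI _ _ _ _ (fun y => rv_cons (c y) (h^-1 *: y.2))
  (fun w => (x w, h *: rv_tail w))).
- move=> y _.
  have cn : {for y, continuous (fun y : R * 'rV[R]_d => `|y.2|)} by cont.
  have c1 := cont_comp cb1 cn; have c2 := cont_comp cb2 cn.
  apply: (@cont_rv_cons _ _ _ c (fun y : R * 'rV[R]_d => h^-1 *: y.2)); last by cont.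
  rewrite /c; cont; first [exact: c1|exact: c2|by rewrite gt_eqF].
- move=> w _.
  have ct : {for w, continuous (fun w : 'rV[R]_d.+1 => rv_tail w)}.
    by apply: (@cont_rv_tail _ _ _ (fun v : 'rV[R]_d.+1 => v)); cont.
  have cn : {for w, continuous (fun w : 'rV[R]_d.+1 => `|h *: rv_tail w|)}.
    by cont; exact: ct.
  have c1 := cont_comp cb1 cn; have c2 := cont_comp cb2 cn.
  have c0 : {for w, continuous (fun w : 'rV[R]_d.+1 => w 0 ord0)}.
    exact: coord_continuous.
  cont1; last by cont; exact: ct.
  rewrite /x; cont; first [exact: c1|exact: c2|exact: c0|by rewrite gt_eqF].
- move=> y /DE e; rewrite /star/= norm_rv_cons -[RHS]e; congr (Num.max _ _).
  by rewrite normrZ (gtr0_norm hi) mulrC.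
- move=> w; rewrite /star/= => w1; apply/DE; rewrite cx/= normrZ (gtr0_norm h0).
  rewrite [h * _]mulrC mulfK//.
  by rewrite -norm_rv_cons rv_cons_tail.
- by move=> y _; rewrite xc rv_tail_cons scalerA divff// scale1r; case: y.
- by move=> w _ /=; rewrite cx scalerA mulVf// scale1r rv_cons_tail.
Qed.

Lemma finite_union_funion m N (A : set 'rV[R]_N) :
  funion (@is_msurface R m N) A -> finite_union_msurfaces m A.
Proof.
elim=> [|B1 B2 B1m _ [p [F [Fm ->]]]].
  exists 0%N, (fun _ => set0); split; first by case.
  by apply/seteqP; split => // u [[]].
exists p.+1, (fun i => if unlift ord0 i is Some j then F j else B1); split.
  by move=> i; case: unliftP.
apply/seteqP; split => u.
  move=> [B1u|[i _ Fu]]; first by exists ord0 => //; rewrite unlift_none.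
  by exists (lift ord0 i) => //; rewrite liftK.
move=> [i _]; case: unliftP => [j _ Fu|_ B1u]; [right|by left].
by exists j.
Qed.

End EmbeddedSurfaces.

Section ShellIntersections.
Context {R : realType} {d : nat}.
Local Notation Y := (R * 'rV[R]_d)%type.
Local Notation E := 'rV[R]_d.+2.
Variables (n : nat) (X : R) (f : nat -> Y -> R) (eps : nat -> R -> R).
Hypothesis bs : base_system n X f eps.

Let M : R := n.+1%:R.
Let C : R := n.+2%:R.
Let L : R := 2 * X + 1.
Let eta : R := (L * (X + 1))^-1.
Let X1 : 1 <= X. Proof. exact: bs_X bs. Qed.
Let L1 : 1 <= L. Proof. by have := X1; rewrite /L; lra. Qed.
Let L0 : 0 < L. Proof. exact: lt_le_trans L1. Qed.
Let X10 : 0 < X + 1. Proof. by have := X1; lra. Qed.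
Local Notation shell_height := (shell_height n X f).
Local Notation shell_radius := (shell_radius n X f).
Local Notation shell := (shell n X f).

Let cone (y : Y) : E := rv_cons y.1 (rv_cons 1 y.2).
Let chart i (y : Y) : E := (shell_radius i (cone y) / `|cone y|) *: cone y.
Let gnomon (u : E) : Y :=
  (equator u / rv_tail u 0 ord0, (rv_tail u 0 ord0)^-1 *: rv_tail (rv_tail u)).

Let equator_cone y : equator (cone y) = y.1. Proof. exact: rv_cons0. Qed.
Let tail_cone y : rv_tail (cone y) = rv_cons 1 y.2. Proof. exact: rv_tail_cons. Qed.

Let norm_cone (y : Y) : 0 < `|cone y|.
Proof. by rewrite norm_rv_cons lt_max norm_rv_cons lt_max normr1 ltr01 orbT. Qed.

Let shell_radius_gt0 i (u : E) : (i <= n)%N -> 0 < shell_radius i u.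
Proof. by move=> ni; apply: lt_le_trans (shell_radius_ge1 bs u ni). Qed.

Let gnomonZ (l : R) (u : E) : 0 < l -> gnomon (l *: u) = gnomon u.
Proof.
move=> l0; have ln : l != 0 by rewrite gt_eqF.
rewrite /gnomon /equator rv_tailZ rv_tailZ !mxE; congr (_, _).
  by rewrite invfM mulrACA divff// mul1r.
by rewrite scalerA invfM mulrAC mulVf// mul1r.
Qed.

Let gnomon_cone y : gnomon (cone y) = y.
Proof.
rewrite /gnomon equator_cone tail_cone rv_cons0 rv_tail_cons divr1 invr1 scale1r.
by case: y.
Qed.

Let gnomon_chart i y : (i <= n)%N -> gnomon (chart i y) = y.
Proof. by move=> ni; rewrite gnomonZ ?gnomon_cone// divr_gt0// shell_radius_gt0. Qed.

Let cone_gnomon u : 0 < rv_tail u 0 ord0 -> u = rv_tail u 0 ord0 *: cone (gnomon u).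
Proof.
move=> u0; have un : rv_tail u 0 ord0 != 0 by rewrite gt_eqF.
rewrite /cone /gnomon/= !rv_consZ mulr1 scalerA divff// scale1r.
by rewrite mulrC mulfVK// rv_cons_tail rv_cons_tail.
Qed.

Let chart_cont i y : (i <= n)%N -> {for y, continuous (chart i)}.
Proof.
move=> ni; have cc : {for y, continuous cone}.
  apply: (@cont_rv_cons _ _ _ (fun y : Y => y.1) (fun y : Y => rv_cons 1 y.2)).
    by cont.
  by apply: (@cont_rv_cons _ _ _ (fun y : Y => 1) (fun y : Y => y.2)); cont.
have cr : {for y, continuous (fun y => shell_radius i (cone y))}.
  apply: (@cont_comp_at _ _ _ (shell_radius i) cone) => //.
  by apply: (shell_radius_cont bs ni); rewrite -normr_gt0.
by rewrite /chart; cont; first [exact: cc|exact: cr|rewrite gt_eqF].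
Qed.

Let gnomon_cont u : rv_tail u 0 ord0 != 0 -> {for u, continuous gnomon}.
Proof.
move=> u0.
have ctl : {for u, continuous (fun v : E => rv_tail v)}.
  by apply: (@cont_rv_tail _ _ _ (fun v : E => v)); cont.
have ct0 : {for u, continuous (fun v : E => rv_tail v 0 ord0)}.
  exact: (@cont_coord _ _ _ _ (fun v : E => rv_tail v)).
have ctt : {for u, continuous (fun v : E => rv_tail (rv_tail v))}.
  exact: (@cont_rv_tail _ _ _ (fun v : E => rv_tail v)).
have ceq : {for u, continuous equator} by exact: coord_continuous.
by rewrite /gnomon; cont; first [exact: ctt|exact: ct0|exact: ceq|exact: u0].
Qed.

Let gnomon_cont_chart i y : (i <= n)%N -> {for chart i y, continuous gnomon}.
Proof.
move=> ni; apply: gnomon_cont.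
rewrite /chart rv_tailZ mxE tail_cone rv_cons0 mulr1 gt_eqF// divr_gt0//.
exact: shell_radius_gt0.
Qed.

Let shell_chart i (P : E -> Prop) : (i <= n)%N ->
  (forall (l : R) (u : E), 0 < l -> P (l *: u) <-> P u) ->
  (forall u, P u -> 0 < rv_tail u 0 ord0) ->
  shell i `&` P = chart i @` [set y | P (cone y)].
Proof.
move=> ni PZ Ppos; apply/seteqP; split => u.
  move=> [ui Pu]; have u0 := Ppos u Pu; have uE := cone_gnomon u0.
  exists (gnomon u); first by move: Pu; rewrite uE => /(PZ _ _ u0) /=; rewrite -uE.
  have nE : `|u| = rv_tail u 0 ord0 * `|cone (gnomon u)|.
    by rewrite {1}uE normrZ gtr0_norm.
  have rE : shell_radius i u = shell_radius i (cone (gnomon u)).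
    by rewrite {1}uE shell_radiusZ.
  rewrite /chart -rE -ui nE mulfK; last by rewrite gt_eqF.
  by rewrite -uE.
move=> [y Py <-]; have l0 : 0 < shell_radius i (cone y) / `|cone y|.
  by rewrite divr_gt0// shell_radius_gt0.
split; last by apply/PZ.
rewrite /shell /star/= /chart shell_radiusZ// normrZ gtr0_norm// mulfVK//.
by rewrite gt_eqF.
Qed.

Let psi (x : R) := X + 1 - (Num.max `|x| L^-1)^-1.
Let beta (b : R) := (X + 1 - b)^-1.

Let dir_proj_cone (x : R) (z : 'rV[R]_d) : `|x| < 1 -> dir_proj X x (rv_cons 1 z) = (psi x, z).
Proof.
move=> x1; rewrite /dir_proj rv_cons0 rv_tail_cons /psi.
by rewrite (max_l (ltW x1)) invr1 scale1r !mul1r.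
Qed.

Let far_cone (x : R) (z : 'rV[R]_d) : 1 <= `|x| -> far X (dir_proj X x (rv_cons 1 z)).
Proof. by move=> x1; apply: dir_proj_far1; rewrite rv_cons0. Qed.

Let far_psi (x : R) (z : 'rV[R]_d) : 1 <= `|x| -> far X (psi x, z).
Proof.
move=> x1; left; rewrite /psi/=.
suff : (Num.max `|x| L^-1)^-1 <= 1 by lra.
by rewrite invf_le1 ?lt_max ?le_max ?x1// (lt_le_trans ltr01).
Qed.

Let psi_pos (x : R) : 0 < Num.max `|x| L^-1.
Proof. by rewrite lt_max invr_gt0 L0 orbT. Qed.

Let beta_gt (b : R) : - X < b -> b < X -> L^-1 < beta b.
Proof. by move=> b1 b2; rewrite /beta ltf_pV2 ?posrE// /L; lra. Qed.

Let psi_le (x b : R) : - X < b -> b < X -> (psi x <= b) = (`|x| <= beta b).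
Proof.
move=> b1 b2; have Xb : 0 < X + 1 - b by lra.
have -> : (psi x <= b) = (X + 1 - b <= (Num.max `|x| L^-1)^-1).
  by rewrite /psi; apply/idP/idP; lra.
rewrite -[X in X <= _]invrK lef_pV2 ?posrE ?invr_gt0 ?psi_pos// ge_max.
by rewrite (ltW (beta_gt b1 b2)) andbT.
Qed.

Let psi_ge (x b : R) : - X < b -> b < X -> (b <= psi x) = (beta b <= `|x|).
Proof.
move=> b1 b2; have Xb : 0 < X + 1 - b by lra.
have -> : (b <= psi x) = ((Num.max `|x| L^-1)^-1 <= X + 1 - b).
  by rewrite /psi; apply/idP/idP; lra.
rewrite -[X in _ <= X]invrK lef_pV2 ?posrE ?invr_gt0 ?psi_pos// le_max.
by rewrite (leNgt _ L^-1) (beta_gt b1 b2) orbF.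
Qed.

Let psi_eq (x b : R) : - X < b -> b < X -> psi x = b <-> `|x| = beta b.
Proof.
move=> b1 b2; split => /eqP; rewrite eq_le => /andP[h1 h2]; apply/eqP.
  by rewrite eq_le -psi_le// -psi_ge// h1.
by rewrite eq_le psi_le// psi_ge// h1.
Qed.

Let beta_bounds (b : R) : - X < b -> b < X -> 0 < beta b /\ beta b < 1.
Proof.
move=> b1 b2; have Xb : 1 < X + 1 - b by lra.
by rewrite /beta invr_gt0 invf_lt1 ?(lt_trans ltr01 Xb).
Qed.

Let beta_lt (b b' : R) : - X < b -> b < b' -> b' < X -> beta b < beta b'.
Proof. by move=> *; rewrite /beta ltf_pV2 ?posrE//; lra. Qed.

Let beta_cont (b : R -> R) : continuous b -> (forall s, b s < X) ->
  continuous (fun s => beta (b s)).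
Proof.
move=> cb bX; apply: forall_cont => s; rewrite /beta; cont; first exact: cb.
by rewrite gt_eqF//; have := bX s; lra.
Qed.

Let Psi (y : Y) : Y := (psi y.1, y.2).

Let Psi_drum D : is_drum X D -> funion (is_drum 1) (Psi @^-1` D).
Proof.
move=> [b1 [b2 [h [[cb1 cb2] h0 b12 ->]]]].
have B1 s : - X < b1 s /\ b1 s < X by have := b12 s; lra.
have B2 s : - X < b2 s /\ b2 s < X by have := b12 s; lra.
have c1 : continuous (fun s => beta (b1 s)) by apply: beta_cont => // s; case: (B1 s).
have c2 : continuous (fun s => beta (b2 s)) by apply: beta_cont => // s; case: (B2 s).
have b1b s : 0 < beta (b1 s) /\ beta (b1 s) < 1 by apply: beta_bounds; case: (B1 s).
have b2b s : 0 < beta (b2 s) /\ beta (b2 s) < 1 by apply: beta_bounds; case: (B2 s).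
have blt s : beta (b1 s) < beta (b2 s) by apply: beta_lt; have := b12 s; lra.
rewrite (_ : _ @^-1` _ = drum (fun s => beta (b1 s)) (fun s => beta (b2 s)) h `|`
   drum (fun s => - beta (b2 s)) (fun s => - beta (b1 s)) h).
  apply: funion_setU; apply: funion1.
    exists (fun s => beta (b1 s)), (fun s => beta (b2 s)), h; split => //.
    by move=> s; have := b1b s; have := b2b s; have := blt s; lra.
  exists (fun s => - beta (b2 s)), (fun s => - beta (b1 s)), h; split => //.
    by split; apply: forall_cont => s; apply: contN; [exact: c2|exact: c1].
  by move=> s; have := b1b s; have := b2b s; have := blt s; lra.
apply/seteqP; split => -[x z]; rewrite /Psi /drum/=;
  have [B11 B12] := B1 `|z|; have [B21 B22] := B2 `|z|;
  have [H11 H12] := B1 h; have [H21 H22] := B2 h;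
  rewrite !psi_eq// psi_le// psi_ge//; have := b1b `|z|; have := b2b `|z|;
  have := b1b h; have := b2b h; case: (ger0P x) => x0 P1 P2 P3 P4.
- by move=> [[H zh]|[zh H]]; left; [left|right].
- move=> [[H zh]|[zh /andP[H1 H2]]]; right; [left|right]; split => //.
    by case: H => H; [right|left]; lra.
  by apply/andP; split; lra.
- move=> [|[[H zh]|[zh /andP[H1 H2]]]] //; first by case: H => H; lra.
  by lra.
- move=> [[[H zh]|[zh /andP[H1 H2]]]|[[H zh]|[zh /andP[H1 H2]]]].
  + by case: H => H; lra.
  + by lra.
  + by left; split => //; case: H => H; [right|left]; lra.
  + by right; split => //; apply/andP; split; lra.
Qed.

Let Psi_tube D : is_tube X D -> is_drum 1 (Psi @^-1` D).
Proof.
move=> [b [h [cb h0 bX ->]]].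
have c1 : continuous (fun s => beta (b s)) by apply: beta_cont => // s; case: (bX s).
have bb s : 0 < beta (b s) /\ beta (b s) < 1 by apply: beta_bounds; case: (bX s).
exists (fun s => - beta (b s)), (fun s => beta (b s)), h; split => //.
- by split => //; apply: forall_cont => s; apply: contN; exact: c1.
- by move=> s; have := bb s; lra.
apply/seteqP; split => -[x z]; rewrite /Psi /drum /tube/=;
  have [B11 B12] := bX `|z|; have [H11 H12] := bX h;
  rewrite !psi_eq// psi_le//; have := bb `|z|; have := bb h;
  case: (ger0P x) => x0 P1 P2.
- by move=> [[H zh]|[zh H]]; [left; split => //; right|right; split => //]; lra.
- by move=> [[H zh]|[zh H]]; [left; split => //; left|right; split => //]; lra.
- by move=> [[[H|H] zh]|[zh /andP[H1 H2]]]; [lra|left|right].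
- by move=> [[[H|H] zh]|[zh /andP[H1 H2]]]; [left; split => //|lra|right; split => //]; lra.
Qed.

Let Psi_ring D : is_ring X D -> funion (is_ring 1) (Psi @^-1` D).
Proof.
move=> [x0 [h [x1 x2 h0 ->]]]; have [b0 b1] := beta_bounds x1 x2.
rewrite (_ : _ @^-1` _ = ring (beta x0) h `|` ring (- beta x0) h).
  apply: funion_setU; apply: funion1.
    by exists (beta x0), h; split => //; lra.
  by exists (- beta x0), h; split => //; lra.
apply/seteqP; split => -[x z]; rewrite /Psi /ring/= psi_eq//; case: (ger0P x) => xp.
- by move=> [H zh]; left.
- by move=> [H zh]; right; split => //; lra.
- by move=> [[H zh]|[H zh]] //; lra.
- by move=> [[H zh]|[H zh]]; [lra|split => //; lra].
Qed.

Let cone_psi i j (x : R) (z : 'rV[R]_d) : (i < n)%N -> (j < n)%N -> i <> j ->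
  (shell_height i (cone (x, z)) = shell_height j (cone (x, z)) <->
   f i (psi x, z) = f j (psi x, z)) /\
  (f i (psi x, z) = f j (psi x, z) -> forall k, (k < n)%N ->
    shell_height k (cone (x, z)) = f k (psi x, z)).
Proof.
move=> iN jN ij.
have hE k : (k < n)%N -> shell_height k (cone (x, z)) = f k (dir_proj X x (rv_cons 1 z)).
  by move=> kN; rewrite /shell_height kN equator_cone tail_cone.
have ne : i.+1%:R <> j.+1%:R :> R by move=> /eqP; rewrite eqr_nat eqSS => /eqP.
have [x1|x1] := leP 1 `|x|; last by rewrite !hE// dir_proj_cone//; split => // _ k /hE ->;
  rewrite dir_proj_cone.
rewrite !hE// !(far_eq bs) //; try exact: far_cone; try exact: far_psi.
Qed.

Let shell_height_pos i j u : (i < n)%N -> (j < n)%N -> i <> j ->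
  shell_height i u = shell_height j u -> 0 < rv_tail u 0 ord0.
Proof.
move=> iN jN ij; rewrite /shell_height iN jN => H; rewrite ltNge; apply/negP => u0.
have fu : far X (dir_proj X (equator u) (rv_tail u)).
  by apply: dir_proj_far1; apply: le_trans u0 _.
by move: H; rewrite !(far_eq bs)// => /eqP; rewrite eqr_nat eqSS => /eqP.
Qed.

Let shell_pairE i j : shell i `&` shell j = shell i `&` [set u | shell_height i u = shell_height j u].
Proof.
apply/seteqP; split => u [ui uj]; split => //; move: ui uj;
  rewrite /shell /star/= /shell_radius => e1 e2; move: e1; rewrite e2 //.
by move=> /addrI.
Qed.

Lemma shell_pair_old i j : (j < i)%N -> (i < n)%N ->
  funion (@is_msurface R d.+1 d.+2) (shell i `&` shell j).
Proof.
move=> ji iN; have jN := ltn_trans ji iN; have iN' := ltnW iN.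
have ij : i <> j by move=> e; rewrite e ltnn in ji.
rewrite shell_pairE shell_chart//; last first.
- by move=> u; exact: shell_height_pos.
- by move=> l u l0; rewrite /= !shell_heightZ.
rewrite (_ : [set y | _] = Psi @^-1` [set y | f i y = f j y]); last first.
  by apply/seteqP; split => -[x z] /= H; [exact/(cone_psi x z iN jN ij).1|
    exact/(cone_psi x z iN jN ij).1].
apply: (funion_map (C := is_drum 1) (g := fun D => chart i @` D)).
- exact: image_set0.
- by move=> B1 B2; exact: image_setU.
- move=> D dD; apply: funion1; apply: (@msurface_embed _ _ _ _ _ gnomon).
  + by move=> y; exact: chart_cont.
  + by move=> y; exact: gnomon_cont_chart.
  + by move=> y; exact: gnomon_chart.
  + exact: prod_rV_homeomorphic.
  + exact: drum_usphere dD.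
have [iN1|iN1] := ltnP i.+1 n.
  apply: (funion_map (C := is_drum X) (g := fun D => Psi @^-1` D)).
  - exact: preimage_set0.
  - by move=> B1 B2; exact: preimage_setU.
  - by move=> D; exact: Psi_drum.
  - exact: (bs_pair_old bs).
apply: funion1; apply: Psi_tube; apply: (bs_pair_new bs) => //.
by apply/eqP; rewrite eqn_leq iN1 iN.
Qed.

Lemma shell_triple_old i j k : (k < j)%N -> (j < i)%N -> (i < n)%N ->
  funion (@is_msurface R d d.+2) (shell i `&` shell j `&` shell k).
Proof.
move=> kj ji iN; have jN := ltn_trans ji iN; have kN := ltn_trans kj jN.
have iN' := ltnW iN.
have ij : i <> j by move=> e; rewrite e ltnn in ji.
rewrite (_ : _ `&` _ = shell i `&` [set u |
    shell_height i u = shell_height j u /\ shell_height j u = shell_height k u]);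
  last first.
  apply/seteqP; split => u /=; rewrite /shell /star/= /shell_radius.
    by move=> [[e1 e2] e3]; split=> //; split; apply: (@addrI _ C); rewrite -?e1 -?e2 -?e3.
  by move=> [e1 [e2 e3]]; rewrite -e3 -e2.
rewrite shell_chart//; last first.
- by move=> u [+ _]; exact: shell_height_pos.
- by move=> l u l0; rewrite /= !shell_heightZ.
rewrite (_ : [set y | _] = Psi @^-1` [set y | f i y = f j y /\ f j y = f k y]); last first.
  apply/seteqP; split => -[x z] /= [H1 H2]; have [c1 c2] := cone_psi x z iN jN ij.
    have H1' := c1.1 H1; split => //.
    by move: H2; rewrite !(c2 H1').
  by split; [exact/c1|rewrite !(c2 H1)].
apply: (funion_map (C := is_ring 1) (g := fun D => chart i @` D)).
- exact: image_set0.
- by move=> B1 B2; exact: image_setU.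
- move=> _ [x0 [h [_ _ h0 ->]]]; apply: funion1.
  rewrite (_ : chart i @` ring x0 h = (fun z => chart i (x0, z)) @` [set z | `|z| = h]).
    apply: (@msurface_sphere _ _ _ _ (fun u => (gnomon u).2) _ h0).
    + move=> z; apply: (@cont_comp_at _ _ _ (chart i) (fun z : 'rV[R]_d => (x0, z))).
        by cont.
      exact: chart_cont.
    + by move=> z; apply: cont_snd; exact: gnomon_cont_chart.
    + by move=> z; rewrite gnomon_chart.
  apply/seteqP; split => u [].
    by move=> [x z] [/= -> zh] <-; exists z.
  by move=> z /= zh <-; exists (x0, z).
apply: (funion_map (C := is_ring X) (g := fun D => Psi @^-1` D)).
- exact: preimage_set0.
- by move=> B1 B2; exact: preimage_setU.
- by move=> D; exact: Psi_ring.
- exact: (bs_triple bs).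
Qed.

Lemma shell_quad_old i j k l : (l < k)%N -> (k < j)%N -> (j < i)%N -> (i < n)%N ->
  shell i `&` shell j `&` shell k `&` shell l = set0.
Proof.
move=> lk kj ji iN; have jN := ltn_trans ji iN; have kN := ltn_trans kj jN.
have lN := ltn_trans lk kN.
apply/seteqP; split => // u [[[]]]; rewrite /shell /star/= /shell_radius => e1 e2 e3 e4.
have h12 : shell_height i u = shell_height j u by apply: (@addrI _ C); rewrite -e1 -e2.
have h23 : shell_height j u = shell_height k u by apply: (@addrI _ C); rewrite -e2 -e3.
have h34 : shell_height k u = shell_height l u by apply: (@addrI _ C); rewrite -e3 -e4.
move: h12 h23 h34; rewrite /shell_height iN jN kN lN => h12 h23 h34.
exact: (bs_quad bs lk kj ji iN (And3 h12 h23 h34)).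
Qed.

End ShellIntersections.

Section EquatorialShell.
Context {R : realType} {d : nat}.
Local Notation Y := (R * 'rV[R]_d)%type.
Local Notation E := 'rV[R]_d.+2.
Variables (n : nat) (X : R) (f : nat -> Y -> R) (eps : nat -> R -> R).
Hypothesis bs : base_system n X f eps.

Let M : R := n.+1%:R.
Let C : R := n.+2%:R.
Let L : R := 2 * X + 1.
Let eta : R := (L * (X + 1))^-1.
Let X1 : 1 <= X. Proof. exact: bs_X bs. Qed.
Let M0 : 0 < M. Proof. by rewrite /M ltr0n. Qed.
Let L1 : 1 <= L. Proof. by have := X1; rewrite /L; lra. Qed.
Let L0 : 0 < L. Proof. exact: lt_le_trans L1. Qed.
Let X10 : 0 < X + 1. Proof. by have := X1; lra. Qed.
Let eta0 : 0 < eta. Proof. by rewrite invr_gt0 mulr_gt0. Qed.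
Let eta1 : eta < 1.
Proof.
rewrite /eta invf_lt1 ?mulr_gt0//.
have := X1; have := L1 => l1 x1; rewrite (@lt_le_trans _ _ (X + 1))//; first lra.
by rewrite ler_peMl// ltW.
Qed.

Local Notation height := (shell_height n X f).
Local Notation radius := (shell_radius n X f).
Local Notation shell := (shell n X f).

Let base (w : 'rV[R]_d.+1) : E := rv_cons 0 w.
Let lean j (w : 'rV[R]_d.+1) : R := eta * height j (base w) / M.
Let chart j (w : 'rV[R]_d.+1) : E := rv_cons (`|w| * lean j w) w.

Let height_base j w : (j < n)%N -> height j (base w) = f j (dir_proj X 0 w).
Proof. by move=> jN; rewrite /shell_height jN /base /equator rv_cons0 rv_tail_cons. Qed.

Let height_lt j u : (j < n)%N -> `|height j u| < M.
Proof.
move=> jN; apply: le_lt_trans (shell_height_bound bs u (ltnW jN)) _.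
by rewrite ltr_nat ltnS.
Qed.

Let lean_lt v : `|v| < M -> `|eta * v / M| < eta.
Proof.
move=> vM; rewrite normrM normfV (gtr0_norm M0) normrM (gtr0_norm eta0) -mulrA.
by rewrite gtr_pMr// ltr_pdivrMr// mul1r.
Qed.

Let norm_max (u : E) : `|u| = Num.max `|equator u| `|rv_tail u|.
Proof. by rewrite -[in LHS](rv_cons_tail u) norm_rv_cons. Qed.

Let height_n u : height n u = clip M (M * equator u / (eta * `|u|)).
Proof. by rewrite /shell_height ltnn. Qed.

Let norm_chart j w : (j < n)%N -> `|chart j w| = `|w|.
Proof.
move=> jN; rewrite /chart norm_rv_cons max_r// normrM normr_id.
rewrite ler_piMr// ltW// (lt_trans (lean_lt _) eta1)//; exact: height_lt.
Qed.

Let chart_flat i j w : (i < n)%N -> (j < n)%N -> 0 < `|w| ->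
  height i (chart j w) = height i (base w).
Proof.
move=> iN jN w0; rewrite height_base// (@shell_height_flat _ _ _ _ _ _ bs _ _ 0)//.
- by rewrite /chart rv_tail_cons.
- rewrite /chart /equator rv_cons0 rv_tail_cons normrM normr_id mulrC ltr_pM2r//.
  by apply: lean_lt; exact: height_lt.
- by rewrite normr0 mulr_gt0// /chart rv_tail_cons.
Qed.

Let shell_norm_gt0 j u : (j <= n)%N -> shell j u -> 0 < `|u|.
Proof. by move=> jN ->; apply: lt_le_trans (shell_radius_ge1 bs u jN). Qed.

Let pairP j u : (j < n)%N -> shell n u -> shell j u ->
  u = chart j (rv_tail u) /\ `|rv_tail u| = radius j (base (rv_tail u)).
Proof.
move=> jN un uj; have r0 := shell_norm_gt0 (leqnn n) un.
have hnj : height n u = height j u by apply: (@addrI _ C); rewrite -[LHS]un -[RHS]uj.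
have vM := height_lt u jN; move: hnj; rewrite height_n => /(clip_eq _ vM) hE.
have eqE : equator u = `|u| * (eta * height j u / M).
  by rewrite -hE; field; rewrite !gt_eqF.
have eq_lt : `|equator u| < eta * `|u|.
  by rewrite eqE normrM normr_id mulrC ltr_pM2r// lean_lt.
have tu : `|u| = `|rv_tail u|.
  have := norm_max u; case: (leP `|equator u| `|rv_tail u|) => // _ e.
  by move: eq_lt; rewrite -e -[ltLHS]mul1r ltr_pM2r// ltNge (ltW eta1).
have flat : height j u = height j (base (rv_tail u)).
  rewrite height_base//; apply: (shell_height_flat bs) => //; rewrite -?tu//.
  by rewrite normr0 mulr_gt0.
split; first by rewrite /chart /lean -flat -tu -eqE rv_cons_tail.
by rewrite -tu [LHS]uj /shell_radius flat.
Qed.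

Let pairPV j w : (j < n)%N -> `|w| = radius j (base w) ->
  shell n (chart j w) /\ shell j (chart j w).
Proof.
move=> jN wr; have w0 : 0 < `|w|.
  by rewrite wr; apply: lt_le_trans (shell_radius_ge1 bs _ (ltnW jN)).
have flat := chart_flat jN jN w0; have nc := norm_chart w jN.
split; rewrite /shell /star/= nc wr /shell_radius; congr (_ + _); last by rewrite flat.
rewrite height_n nc /chart /equator rv_cons0 /lean.
apply/esym/(clip_eq _ (height_lt _ jN)); field.
by rewrite !gt_eqF.
Qed.

Let shell_pairE j : (j < n)%N ->
  shell n `&` shell j = chart j @` star (fun w => radius j (base w)).
Proof.
move=> jN; apply/seteqP; split => u.
  by move=> [un uj]; have [uE wr] := pairP jN un uj; exists (rv_tail u).
by move=> [w wr <-]; exact: pairPV.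
Qed.

Let base_cont w : {for w, continuous base}.
Proof.
by apply: (@cont_rv_cons _ _ _ (fun _ : 'rV[R]_d.+1 => 0) (fun w => w)); cont.
Qed.

Let base_neq0 w : w != 0 -> base w != 0.
Proof.
apply: contra => /eqP b0; apply/eqP.
by rewrite -[w](rv_tail_cons 0) -/(base w) b0; apply/rowP => i; rewrite !mxE.
Qed.

Let base_height_cont j w : (j < n)%N -> w != 0 ->
  {for w, continuous (fun w => height j (base w))}.
Proof.
move=> jN w0; apply: (@cont_comp_at _ _ _ (height j) base); first exact: base_cont.
by apply: (shell_height_cont bs (ltnW jN)); exact: base_neq0.
Qed.

Let chart_cont j w : (j < n)%N -> {for w, continuous (chart j)}.
Proof.
move=> jN; apply: (@cont_rv_cons _ _ _ (fun w => `|w| * lean j w) (fun w => w));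
  last by cont.
have [->|w0] := eqVneq w 0; last first.
  by rewrite /lean; cont; first [exact: base_height_cont|rewrite gt_eqF].
suff H : forall v : 'rV[R]_d.+1, `| `|v| * lean j v| <= `|v|.
  have e0 : `|0 : 'rV[R]_d.+1| * lean j 0 = 0 by rewrite normr0 mul0r.
  rewrite /prop_for /continuous_at e0; 
  apply/(@cvgr0Pnorm_lt _ _ _ _ (nbhs_filter _)) => e e1.
  have : \forall v \near (0 : 'rV[R]_d.+1), `|v| < e.
    apply: (@cvgr_lt R _ (nbhs (0 : 'rV[R]_d.+1)) (nbhs_filter _)
      (fun v : 'rV[R]_d.+1 => `|v|) `|0 : 'rV[R]_d.+1|); last by rewrite normr0.
    by apply: (@cont_norm _ _ _ (fun v : 'rV[R]_d.+1 => v)); exact: cvg_id.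
  by apply: filterS => v; apply: le_lt_trans.
move=> v; rewrite normrM normr_id ler_piMr// ltW// (lt_trans (lean_lt _) eta1)//.
exact: height_lt.
Qed.

Lemma shell_pair_new j : (j < n)%N ->
  funion (@is_msurface R d.+1 d.+2) (shell n `&` shell j).
Proof.
move=> jN; rewrite shell_pairE//; apply: funion1.
apply: (@msurface_embed _ _ _ _ (chart j) (fun u => rv_tail u)).
- by move=> w; exact: chart_cont.
- by move=> w; apply: (@cont_rv_tail _ _ _ (fun v : E => v)); cont.
- by move=> w; rewrite rv_tail_cons.
- exact: homeomorphic_refl.
apply: star_usphere.
- by move=> w; apply: (shell_radius_ge1 bs); exact: ltnW.
- move=> l w l0; rewrite -(shell_radiusZ _ _ _ _ (base w) l0); congr radius.
  by rewrite /base rv_consZ mulr0.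
- move=> w w0; apply: (@contD _ _ (fun=> C) (fun w => height j (base w))).
    by cont.
  exact: base_height_cont.
Qed.

Let base_eq j k w : (k < j)%N -> (j < n)%N ->
  height j (base w) = height k (base w) ->
  [/\ 0 < w 0 ord0, eps j `|(w 0 ord0)^-1 *: rv_tail w| = height j (base w) &
      eps k `|(w 0 ord0)^-1 *: rv_tail w| = height j (base w)].
Proof.
move=> kj jN; have kN := ltn_trans kj jN; rewrite !height_base// => H.
have w0 : 0 < w 0 ord0.
  rewrite ltNge; apply/negP => w0.
  have fu : far X (dir_proj X 0 w) by apply: dir_proj_far1; rewrite normr0.
  by move: H; rewrite !(far_eq bs)// => /eqP; rewrite eqr_nat eqSS gtn_eqF.
have pE : dir_proj X 0 w = (- X, (w 0 ord0)^-1 *: rv_tail w).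
  by apply: (dir_proj_collar bs) => //; rewrite normr0 mulr0 ltW.
split => //; first by rewrite pE (bs_collar bs).
by rewrite H pE (bs_collar bs).
Qed.

Lemma shell_triple_new j k : (k < j)%N -> (j < n)%N ->
  funion (@is_msurface R d d.+2) (shell n `&` shell j `&` shell k).
Proof.
move=> kj jN; have kN := ltn_trans kj jN.
have k1N : (k.+1 < n)%N by exact: leq_ltn_trans jN.
have split3 u : (shell n `&` shell j `&` shell k) u ->
    [/\ u = chart j (rv_tail u), `|rv_tail u| = radius j (base (rv_tail u)) &
      height j (base (rv_tail u)) = height k (base (rv_tail u))].
  move=> [[un uj] uk]; have [uE wr] := pairP jN un uj; split => //.
  have [_ wr'] := pairP kN un uk.
  by apply: (@addrI _ C); rewrite -[LHS]wr -[RHS]wr'.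
have [j1N|j1N] := ltnP j.+1 n.
  rewrite (_ : _ `&` _ = set0); first exact: funion0.
  apply/seteqP; split => // u /split3[_ _ H].
  have [_ + e2] := base_eq kj jN H.
  by rewrite -e2 !(bs_eps_old bs)// => /eqP; rewrite eqr_nat eqSS gtn_eqF.
have jE : j.+1 = n by apply/eqP; rewrite eqn_leq j1N jN.
have [h [h0 hX hE]] := bs_eps_new bs jE kj.
pose c : R := C + k.+1%:R; pose m := Num.max 1 h.
have m0 : 0 < m by rewrite lt_max ltr01.
have c0 : 0 < c by rewrite /c addr_gt0// ltr0n.
pose lam := c / m; have lam0 : 0 < lam by rewrite divr_gt0.
pose mu := c * (eta * k.+1%:R / M).
pose ch (z : 'rV[R]_d) : E := rv_cons mu (rv_cons lam (lam *: z)).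
rewrite (_ : _ `&` _ = ch @` [set z | `|z| = h]).
  apply: funion1.
  apply: (@msurface_sphere _ _ _ _ (fun u => lam^-1 *: rv_tail (rv_tail u)) _ h0).
  - move=> z; apply: (@cont_rv_cons _ _ _ (fun _ : 'rV[R]_d => mu)
      (fun z => rv_cons lam (lam *: z))); first by cont.
    by apply: (@cont_rv_cons _ _ _ (fun _ : 'rV[R]_d => lam) (fun z => lam *: z)); cont.
  - move=> z; apply: (@contZ _ _ _ (fun _ : E => lam^-1) (fun u : E => rv_tail (rv_tail u))).
      by cont; rewrite gt_eqF.
    apply: (@cont_rv_tail _ _ _ (fun v : E => rv_tail v)).
    by apply: (@cont_rv_tail _ _ _ (fun v : E => v)); cont.
  - by move=> z; rewrite /ch !rv_tail_cons scalerA mulVf ?scale1r ?gt_eqF.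
apply/seteqP; split => u.
  move=> /split3; set w := rv_tail u => -[uE wr H].
  have [w0 e1 e2] := base_eq kj jN H.
  have hk : height j (base w) = k.+1%:R by rewrite -e2 (bs_eps_old bs).
  rewrite hk in e1; have zh := (hE _).1 e1.
  have wE : w = rv_cons (w 0 ord0) (w 0 ord0 *: ((w 0 ord0)^-1 *: rv_tail w)).
    by rewrite scalerA divff ?gt_eqF// scale1r rv_cons_tail.
  have nw : `|w| = w 0 ord0 * m.
    rewrite wE norm_rv_cons rv_cons0 [X in Num.max _ X]normrZ zh gtr0_norm//.
    by rewrite /m maxr_pMr ?ltW// mulr1.
  have wc : `|w| = c by rewrite wr /shell_radius hk.
  have wl : w 0 ord0 = lam by rewrite /lam -wc nw mulfK// gt_eqF.
  exists ((w 0 ord0)^-1 *: rv_tail w) => //.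
  by rewrite /ch -wl -wE uE /chart /lean hk wc.
move=> [z /= zh <-]; pose w := rv_cons lam (lam *: z).
have nw : `|w| = c.
  have nlz : `|lam *: z| = lam * h by rewrite normrZ zh gtr0_norm.
  rewrite /w norm_rv_cons nlz (gtr0_norm lam0) -[X in Num.max X _]mulr1.
  by rewrite -maxr_pMr ?(ltW lam0)// -/m /lam mulfVK// gt_eqF.
have pE : dir_proj X 0 w = (- X, z).
  have w0 : w 0 ord0 = lam by exact: rv_cons0.
  rewrite (dir_proj_collar bs); rewrite ?normr0 ?mulr0 w0 ?ltW//.
  by rewrite /w rv_tail_cons scalerA mulVf ?scale1r// gt_eqF.
have hj : height j (base w) = k.+1%:R.
  by rewrite height_base// pE (bs_collar bs)//; exact/hE.
have hk : height k (base w) = k.+1%:R.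
  by rewrite height_base// pE (bs_collar bs)// (bs_eps_old bs).
have chE : ch z = chart j w by rewrite /ch /chart /lean hj nw.
have wr : `|w| = radius j (base w) by rewrite /shell_radius hj.
have [un uj] := pairPV jN wr.
split; first by rewrite chE.
rewrite chE /shell /star/= norm_chart// /shell_radius chart_flat ?nw ?hk//.
Qed.

Lemma shell_quad_new j k l : (l < k)%N -> (k < j)%N -> (j < n)%N ->
  shell n `&` shell j `&` shell k `&` shell l = set0.
Proof.
move=> lk kj jN; have kN := ltn_trans kj jN; have lN := ltn_trans lk kN.
apply/seteqP; split => // u [[[un uj] uk] ul].
have [_ wj] := pairP jN un uj; have [_ wk] := pairP kN un uk.
have [_ wl] := pairP lN un ul.
have hjk : height j (base (rv_tail u)) = height k (base (rv_tail u)).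
  by apply: (@addrI _ C); rewrite -[LHS]wj -[RHS]wk.
have hkl : height k (base (rv_tail u)) = height l (base (rv_tail u)).
  by apply: (@addrI _ C); rewrite -[LHS]wk -[RHS]wl.
have [_ _ e1] := base_eq kj jN hjk; have [_ _ e2] := base_eq lk kN hkl.
move: e1; rewrite hjk -e2 !(bs_eps_old bs) ?(leq_ltn_trans kj)//; last first.
  by rewrite (leq_ltn_trans lk).
by move=> /eqP; rewrite eqr_nat eqSS gtn_eqF.
Qed.

End EquatorialShell.

Section Radial.
Context {R : realType} {k : nat}.
Local Notation E := 'rV[R]_k.+2.

Definition radial (G : E -> R) :=
  [/\ forall u, 1 <= G u, exists K, forall u, G u <= K,
      forall (l : R) u, 0 < l -> G (l *: u) = G u &
      forall u, u != 0 -> {for u, continuous G}].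

Lemma radial_max F G : radial F -> radial G -> radial (fun u => Num.max (F u) (G u)).
Proof.
move=> [F1 [K FK] FZ Fc] [G1 [K' GK] GZ Gc]; split.
- by move=> u; rewrite le_max F1.
- by exists (Num.max K K') => u; rewrite ge_max !le_max FK GK orbT.
- by move=> l u l0; rewrite FZ// GZ.
- by move=> u u0; apply: (@cont_max _ _ F G); [exact: Fc|exact: Gc].
Qed.

Lemma radial_min F G : radial F -> radial G -> radial (fun u => Num.min (F u) (G u)).
Proof.
move=> [F1 [K FK] FZ Fc] [G1 [K' GK] GZ Gc]; split.
- by move=> u; rewrite le_min F1 G1.
- by exists K => u; rewrite ge_min FK.
- by move=> l u l0; rewrite FZ// GZ.
- by move=> u u0; apply: (@cont_min _ _ F G); [exact: Fc|exact: Gc].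
Qed.

Lemma radial_big_min (g : nat -> E -> R) n : (forall i, (i <= n)%N -> radial (g i)) ->
  exists2 G, radial G & forall u t, t < G u <-> forall i, (i <= n)%N -> t < g i u.
Proof.
elim: n => [|n IH] gr.
  exists (g 0%N); first exact: gr.
  by move=> u t; split => [H [|]//|]; exact.
have [i ni|G Gr GE] := IH; first by apply: gr; exact: leqW.
exists (fun u => Num.min (G u) (g n.+1 u)); first by apply: radial_min => //; exact: gr.
move=> u t; rewrite lt_min; split.
  move=> /andP[/GE H1 H2] i; rewrite leq_eqVlt => /predU1P[->//|]; exact: H1.
by move=> H; rewrite H// andbT; apply/GE => i ni; apply: H; exact: leqW.
Qed.

Lemma radial_big_max (g : nat -> E -> R) n : (forall i, (i <= n)%N -> radial (g i)) ->
  exists2 G, radial G & forall u t, G u < t <-> forall i, (i <= n)%N -> g i u < t.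
Proof.
elim: n => [|n IH] gr.
  exists (g 0%N); first exact: gr.
  by move=> u t; split => [H [|]//|]; exact.
have [i ni|G Gr GE] := IH; first by apply: gr; exact: leqW.
exists (fun u => Num.max (G u) (g n.+1 u)); first by apply: radial_max => //; exact: gr.
move=> u t; rewrite gt_max; split.
  move=> /andP[/GE H1 H2] i; rewrite leq_eqVlt => /predU1P[->//|]; exact: H1.
by move=> H; rewrite H// andbT; apply/GE => i ni; apply: H; exact: leqW.
Qed.

Lemma radial_msurface G : radial G -> is_msurface k.+2 (star G).
Proof.
move=> [G1 [K GK] GZ Gc]; split; last exact: star_usphere.
exists setT => //; exists setT; [by left|exact: homeomorphic_refl].
Qed.

Lemma radial_side G b : radial G ->
  side setT id (star G) b =
  [set u | if b then G u < `|u| else `|u| < G u].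
Proof.
move=> [G1 [K GK] GZ Gc]; rewrite /side setTI image_id preimage_id.
by rewrite (star_side G1 GK GZ Gc); case: b.
Qed.

Lemma radial_side_regular G b : radial G ->
  side setT id (star G) b !=set0 /\ connected (side setT id (star G) b).
Proof.
move=> Gr; rewrite radial_side//; have [G1 GK GZ Gc] := Gr; case: b; split.
- exact: star_outer_nonempty.
- exact: star_outer_connected.
- by exists 0; rewrite /= normr0 (lt_le_trans ltr01).
- exact: star_inner_connected.
Qed.

End Radial.

Section Venn.
Context {R : realType} {d : nat}.
Local Notation Y := (R * 'rV[R]_d)%type.
Local Notation E := 'rV[R]_d.+2.
Variables (n : nat) (X : R) (f : nat -> Y -> R) (eps : nat -> R -> R).
Hypothesis bs : base_system n X f eps.

Let M : R := n.+1%:R.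
Let C : R := n.+2%:R.
Let eta : R := ((2 * X + 1) * (X + 1))^-1.
Let X1 : 1 <= X. Proof. exact: bs_X bs. Qed.
Let M0 : 0 < M. Proof. by rewrite /M ltr0n. Qed.
Let eta0 : 0 < eta.
Proof. by have x1 := X1; rewrite invr_gt0 mulr_gt0//; lra. Qed.

Local Notation height := (shell_height n X f).
Local Notation radius := (shell_radius n X f).
Let S (i : 'I_n.+1) : set E := shell n X f i.

Let radius_radial i : (i <= n)%N -> radial (radius i).
Proof.
move=> ni; split.
- by move=> u; exact: (shell_radius_ge1 bs).
- by exists (C + M) => u; exact: (shell_radius_le bs).
- by move=> l u; exact: shell_radiusZ.
- by move=> u; exact: (shell_radius_cont bs).
Qed.

Let regionE (e : 'I_n.+1 -> bool) : region setT id S e =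
  [set u | forall i, (i <= n)%N ->
    if e (inord i) then radius i u < `|u| else `|u| < radius i u].
Proof.
have sE i : side setT id (S i) (e i) =
    [set u | if e i then radius i u < `|u| else `|u| < radius i u].
  by apply: radial_side; apply: radius_radial; rewrite -ltnS.
apply/seteqP; split => u H.
  move=> i ni; have := H (inord i) I.
  by rewrite sE /= inordK.
move=> i _; rewrite sE /=; have := H i; rewrite inord_val; apply.
by rewrite -ltnS.
Qed.

Let good (A : set E) :=
  [/\ A !=set0, connected A & exists (T : set E) (b : bool),
     [/\ is_msurface d.+2 T, T `<=` setT & homeomorphic A (side setT id T b)]].

Let good_radial G b : radial G -> good (side setT id (star G) b).
Proof.
move=> Gr; have [ne co] := radial_side_regular b Gr; split => //.
exists (star G), b; split => //; [exact: radial_msurface|exact: homeomorphic_refl].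
Qed.

Let good_cell A : homeomorphic A [set: Y * R] -> good A.
Proof.
have ur : radial (fun _ : E => 1 : R).
  by split => // [|u _]; [exists 1|cont].
have YE : homeomorphic [set: Y * R] [set: E].
  apply: (@homeomorphicI _ _ _ _ (fun p : Y * R => rv_cons p.2 (rv_cons p.1.1 p.1.2))
    (fun u : E => ((rv_tail u 0 ord0, rv_tail (rv_tail u)), u 0 ord0))) => //.
  - move=> p _; apply: (@cont_rv_cons _ _ _ (fun p : Y * R => p.2)
      (fun p : Y * R => rv_cons p.1.1 p.1.2)); first by cont.
    by apply: (@cont_rv_cons _ _ _ (fun p : Y * R => p.1.1) (fun p : Y * R => p.1.2)); cont.
  - move=> u _.
    have ctl : {for u, continuous (fun v : E => rv_tail v)}.
      by apply: (@cont_rv_tail _ _ _ (fun v : E => v)); cont.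
    cont; first [exact: coord_continuous
      |exact: (@cont_coord _ _ _ _ (fun v : E => rv_tail v))
      |exact: (@cont_rv_tail _ _ _ (fun v : E => rv_tail v))].
  - by move=> [[x z] t] _; rewrite /= !rv_tail_cons !rv_cons0.
  - by move=> u _; rewrite /= !rv_cons_tail.
move=> AY; have := homeomorphic_trans AY YE => AE.
have ES : homeomorphic A (side setT id (star (fun _ : E => 1)) false).
  rewrite radial_side//; apply: homeomorphic_trans AE _.
  exact: homeomorphic_sym (open_ball_homeomorphic _).
have [ne co] := radial_side_regular false ur.
split.
- exact: homeomorphic_nonempty (homeomorphic_sym ES) ne.
- exact: homeomorphic_connected (homeomorphic_sym ES) co.
- exists (star (fun _ : E => 1)), false; split => //; exact: radial_msurface.
Qed.

Let region_mixed (e : 'I_n.+1 -> bool) i0 j0 : e i0 -> ~~ e j0 ->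
  region setT id S e =
  sector n X f (fun i => ~~ e (inord i))
    (fun t => (if e (inord n) then -1 else 1) * (eta * t / M))
    (if e (inord n) then -1 else 1).
Proof.
move=> ei ej; rewrite regionE.
have C_M : C = M + 1 by rewrite /C /M -addn1 natrD.
have in_height (u : E) t : `|u| = t + C -> forall i : nat,
    (if e (inord i) then radius i u < `|u| else `|u| < radius i u) =
    (if e (inord i) then height i u < t else t < height i u).
  by move=> -> i; rewrite /shell_radius [t + C]addrC !ltrD2l.
have last (u : E) t : `|u| = t + C -> `|t| < M ->
    (if e (inord n) then height n u < t else t < height n u) =
    ((if e (inord n) then -1 else 1) * (eta * t / M) * `|u| <
     (if e (inord n) then -1 else 1) * equator u).
  move=> ut tM; have u0 : 0 < `|u|.
    by rewrite ut; move: tM; rewrite ltr_norml C_M; lra.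
  have eu : 0 < eta * `|u| by rewrite mulr_gt0.
  have tE : eta * t / M * `|u| = t * (eta * `|u|) / M by ring.
  rewrite /shell_height ltnn; case: (e _).
    rewrite clip_lt// ltr_pdivrMr// mulN1r mulNr mulN1r ltrN2 tE.
    by rewrite ltr_pdivlMr// [equator u * M]mulrC.
  by rewrite clip_gt// ltr_pdivlMr// !mul1r tE ltr_pdivrMr// [equator u * M]mulrC.
apply/seteqP; split => u H.
  pose t := `|u| - C; have ut : `|u| = t + C by rewrite /t subrK.
  have {}H i : (i <= n)%N -> if e (inord i) then height i u < t else t < height i u.
    by move=> ni; rewrite -(in_height u t ut); exact: H.
  have bd i := shell_height_bound bs u (i := i).
  have tM : `|t| < M.
    have hi := H i0 (ltn_ord i0); have hj := H j0 (ltn_ord j0).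
    move: hi hj; rewrite !inord_val ei (negbTE ej) => hi hj.
    have := bd i0 (ltn_ord i0); have := bd j0 (ltn_ord j0).
    have iM : i0.+1%:R <= M by rewrite ler_nat ltn_ord.
    have jM : j0.+1%:R <= M by rewrite ler_nat ltn_ord.
    by rewrite !ler_norml ltr_norml; lra.
  split; last by rewrite -/t -last//; exact: H.
  split => //= i iN; rewrite -/t; have := H i (ltnW iN).
  by rewrite /shell_height iN if_neg.
move: H => [[/= tM H] la] i; have ut : `|u| = (`|u| - C) + C by rewrite subrK.
rewrite (in_height u _ ut) leq_eqVlt => /predU1P[->|iN]; first by rewrite last.
by have := H i iN; rewrite /shell_height iN if_neg.
Qed.

Let region_good (e : 'I_n.+1 -> bool) : good (region setT id S e).
Proof.
have [/existsP[i0 ei]|/existsPn ei] := boolP [exists i, e i]; last first.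
  have [G Gr GE] := radial_big_min radius_radial.
  suff -> : region setT id S e = side setT id (star G) false by exact: good_radial.
  rewrite regionE radial_side//; apply/seteqP; split => u /=.
    by move=> H; apply/GE => i ni; have := H i ni; rewrite (negbTE (ei _)).
  by move=> /GE H i ni; rewrite (negbTE (ei _)); exact: H.
have [/existsP[j0 ej]|/existsPn ej] := boolP [exists i, ~~ e i]; last first.
  have [G Gr GE] := radial_big_max radius_radial.
  suff -> : region setT id S e = side setT id (star G) true by exact: good_radial.
  rewrite regionE radial_side//; apply/seteqP; split => u /=.
    by move=> H; apply/GE => i ni; have := H i ni; rewrite (negbNE (ej _)).
  by move=> /GE H i ni; rewrite (negbNE (ej _)); exact: H.
rewrite (region_mixed ei ej); apply: good_cell.
apply: homeomorphic_trans (bs_cell bs (fun i => ~~ e (inord i))).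
have sg1 : `|(if e (inord n) then -1 else 1 : R)| = 1.
  by case: ifP => _; rewrite ?normrN1 ?normr1.
apply: (sector_cell bs).
- by apply: forall_cont => t; cont; rewrite gt_eqF.
- move=> t tM; rewrite normrM sg1 mul1r normrM normfV (gtr0_norm M0) normrM.
  by rewrite (gtr0_norm eta0) -mulrA gtr_pMr// ltr_pdivrMr// mul1r.
- by case: ifP => _; rewrite ?mulrNN mulr1.
Qed.

Let shell_pair i j : (j < i)%N -> (i <= n)%N ->
  funion (@is_msurface R d.+1 d.+2) (shell n X f i `&` shell n X f j).
Proof.
move=> ji; rewrite leq_eqVlt => /predU1P[iE|]; last exact: (shell_pair_old bs).
by move: ji; rewrite iE; exact: (shell_pair_new bs).
Qed.

Let shell_triple i j k : (k < j)%N -> (j < i)%N -> (i <= n)%N ->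
  funion (@is_msurface R d d.+2) (shell n X f i `&` shell n X f j `&` shell n X f k).
Proof.
move=> kj ji; rewrite leq_eqVlt => /predU1P[iE|]; last exact: (shell_triple_old bs).
by move: ji; rewrite iE; exact: (shell_triple_new bs).
Qed.

Let shell_quad i j k l : (l < k)%N -> (k < j)%N -> (j < i)%N -> (i <= n)%N ->
  shell n X f i `&` shell n X f j `&` shell n X f k `&` shell n X f l = set0.
Proof.
move=> lk kj ji; rewrite leq_eqVlt => /predU1P[iE|]; last exact: (shell_quad_old bs).
by move: ji; rewrite iE; exact: (shell_quad_new bs).
Qed.

Let shell_capE (s : seq nat) (i : nat) :
  \bigcap_(j in [set` i :: s]) shell n X f j =
  shell n X f i `&` \bigcap_(j in [set` s]) shell n X f j.
Proof.
apply/seteqP; split => u.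
  move=> H; split; first by apply: H; rewrite /= mem_head.
  by move=> j js; apply: H; rewrite /= in_cons js orbT.
by move=> [ui us] j /=; rewrite in_cons => /predU1P[->//|]; exact: us.
Qed.

Let shell_cap (s : seq nat) : s <> [::] -> sorted gtn s -> all (leq^~ n) s ->
  funion (@is_msurface R (d.+3 - size s) d.+2)
    (\bigcap_(i in [set` s]) shell n X f i).
Proof.
have cap0 : \bigcap_(i in [set` ([::] : seq nat)]) shell n X f i = setT.
  by rewrite set_nil bigcap_set0.
case: s => [//|i [|j [|k [|l s]]]] _ /=; rewrite !shell_capE.
- move=> _ /andP[ni _]; rewrite cap0 setIT subn1 /=; apply: funion1.
  exact: (radial_msurface (radius_radial ni)).
- move=> /andP[ji _] /andP[ni _]; rewrite cap0 setIT; exact: shell_pair.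
- move=> /and3P[ji kj _] /andP[ni _]; rewrite cap0 setIT setIA !subSS subn0.
  exact: shell_triple.
- move=> /and4P[ji kj lk _] /andP[ni _]; rewrite !setIA shell_quad// set0I.
  exact: funion0.
Qed.

Let shells_cap (A : {set 'I_n.+1}) : (0 < #|A|)%N ->
  finite_union_msurfaces (d.+3 - #|A|) (\bigcap_(i in [set` A]) S i).
Proof.
move=> A0; pose s := sort geq [seq val i | i <- enum A].
have ss : size s = #|A| by rewrite size_sort size_map cardE.
have sA i : (val i \in s) = (i \in A).
  by rewrite mem_sort (mem_map val_inj) mem_enum.
rewrite (_ : \bigcap_(i in _) _ = \bigcap_(i in [set` s]) shell n X f i); last first.
  apply/seteqP; split => u H i /=.
    by rewrite mem_sort => /mapP[j]; rewrite mem_enum => jA ->; exact: H.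
  by move=> iA; apply: H; rewrite /= sA.
apply: finite_union_funion; rewrite -ss; apply: shell_cap.
- by move=> s0; rewrite -ss s0 in A0.
- rewrite gtn_sorted_uniq_geq sort_uniq (map_inj_uniq val_inj) enum_uniq /=.
  by apply: sort_sorted => a b; exact: leq_total.
- by apply/allP => i; rewrite mem_sort => /mapP[j _ ->]; exact: ltn_ord j.
Qed.

Lemma shells_simple_venn : is_simple_venn d.+2 setT S.
Proof.
split; last first.
  by move=> k A k0 Ak; rewrite -Ak; apply: shells_cap; rewrite Ak.
exists setT, id, id; split.
- split; first by left.
  by split => //; split; apply: continuous_subspaceT => u; exact: cvg_id.
- by move=> i; split => //; apply/radial_msurface/radius_radial; rewrite -ltnS.
- exact: region_good.
- move=> i j ij; have := @shells_cap [set i; j].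
  rewrite cards2 ij => /(_ isT); rewrite (_ : \bigcap_(_ in _) _ = S i `&` S j)//.
  apply/seteqP; split => u.
    by move=> H; split; apply: H; rewrite /= !inE eqxx ?orbT.
  by move=> [ui uj] k /=; rewrite !inE => /orP[]/eqP ->.
Qed.

End Venn.

Theorem theorem1 (R : realType) (m n : nat) (hm : (2 <= m)%N) (hn : (1 <= n)%N) :
  exists (N : nat) (X : set 'rV[R]_N) (S : 'I_n -> set 'rV[R]_N),
    is_simple_venn m X S.
Proof.
case: m hm => [|[|d]] // _; case: n hn => // n _.
have [X [f [eps bs]]] := @base_system_exists R d n.
by exists d.+2, setT; eexists; exact: shells_simple_venn bs.
Qed.
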